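(* Let $n\ge2$, let $\Omega\subset\mathbb{R}^n$ be a bounded domain, and let $p:\Omega\to\mathbb{R}$, numbers $\beta\ge\alpha>1$, $r_0\in(0,1)$ and a non-decreasing continuous function $\omega:[0,\infty)\to[0,\infty)$, differentiable on $(0,r_0]$, satisfy (a) $\alpha\le p(x)\le\beta$ for all $x\in\Omega$; (b) $|p(x)-p(y)|\le\omega(|x-y|/2)$ for all $x,y\in\Omega$; (c) $\omega'(r)\ge0$ for all $r\in(0,r_0]$; (d) $\omega(0)=0$ and $\omega(r_0)<1$. Assume further that $\omega(r_0)<\frac1{n-1}$. Then there is a constant $c=c(n,\beta)>0$ such that for all $$0<r\le r_0,\qquad 1\le q\le\min\Big\{\alpha,\ \frac{n}{n-1}-\omega(r_0)\Big\},$$ and every ball $B_r=B_r(x_0)\subset\Omega$, the inequality $$\frac1{|B_r|}\int_{B_r}\left|\frac{u-\lambda}{r}\right|^{p(x)}dx\le c+c\left(\frac1{|B_r|}\int_{B_r}|\nabla u|^{\frac{p(x)}{q}}dx\right)^{q+\omega(r)}$$ holds for all $u\in W^{1,p(x)}(B_r)$ with $\lambda=\frac1{|B_r|}\int_{B_r}u\,dx$. Moreover, given a constant $\gamma\in(0,1)$, the same inequality holds with $\lambda=0$ and with a constant $c=c(n,\beta,\gamma)>0$ for all $u\in W^{1,p(x)}(B_r)$ satisfying $|\{x\in B_r:u(x)=0\}|\ge\gamma|B_r|$.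
   Context: $B_r(x_0)$ is the ball of radius $r$ centered at $x_0$. $W^{1,p(x)}(B_r)$ is the variable exponent Sobolev space of functions $u\in W^{1,1}(B_r)$ with $\int_{B_r}(|u|^{p(x)}+|\nabla u|^{p(x)})dx<\infty$. The notation $c(n,\beta)$, $c(n,\beta,\gamma)$ means that the constant depends only on the listed quantities. *)

(* Defs.v *)
From HB Require Import structures.
From mathcomp Require Import all_boot all_order all_algebra.
From mathcomp Require Import all_classical all_reals all_analysis.

Set Implicit Arguments.
Unset Strict Implicit.
Unset Printing Implicit Defensive.
Import Order.TTheory GRing.Theory Num.Theory.
Import numFieldNormedType.Exports.
Local Open Scope classical_set_scope.
Local Open Scope ring_scope.

(* The Borel sigma-algebra of R^n = 'rV[R]_n, as the product sigma-algebra: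
   the smallest one making the coordinates measurable. *)
Definition measure_rV_display : measure_display -> measure_display.
Proof. exact. Qed.

Section measurable_rV.
Context {d} {T : measurableType d}.
Variable n : nat.

Let coords : 'I_n -> 'rV[T]_n -> T := fun i x => x ord0 i.

Let rV_set0 : g_sigma_preimage coords set0.
Proof. exact: sigma_algebra0. Qed.

Let rV_setC A : g_sigma_preimage coords A -> g_sigma_preimage coords (~` A).
Proof. exact: sigma_algebraC. Qed.

Let rV_bigcup (F : _^nat) : (forall i, g_sigma_preimage coords (F i)) ->
  g_sigma_preimage coords (\bigcup_i (F i)).
Proof. exact: sigma_algebra_bigcup. Qed.

HB.instance Definition _ := @isMeasurable.Build (measure_rV_display d)
  'rV[T]_n (g_sigma_preimage coords) rV_set0 rV_setC rV_bigcup.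

End measurable_rV.

Lemma measurable_rV_coord d (T : measurableType d) n (i : 'I_n) :
  measurable_fun [set: 'rV[T]_n] (fun x => x ord0 i).
Proof.
move=> _ Y mY; rewrite setTI; apply: sub_sigma_algebra => /=.
rewrite -bigcup_seq/=; exists i => /=; first by rewrite mem_index_enum.
by exists Y => //; rewrite setTI.
Qed.

Lemma measurable_fun_rVP d1 d2 (T1 : measurableType d1)
    (T2 : measurableType d2) n (f : T1 -> 'rV[T2]_n) :
  (forall i, measurable_fun [set: T1] (fun x => f x ord0 i)) ->
  measurable_fun [set: T1] f.
Proof.
move=> mf; suff : g_sigma_preimage (fun i x => f x ord0 i) `<=` measurable.
  rewrite (_ : (fun i x => _) =
    (fun i => (fun v : 'rV[T2]_n => v ord0 i) \o f)) //.
  by rewrite g_sigma_preimage_comp => h _ A mA; apply: h; exists A.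
apply: smallest_sub; first exact: sigma_algebra_measurable.
rewrite -bigcup_seq => A [i _] [B mB <-]; exact: mf.
Qed.

Section lebesgue_rVS.
Context {R : realType} (n : nat).
Variable mu : {sigma_finite_measure set 'rV[R]_n -> \bar R}.

Definition rVcons (p : R * 'rV[R]_n) : 'rV[R]_n.+1 :=
  row_mx (p.1)%:M p.2 : 'rV_(1 + n).

Definition rVuncons (x : 'rV[R]_n.+1) : R * 'rV[R]_n :=
  (x ord0 ord0, rsubmx (x : 'rV_(1 + n))).

Lemma rVconsK : cancel rVcons rVuncons.
Proof.
move=> [a v]; rewrite /rVuncons /rVcons /=; congr pair; last exact: row_mxKr.
have := @row_mxEl R 1 1 n a%:M v ord0 ord0.
rewrite [X in _ = X](_ : _ = a); last by rewrite mxE eqxx mulr1n.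
move=> {2}<-; congr (row_mx _ _ _ _); exact/val_inj.
Qed.

Lemma measurable_rVcons : measurable_fun [set: R * 'rV[R]_n] rVcons.
Proof.
apply: measurable_fun_rVP => i.
case: (split_ordP (i : 'I_(1 + n))) => j ->.
  rewrite (_ : (fun x => _) = fst) //; apply/funext => x /=.
  apply: etrans (@row_mxEl R 1 1 n (x.1)%:M x.2 ord0 j) _.
  by rewrite (ord1 j) mxE eqxx mulr1n.
rewrite (_ : (fun x => _) = (fun v : 'rV[R]_n => v ord0 j) \o snd).
  apply: measurableT_comp => //; exact: measurable_rV_coord.
by apply/funext => x; exact: (@row_mxEr R 1 1 n).
Qed.

Lemma measurable_rVuncons : measurable_fun [set: 'rV[R]_n.+1] rVuncons.
Proof.
apply: measurable_fun_pair; first exact: measurable_rV_coord.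
apply: measurable_fun_rVP => i.
rewrite (_ : (fun x => _) = fun x : 'rV[R]_n.+1 => x ord0 (rshift 1 i)).
  exact: measurable_rV_coord.
by apply/funext => x; rewrite mxE.
Qed.

Definition lebesgue_rVS : set 'rV[R]_n.+1 -> \bar R :=
  pushforward (lebesgue_measure \x mu)%E rVcons.

Let lebesgue_rVS0 : lebesgue_rVS set0 = 0%E.
Proof. by rewrite /lebesgue_rVS /pushforward preimage_set0 measure0. Qed.

Let lebesgue_rVS_ge0 A : (0 <= lebesgue_rVS A)%E.
Proof. exact: (measure_ge0 (lebesgue_measure \x mu)%E). Qed.

Let lebesgue_rVS_sigma_additive : semi_sigma_additive lebesgue_rVS.
Proof.
have mf := measurable_rVcons.
move=> F mF tF mUF; rewrite /lebesgue_rVS /pushforward preimage_bigcup.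
apply: (@measure_semi_sigma_additive _ _ _ (lebesgue_measure \x mu)%E).
- by move=> k; rewrite -[X in measurable X]setTI; exact: mf.
- apply/trivIsetP => /= i j _ _ ij; rewrite -preimage_setI.
  by move/trivIsetP : tF => /(_ _ _ _ _ ij) ->//; rewrite preimage_set0.
- by rewrite -preimage_bigcup -[X in measurable X]setTI; exact: mf.
Qed.

HB.instance Definition _ := isMeasure.Build _ _ _ lebesgue_rVS
  lebesgue_rVS0 lebesgue_rVS_ge0 lebesgue_rVS_sigma_additive.

Let lebesgue_rVS_sigma_finite : sigma_finite setT lebesgue_rVS.
Proof.
have /sigma_finiteP[F [TF ndF Foo]] := sigma_finiteT (@lebesgue_measure R).
have /sigma_finiteP[G [TG ndG Goo]] := sigma_finiteT mu.
exists (fun k => rVuncons @^-1` (F k `*` G k)).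
  rewrite -preimage_bigcup (_ : \bigcup_i _ = setT) ?preimage_setT//.
  apply/seteqP; split => // -[x y] _.
  have [i _ Fx] : (\bigcup_i F i) x by rewrite -TF.
  have [j _ Gy] : (\bigcup_i G i) y by rewrite -TG.
  exists (maxn i j) => //; split.
  - by move: x Fx; exact/subsetPset/ndF/leq_maxl.
  - by move: y Gy; exact/subsetPset/ndG/leq_maxr.
move=> k; have [mF Fk] := Foo k; have [mG Gk] := Goo k; split.
  rewrite -[X in measurable X]setTI; apply: measurable_rVuncons => //.
  exact: measurableX.
rewrite /lebesgue_rVS /pushforward -comp_preimage (_ : _ \o _ = id).
  by rewrite product_measure1E// lte_mul_pinfty// ge0_fin_numE.
exact/funext/rVconsK.
Qed.

HB.instance Definition _ := Measure_isSigmaFinite.Build _ _ _ lebesgue_rVS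
  lebesgue_rVS_sigma_finite.

End lebesgue_rVS.

Fixpoint lebesgue_rV (R : realType) (n : nat) :
    {sigma_finite_measure set 'rV[R]_n -> \bar R} :=
  if n is m.+1 then lebesgue_rVS (lebesgue_rV R m)
  else \d_(0 : 'rV[R]_0).

Lemma lebesgue_rV_box (R : realType) (n : nat) (A : 'I_n -> set R) :
  (forall i, measurable (A i)) ->
  lebesgue_rV R n [set x | forall i, A i (x ord0 i)] =
  (\prod_(i < n) lebesgue_measure (A i))%E.
Proof.
elim: n A => [|n IH] A mA /=.
  by rewrite big_ord0 diracE mem_set//= => -[].
pose B := [set x : 'rV[R]_n | forall i, A (lift ord0 i) (x ord0 i)].
have mB : measurable B.
  rewrite (_ : B = \bigcap_(i in [set: 'I_n])
      ((fun x : 'rV[R]_n => x ord0 i) @^-1` A (lift ord0 i))).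
    apply: fin_bigcap_measurable => // i _.
    by rewrite -[X in measurable X]setTI; exact: measurable_rV_coord.
  by apply/seteqP; split => x h i; [move=> _; exact: h|exact: (h i)].
transitivity (lebesgue_rVS (lebesgue_rV R n)
    (@rVuncons R n @^-1` (A ord0 `*` B))).
  congr (lebesgue_rVS _ _).
  apply/seteqP; split => x /= h.
    split; first exact: h.
    by move=> i /=; rewrite mxE (_ : rshift 1 i = lift ord0 i)//; exact/val_inj.
  move=> i; have [j ->|->] := unliftP ord0 i; last exact: h.1.
  have /= := h.2 j; rewrite mxE.
  by rewrite (_ : rshift 1 j = lift ord0 j)//; exact/val_inj.
rewrite /lebesgue_rVS /pushforward -comp_preimage (_ : _ \o _ = id).
  rewrite product_measure1E//; last exact: mA.
  rewrite big_ord_recl; congr (_ * _)%E.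
  exact: (IH (fun i => A (lift ord0 i))).
exact/funext/rVconsK.
Qed.

Section euclidean_space.
Context {R : realType} {n : nat}.
Local Notation mu := (lebesgue_rV R n).
Implicit Types (U : set 'rV[R]_n) (x : 'rV[R]_n).

(* The library norm on 'rV[R]_n is the sup norm. *)
Definition enorm x : R := Num.sqrt (\sum_(i < n) x ord0 i ^+ 2).

Definition eball x0 (r : R) : set 'rV[R]_n := [set x | enorm (x - x0) < r].

Definition bounded_domain U : Prop :=
  [/\ U !=set0, open U, connected U & bounded_set U].

Definition partial (i : 'I_n) (f : 'rV[R]_n -> R) : 'rV[R]_n -> R :=
  fun x => 'D_(delta_mx ord0 i) f x.

(* C^oo: all iterated partial derivatives, including f itself, are
   differentiable everywhere. *)
Definition smooth (f : 'rV[R]_n -> R) : Prop :=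
  forall (s : seq 'I_n) x, differentiable (foldr partial f s) x.

Definition test_function U (phi : 'rV[R]_n -> R) : Prop :=
  let supp := closure [set x | phi x != 0] in
  [/\ smooth phi, compact supp & supp `<=` U].

Definition weak_gradient U (u : 'rV[R]_n -> R) (g : 'rV[R]_n -> 'rV[R]_n) :
    Prop :=
  forall phi, test_function U phi -> forall i : 'I_n,
    \int[mu]_(x in U) (u x * partial i phi x) =
    - \int[mu]_(x in U) (g x ord0 i * phi x).

(* Sobolev functions are handled together with (a representative of) their
   weak gradient g, which is unique almost everywhere. Integrability includes
   Borel measurability on U: u and g are Borel representatives of their
   classes modulo null sets. *)
Definition sobolev11 U (u : 'rV[R]_n -> R) (g : 'rV[R]_n -> 'rV[R]_n) : Prop :=
  [/\ mu.-integrable U (fun x => (u x)%:E),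
      forall i : 'I_n, mu.-integrable U (fun x => (g x ord0 i)%:E) &
      weak_gradient U u g].

Definition sobolev1 U (p : 'rV[R]_n -> R) (u : 'rV[R]_n -> R)
    (g : 'rV[R]_n -> 'rV[R]_n) : Prop :=
  sobolev11 U u g /\
  (\int[mu]_(x in U) (`|u x| `^ p x + enorm (g x) `^ p x)%:E < +oo)%E.

Definition eaverage U (f : 'rV[R]_n -> \bar R) : \bar R :=
  ((fine (mu U))^-1%:E * \int[mu]_(x in U) f x)%E.

Definition average U (f : 'rV[R]_n -> R) : R :=
  (fine (mu U))^-1 * \int[mu]_(x in U) f x.

(* Only the values of p on Omega and of omega on [0, +oo[ are constrained. *)
Record variable_exponent (Omega : set 'rV[R]_n) (p : 'rV[R]_n -> R)
    (alpha beta r0 : R) (omega : R -> R) : Prop := {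
  ve_alpha_gt1 : 1 < alpha ;
  ve_alpha_le_beta : alpha <= beta ;
  ve_r0 : 0 < r0 < 1 ;
  ve_omega_ge0 : forall t : R, 0 <= t -> 0 <= omega t ;
  ve_omega_nondecreasing :
    forall s t : R, 0 <= s -> s <= t -> omega s <= omega t ;
  ve_omega_continuous : {within `[0, +oo[%classic, continuous omega} ;
  ve_omega_derivable : forall r : R, 0 < r <= r0 -> derivable omega r 1 ;
  ve_p_bounds : forall x, Omega x -> alpha <= p x <= beta ;
  ve_p_modulus : forall x y, Omega x -> Omega y ->
    `|p x - p y| <= omega (enorm (x - y) / 2) ;
  ve_omega_derive_ge0 : forall r : R, 0 < r <= r0 -> 0 <= derive1 omega r ;
  ve_omega0 : omega 0 = 0 ;
  ve_omega_r0_lt1 : omega r0 < 1 }.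

End euclidean_space.

(* Main.v *)
(* For almost every x, u is absolutely continuous along the segment from x to
   x + h; this follows from the weak gradient identity and the fundamental
   lemma of the calculus of variations.  If u <= k at x and u >= l at x + h,
   the segment therefore collects at least l - k of |Du| inside the layer
   {k < u < l}.  Integrating over x and h gives, with F = {u >= l},
     (l - k) |{u <= k}| |F| <= C r^n |F|^(1/n) \int_{k < u < l} |Du|,
   a weak-type isoperimetric estimate.  Applying it to the levels m + r D 2^j
   and summing over j (Maz'ya's truncation) yields the Sobolev-Poincare
   inequality with constant exponents s and P whenever 1/s <= 1/n + 1/P.
   For a variable exponent, take p1 = inf p on the ball, s = p1/q,
   P = max (p1 + omega r) (n/(n-1)) and D^s = 1 + (average of |Du|^(p/q)):
   then D^(p1 + omega r) is at most (1 + average)^(q + omega r). *)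
Require Import Defs.
From HB Require Import structures.
From mathcomp Require Import all_boot all_order all_algebra.
From mathcomp Require Import all_classical all_reals all_analysis measurable_realfun ring lra.

Set Implicit Arguments.
Unset Strict Implicit.
Unset Printing Implicit Defensive.
Import Order.TTheory GRing.Theory Num.Theory.
Import numFieldNormedType.Exports.
Local Open Scope classical_set_scope.
Local Open Scope ring_scope.

(** * Lebesgue measure, cubes and balls *)

(** The power [|F|^(1/n)] arises by freezing the intermediate point [z = x + t h]: the admissible h
    satisfy [z + (1 - t) h] in F, a set of measure at most the minimum of [(4r)^n] and
    [|F| / (1 - t)^n], and the integral of this minimum over t is at most of order
    [r^(n-1) |F|^(1/n)]. The bound [q <= n/(n-1) - omega r0] is what yields [1/s <= 1/n + 1/P]
    although P is as large as [p1 + omega r]; the maximum with [n/(n-1)] secures [P (1 - 1/n) >= 1],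
    which the absorption of the sum over levels uses. Two obstacles shape the details. The increment
    identity along a segment holds, for each length, off a null set that depends on the length, so
    Fubini has to turn it into a statement about almost every whole segment. And the final constants
    may not depend on p, alpha, q or r: they are monotone in the exponent and are evaluated at the
    upper bound [max (beta + 1) 2]. *)

Section lebesgue_affine.
Context {R : realType}.
Local Notation mu1 := (@lebesgue_measure R).

Lemma measurable_affine (a c : R) : measurable_fun [set: R] (fun x => a + c * x).
Proof.
by apply: measurable_funD => //; apply: measurable_funM => //.
Qed.

(** By uniqueness: c times the image of [mu1] under the affine map gives every half-open interval
    its length, hence is [mu1]. *)
Lemma lebesgue_measure_affine (a c : R) (A : set R) : 0 < c -> measurable A ->
  mu1 ((fun x => a + c * x) @^-1` A) = (c^-1%:E * mu1 A)%E.
Proof.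
move=> c0 mA; pose f : measurableTypeR R -> measurableTypeR R := fun x : R => a + c * x.
have mf : measurable_fun setT f := measurable_affine a c.
pose fM := measure_function_pushforward__canonical__measure_function_Measure mu1 mf.
pose m : {measure set (measurableTypeR R) -> \bar R} := mscale (NngNum (ltW c0)) fM.
have mE : forall X, measurable X -> mu1 X = m X.
  apply: lebesgue_measure_unique => X [[x y] /= xy <-].
  rewrite /m /mscale /= /pushforward.
  rewrite (_ : _ @^-1` _ = `](x - a) / c, (y - a) / c]%classic); last first.
    apply/seteqP; split => z /=; rewrite !in_itv /= /f ltr_pdivrMr// ler_pdivlMr// ltrBlDl lerBrDl mulrC//.
  rewrite !lebesgue_measure_itv/= !lte_fin ltr_pM2r ?invr_gt0// ltrD2r.
  case: ifPn => _; last by rewrite mule0.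
  rewrite -!EFinB -EFinM; congr EFin.
  by rewrite -mulrBl mulrCA divff ?gt_eqF// mulr1 opprB addrA subrK.
have -> : mu1 ((fun x => a + c * x) @^-1` A) = pushforward mu1 f A by [].
have -> : mu1 A = m A by exact: mE.
by rewrite /m /mscale /= muleA -EFinM mulVf ?gt_eqF// mul1e.
Qed.

Lemma ge0_integral_affine1 (a c : R) (f : R -> \bar R) : 0 < c ->
  measurable_fun setT f -> (forall x, 0 <= f x)%E ->
  (\int[mu1]_x f (a + c * x)%R = c^-1%:E * \int[mu1]_x f x)%E.
Proof.
move=> c0 mf f0.
pose g : measurableTypeR R -> measurableTypeR R := fun x : R => a + c * x.
have mg : measurable_fun setT g := measurable_affine a c.
transitivity (\int[pushforward mu1 g]_x f x)%E.
  by rewrite ge0_integral_pushforward ?preimage_setT.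
have ci0 : 0 <= c^-1 by rewrite invr_ge0 ltW.
transitivity (\int[mscale (NngNum ci0) mu1]_x f x)%E; last first.
  by rewrite ge0_integral_mscale.
apply: eq_measure_integral => A mA _.
by rewrite /mscale /= /pushforward lebesgue_measure_affine.
Qed.

Lemma measurable_rV_affine n (a : 'rV[R]_n) (c : R) :
  measurable_fun setT (fun x : 'rV[R]_n => a + c *: x).
Proof.
apply: measurable_fun_rVP => i.
rewrite (_ : (fun x => _) = (fun x => a ord0 i + c * x) \o (fun x : 'rV[R]_n => x ord0 i)).
  by apply: measurableT_comp; [exact: measurable_affine|exact: measurable_rV_coord].
by apply/funext => x; rewrite !mxE.
Qed.

Lemma rVcons0 n (p : R * 'rV[R]_n) : rVcons p ord0 ord0 = p.1.
Proof. by have [] := congr1 fst (@rVconsK R n p). Qed.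

Lemma rVconsS n (p : R * 'rV[R]_n) j : rVcons p ord0 (lift ord0 j) = p.2 ord0 j.
Proof.
have /rowP/(_ j) := congr1 snd (@rVconsK R n p); rewrite mxE => <-.
by congr (rVcons _ _ _); exact/val_inj.
Qed.

Lemma rVcons_affine n (a : 'rV[R]_n.+1) (c x : R) (v : 'rV[R]_n) :
  a + c *: rVcons (x, v) =
  rVcons ((rVuncons a).1 + c * x, (rVuncons a).2 + c *: v).
Proof.
apply/rowP => i; rewrite [LHS]mxE [X in _ + X]mxE.
have [j ->|->] := unliftP ord0 i; last by rewrite !rVcons0.
rewrite !rVconsS /= !mxE; congr (a _ _ + _); exact/val_inj.
Qed.

(** Induction through the product structure: the sections contribute [c ^- n] and the first
    coordinate one more [c^-1]. The case [c = 1] is translation invariance; [c = 1 - t] rescales F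
    in [level_section]. *)
Lemma lebesgue_rV_affine n (a : 'rV[R]_n) (c : R) (A : set 'rV[R]_n) : 0 < c ->
  measurable A ->
  (lebesgue_rV R n ((fun x => a + c *: x)%R @^-1` A) =
  (c ^- n)%R%:E * lebesgue_rV R n A)%E.
Proof.
elim: n a A => [a A c0 mA|n IH a A c0 mA] /=.
  rewrite expr0 invr1 mul1e !diracE; congr ((nat_of_bool _)%:R%:E).
  apply/idP/idP; rewrite !inE /=; first by rewrite (thinmx0 (a + _)).
  by rewrite (thinmx0 (a + _)).
rewrite /lebesgue_rVS /pushforward /product_measure1 /=.
set B := @rVcons R n @^-1` A.
have mB : measurable B.
  by rewrite -[B]setTI; exact: measurable_rVcons.
have -> : @rVcons R n @^-1` ((fun x => a + c *: x) @^-1` A) =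
    [set p | B ((rVuncons a).1 + c * p.1, (rVuncons a).2 + c *: p.2)].
  by apply/seteqP; split => -[x v] /=; rewrite /B/= rVcons_affine.
under eq_integral => x _.
  rewrite (_ : xsection _ x = (fun v => (rVuncons a).2 + c *: v) @^-1`
    (xsection B ((rVuncons a).1 + c * x))); last first.
    by apply/seteqP; split => v /=; rewrite /xsection /= !inE.
  rewrite IH//; last exact: measurable_xsection.
  over.
have mg := measurable_fun_xsection (lebesgue_rV R n) mB.
have mg' : measurable_fun setT
   (fun x : R => lebesgue_rV R n (xsection B ((rVuncons a).1 + c * x))).
  by apply: (measurableT_comp mg); exact: measurable_affine.
rewrite (ge0_integralZl mu1 measurableT mg'); [|by []|]; last first.
  by rewrite lee_fin invr_ge0 exprn_ge0// ltW.
rewrite (ge0_integral_affine1 _ c0 mg)//.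
by rewrite muleA -EFinM -invfM exprS mulrC.
Qed.

Lemma ge0_integral_rV_translate n (a : 'rV[R]_n) (f : 'rV[R]_n -> \bar R) :
  measurable_fun setT f -> (forall x, 0 <= f x)%E ->
  (\int[lebesgue_rV R n]_x f (x + a)%R = \int[lebesgue_rV R n]_x f x)%E.
Proof.
move=> mf f0; pose g : 'rV[R]_n -> 'rV[R]_n := fun x => a + 1 *: x.
have mg : measurable_fun setT g := measurable_rV_affine a 1.
transitivity (\int[pushforward (lebesgue_rV R n) g]_x f x)%E.
  rewrite ge0_integral_pushforward ?preimage_setT//.
  by apply: eq_integral => x _; rewrite /g /= scale1r addrC.
apply: eq_measure_integral => A mA _.
apply: etrans (lebesgue_rV_affine a ltr01 mA) _.
by rewrite expr1n invr1 mul1e.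
Qed.

Lemma measurable_rV_translate n (a : 'rV[R]_n) :
  measurable_fun setT (fun x : 'rV[R]_n => x + a).
Proof.
rewrite (_ : (fun x => _) = (fun x => a + 1 *: x)); first exact: measurable_rV_affine.
by apply/funext => x; rewrite scale1r addrC.
Qed.

Lemma integral_rV_translate n (a : 'rV[R]_n) (f : 'rV[R]_n -> \bar R) :
  measurable_fun setT f ->
  (\int[lebesgue_rV R n]_x f (x + a)%R = \int[lebesgue_rV R n]_x f x)%E.
Proof.
move=> mf; rewrite [LHS]integralE [RHS]integralE; congr (_ - _)%E.
- rewrite -[RHS](ge0_integral_rV_translate a)//; last exact: measurable_funepos.
  by apply: eq_integral => x _; rewrite !funeposE.
- rewrite -[RHS](ge0_integral_rV_translate a)//; last exact: measurable_funeneg.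
  by apply: eq_integral => x _; rewrite !funenegE.
Qed.

Lemma integrable_rV_translate n (a : 'rV[R]_n) (f : 'rV[R]_n -> \bar R) :
  (lebesgue_rV R n).-integrable setT f ->
  (lebesgue_rV R n).-integrable setT (fun x => f (x + a)).
Proof.
move=> /integrableP[mf foo]; apply/integrableP; split.
  exact: (measurableT_comp mf (measurable_rV_translate a)).
rewrite (ge0_integral_rV_translate a (f := fun x => `|f x|%E))//.
exact: measurableT_comp.
Qed.

(** The open ball of the sup norm. Its measure is explicit, and the volume of [eball] is only ever
    compared with it. *)
Definition rV_cube n (a : 'rV[R]_n) (e : R) : set 'rV[R]_n :=
  [set x | forall i, `|x ord0 i - a ord0 i| < e].

Lemma rV_cubeE n (a : 'rV[R]_n) (e : R) : rV_cube a e =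
  [set x | forall i, `]a ord0 i - e, a ord0 i + e[%classic (x ord0 i)].
Proof.
apply/seteqP; split => x /= h i; have := h i.
  by rewrite /= in_itv /= ltr_distl.
by rewrite /= in_itv /= ltr_distl.
Qed.

Lemma measurable_rV_forall n (A : 'I_n -> set R) :
  (forall i, measurable (A i)) ->
  measurable [set x : 'rV[R]_n | forall i, A i (x ord0 i)].
Proof.
move=> mA; rewrite (_ : mkset _ = \bigcap_(i in [set: 'I_n])
    ((fun x : 'rV[R]_n => x ord0 i) @^-1` A i)).
  apply: fin_bigcap_measurable => // i _.
  by rewrite -[X in measurable X]setTI; exact: measurable_rV_coord.
by apply/seteqP; split => x h i; [move=> _; exact: h|exact: (h i)].
Qed.

Lemma measurable_rV_cube n (a : 'rV[R]_n) (e : R) : measurable (rV_cube a e).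
Proof.
rewrite rV_cubeE.
exact: (measurable_rV_forall (A := fun i => `]a ord0 i - e, a ord0 i + e[%classic)).
Qed.

Lemma lebesgue_rV_cube n (a : 'rV[R]_n) (e : R) : 0 < e ->
  lebesgue_rV R n (rV_cube a e) = ((2 * e) ^+ n)%:E.
Proof.
move=> e0; rewrite rV_cubeE.
rewrite (lebesgue_rV_box (A := fun i => `]a ord0 i - e, a ord0 i + e[%classic))//.
under eq_bigr => i _.
  rewrite lebesgue_measure_itv /= lte_fin ltrD2l gtrN// -EFinD.
  rewrite (_ : _ + e - _ = 2 * e); last by ring.
  over.
by rewrite prodEFin big_const_ord iter_mulr_1.
Qed.

Lemma measurable_enorm d (T : measurableType d) (D : set T) n (f : T -> 'rV[R]_n) :
  (forall i, measurable_fun D (fun x => f x ord0 i)) ->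
  measurable_fun D (fun x => enorm (f x)).
Proof.
move=> mf; apply: (@measurableT_comp _ _ _ _ _ _ (@Num.sqrt R)).
  by apply: continuous_measurable_fun; exact: sqrt_continuous.
by apply: measurable_sum => i; exact: measurable_funX.
Qed.

Lemma measurable_eball n (a : 'rV[R]_n) (r : R) : measurable (eball a r).
Proof.
rewrite (_ : eball a r = (fun x => enorm (x - a)) @^-1` `]-oo, r[%classic); last first.
  by apply/seteqP; split => x /=; rewrite in_itv.
rewrite -[X in measurable X]setTI; apply: (measurable_enorm (D := setT)) => // i.
exact: (measurableT_comp (measurable_rV_coord i) (measurable_rV_translate (- a))).
Qed.

Lemma eballP n (a x : 'rV[R]_n) (r : R) : 0 < r ->
  eball a r x <-> \sum_(i < n) (x - a) ord0 i ^+ 2 < r ^+ 2.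
Proof.
move=> r0; rewrite /eball /= /enorm; set S := \sum_(i < n) _.
have -> : (Num.sqrt S < r) = (S < r ^+ 2); last by [].
rewrite -[in LHS](gtr0_norm r0) -sqrtr_sqr ltr_sqrt// exprn_gt0//.
Qed.

Lemma ler_coord_enorm n (x : 'rV[R]_n) i : `|x ord0 i| <= enorm x.
Proof.
rewrite -sqrtr_sqr ler_sqrt; last by apply: sumr_ge0 => j _; exact: sqr_ge0.
by rewrite (bigD1 i)//= lerDl; apply: sumr_ge0 => j _; exact: sqr_ge0.
Qed.

Lemma eball_sub_cube n (a : 'rV[R]_n) (r : R) : eball a r `<=` rV_cube a r.
Proof.
move=> x xr i; apply: le_lt_trans xr; rewrite -[X in `|X|](_ : (x - a) ord0 i = _).
  exact: ler_coord_enorm.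
by rewrite !mxE.
Qed.

(** The half-side [r / n], smaller than the sharp [r / sqrt n], keeps roots out: n squares of size
    [(r / n) ^+ 2] add up to at most [r ^+ 2]. *)
Lemma cube_sub_eball n (a : 'rV[R]_n) (r : R) : (0 < n)%N -> 0 < r ->
  rV_cube a (r / n%:R) `<=` eball a r.
Proof.
move=> n0 r0 x xr; apply/eballP => //.
have n0' : 0 < n%:R :> R by rewrite ltr0n.
apply: (@lt_le_trans _ _ (\sum_(i < n) (r / n%:R) ^+ 2)).
  apply: ltr_sum; first by apply/hasP; exists (Ordinal n0); rewrite ?mem_index_enum.
  move=> i _; rewrite !mxE; have := xr i; rewrite ltr_norml => /andP[].
  set z := _ - _; set e := _ / _ => *; nra.
rewrite sumr_const card_ord -[leLHS]mulr_natl expr_div_n mulrA ler_pdivrMr ?exprn_gt0//.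
rewrite mulrC ler_wpM2l ?sqr_ge0//.
by rewrite -natrX ler_nat expnS expn1 leq_pmull.
Qed.

Lemma sqr_convex (b c d t : R) : 0 <= t -> t <= 1 ->
  (b + t * (c - b) - d) ^+ 2 <= (1 - t) * (b - d) ^+ 2 + t * (c - d) ^+ 2.
Proof.
move=> t0 t1.
rewrite -subr_ge0.
have -> : (1 - t) * (b - d) ^+ 2 + t * (c - d) ^+ 2 - (b + t * (c - b) - d) ^+ 2
  = t * (1 - t) * (b - c) ^+ 2 by ring.
by rewrite mulr_ge0 ?sqr_ge0// mulr_ge0// subr_ge0.
Qed.

Lemma sqr_diff_le (b c d : R) :
  (b - c) ^+ 2 <= 2 * (b - d) ^+ 2 + 2 * (c - d) ^+ 2.
Proof.
rewrite -subr_ge0.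
have -> : 2 * (b - d) ^+ 2 + 2 * (c - d) ^+ 2 - (b - c) ^+ 2
  = (b + c - 2 * d) ^+ 2 by ring.
exact: sqr_ge0.
Qed.

Lemma eball_convex n (a x y : 'rV[R]_n) (r t : R) : 0 < r -> 0 <= t <= 1 ->
  eball a r x -> eball a r y -> eball a r (x + t *: (y - x)).
Proof.
move=> r0 /andP[t0 t1] /(eballP _ _ r0) xr /(eballP _ _ r0) yr; apply/(eballP _ _ r0).
set X := \sum_(i < n) _ in xr; set Y := \sum_(i < n) _ in yr.
apply: (@le_lt_trans _ _ ((1 - t) * X + t * Y)).
  rewrite !mulr_sumr -big_split /=; apply: ler_sum => i _; rewrite !mxE.
  exact: sqr_convex.
apply: (@le_lt_trans _ _ (Num.max X Y)); last by rewrite gt_max xr.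
have XM : X <= Num.max X Y by rewrite le_max lexx.
have YM : Y <= Num.max X Y by rewrite le_max lexx orbT.
apply: (@le_trans _ _ ((1 - t) * Num.max X Y + t * Num.max X Y)).
  by rewrite lerD// ler_wpM2l// subr_ge0.
by rewrite -mulrDl subrK mul1r.
Qed.

(** Summing [sqr_diff_le] over the coordinates gives [|x - y|^2 < 4 r^2], in place of the triangle
    inequality for [enorm]. *)
Lemma eball_diff n (a x y : 'rV[R]_n) (r : R) : 0 < r ->
  eball a r x -> eball a r y -> enorm (x - y) < 2 * r.
Proof.
move=> r0 /(eballP _ _ r0) xr /(eballP _ _ r0) yr.
have r20 : 0 < 2 * r by rewrite mulr_gt0.
suff : eball y (2 * r) x by [].
apply/(eballP _ _ r20).
set X := \sum_(i < n) _ in xr; set Y := \sum_(i < n) _ in yr.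
apply: (@le_lt_trans _ _ (2 * X + 2 * Y)).
  rewrite !mulr_sumr -big_split /=; apply: ler_sum => i _; rewrite !mxE.
  exact: sqr_diff_le.
by rewrite (_ : (2 * r) ^+ 2 = 2 * r ^+ 2 + 2 * r ^+ 2); [lra|ring].
Qed.

Lemma lebesgue_eball_le n (a : 'rV[R]_n) (r : R) : 0 < r ->
  (lebesgue_rV R n (eball a r) <= ((2 * r) ^+ n)%:E)%E.
Proof.
move=> r0; rewrite -(lebesgue_rV_cube a r0) le_measure ?inE//.
- exact: measurable_eball.
- exact: measurable_rV_cube.
- exact: eball_sub_cube.
Qed.

Lemma lebesgue_eball_ge n (a : 'rV[R]_n) (r : R) : (0 < n)%N -> 0 < r ->
  (((2 * (r / n%:R)) ^+ n)%:E <= lebesgue_rV R n (eball a r))%E.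
Proof.
move=> n0 r0; have rn0 : 0 < r / n%:R by rewrite divr_gt0// ltr0n.
rewrite -(lebesgue_rV_cube a rn0) le_measure ?inE//.
- exact: measurable_rV_cube.
- exact: measurable_eball.
- exact: cube_sub_eball.
Qed.

End lebesgue_affine.

(** * Smooth bump functions *)

Section smooth_cutoff.
Context {R : realType}.
Implicit Types (p : {poly R}) (c : R).

Definition expinv p c x : R := if 0 < x then p.[x^-1] * expR (- (c * x^-1)) else 0.

(** Differentiating [p(1/x) exp(-c/x)] gives [x^-2 (c p(1/x) - p'(1/x)) exp(-c/x)]; the factor
    [x^-2] becomes ['X^2]. *)
Definition expinv_deriv p c : {poly R} := c *: ('X^2 * p) - 'X^2 * p^`().

(** Half of the decay rate is spent on each factor y, as [y exp(-c y / 2) <= 2 / c]; the induction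
    hypothesis at rate [c / 2] absorbs the rest of the polynomial. *)
Lemma horner_expR_bounded p c : 0 < c ->
  exists M : R, forall y, 0 <= y -> `|p.[y] * expR (- (c * y))| <= M.
Proof.
elim/poly_ind: p c => [c _|p a IH c c0].
  by exists 0 => y _; rewrite horner0 mul0r normr0.
have c20 : 0 < c / 2 by rewrite divr_gt0.
have [M HM] := IH _ c20.
exists (M * (2 / c) + `|a|) => y y0.
have -> : (p * 'X + a%:P).[y] * expR (- (c * y)) =
    (p.[y] * expR (- (c / 2 * y))) * (y * expR (- (c / 2 * y))) +
    a * expR (- (c * y)).
  have -> : expR (- (c * y)) = expR (- (c / 2 * y)) * expR (- (c / 2 * y)).
    by rewrite -expRD; congr expR; field.
  move: (expR _) => e; rewrite hornerD hornerM hornerX hornerC; ring.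
apply: le_trans (ler_normD _ _) _; apply: lerD.
  rewrite normrM; apply: ler_pM => //; first exact: HM.
  rewrite ger0_norm ?mulr_ge0 ?expR_ge0// expRN ler_pdivrMr ?expR_gt0//.
  apply: (@le_trans _ _ (2 / c * (1 + c / 2 * y))).
    have -> : 2 / c * (1 + c / 2 * y) = 2 / c + y by field; rewrite gt_eqF.
    by rewrite lerDr divr_ge0// ltW.
  by rewrite ler_wpM2l ?expR_ge1Dx// divr_ge0// ltW.
rewrite normrM [X in _ * X]ger0_norm ?expR_ge0// ler_piMr//.
by rewrite expR_le1 oppr_le0 mulr_ge0// ltW.
Qed.

Lemma expinv_bounded p c : 0 < c -> exists M : R, forall x, `|expinv p c x| <= M.
Proof.
move=> c0; have [M HM] := horner_expR_bounded p c0.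
exists M => x; rewrite /expinv; case: ifPn => x0; first by rewrite HM// invr_ge0 ltW.
by rewrite normr0; apply: le_trans (HM 0 (lexx _)).
Qed.

Lemma is_derive_expinv p c (x : R) : 0 < c ->
  is_derive x 1 (expinv p c) (expinv (expinv_deriv p c) c x).
Proof.
move=> c0; have [x0|x0|<-] := ltgtP 0 x.
- apply: (@near_eq_is_derive _ _ _ (fun y : R => p.[y^-1] * expR (- (c * y^-1)))).
    near=> y; rewrite /expinv ifT//; near: y.
    exact: (lt_nbhsr).
  rewrite /expinv x0.
  have dV : is_derive x 1 (fun y : R => y^-1) (- x ^- 2).
    by apply: is_derive_eq; [apply: is_deriveV; rewrite gt_eqF|rewrite /= scaler1].
  have d1 : is_derive x 1 (fun y : R => p.[y^-1]) (p^`().[x^-1] * (- x ^- 2)).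
    exact: (is_derive1_comp (f := horner p)).
  have d2 : is_derive x 1 (fun y : R => expR (- (c * y^-1))) (expR (- (c * x^-1)) * (- (c * (- x ^- 2)))).
    apply: (is_derive1_comp (f := expR)).
  apply: is_derive_eq.
  rewrite /expinv_deriv hornerD hornerN hornerZ !hornerM !hornerX.
  move: (expR _) (p.[_]) (p^`().[_]) => e u v.
  suff : u * (e * - (c * - x ^- 2)) + e * (v * - x ^- 2) =
    (c * (x^-1 / x * u) - x^-1 / x * v) * e by [].
  by field; exact: lt0r_neq0.
- apply: (@near_eq_is_derive _ _ _ (cst 0)).
    near=> y; rewrite /expinv ifF//; apply/negbTE; rewrite -leNgt ltW//; near: y.
    by apply: cvgr_lt x0; exact: cvg_id.
  by rewrite /expinv ltNge ltW//=; exact: is_derive_cst.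
- rewrite {2}/expinv ltxx.
  (* At the origin, two extra factors [1/h] in the bounded function give [|expinv p c h| <= M h^2],
     so the difference quotient is at most [M |h|]. *)
  have [M HM] := horner_expR_bounded ('X^2 * p) c0.
  have M0 : 0 <= M by apply: le_trans (HM 0 (lexx _)).
  have lim0 : (fun h : R => h^-1 *: ((expinv p c \o shift 0) (h *: 1) - expinv p c 0)) @ 0^' --> (0 : R).
    apply/cvgrPdist_le => e e0; near=> h.
    have hM : `|h| <= e / (M + 1).
      by near: h; apply: dnbhs0_le; rewrite divr_gt0// ltr_wpDl.
    rewrite sub0r normrN /= /shift /= addr0 [h *: 1]mulr1.
    rewrite {2}/expinv ltxx subr0 [_ *: _](_ : _ = h^-1 * expinv p c h)// /expinv.
    case: ifPn => h0; last by rewrite mulr0 normr0 ltW.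
    have := HM h^-1; rewrite invr_ge0 ltW// => /(_ isT).
    rewrite hornerM hornerXn -mulrA normrM [X in X * _]ger0_norm; last by rewrite exprn_ge0// invr_ge0 ltW.
    set q := _ * expR _; rewrite (gtr0_norm h0) in hM *.
    rewrite [`|h^-1 * _|]normrM (gtr0_norm (_ : 0 < h^-1)) ?invr_gt0// => H.
    rewrite ler_pdivrMl//.
    have qM : `|q| <= M * h ^+ 2.
      by rewrite -ler_pdivrMr ?exprn_gt0// mulrC -exprVn.
    rewrite ler_pdivlMr in hM; last by rewrite ltr_wpDl.
    apply: le_trans qM _; nra.
  apply: DeriveDef; last exact: cvg_lim lim0.
  by apply/cvg_ex; exists 0.
Unshelve. all: by end_near.
Qed.

(* The functions x |-> p(1/x) exp(-c/x) are stable under differentiation, so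
   every partial derivative of a member of this class is again a member. *)
Inductive smooth_alg n : ('rV[R]_n -> R) -> Prop :=
| smooth_alg_cst a : smooth_alg (fun=> a)
| smooth_alg_expinv i p c (s a : R) : 0 < c ->
    smooth_alg (fun x => expinv p c (s * x ord0 i + a))
| smooth_alg_add f g : smooth_alg f -> smooth_alg g ->
    smooth_alg (fun x => f x + g x)
| smooth_alg_mul f g : smooth_alg f -> smooth_alg g ->
    smooth_alg (fun x => f x * g x).

Lemma is_derive_expinv_affine p c (s a x : R) : 0 < c ->
  is_derive x 1 (fun x : R => expinv p c (s * x + a))
    (expinv (expinv_deriv p c) c (s * x + a) * s).
Proof.
move=> c0; apply: (is_derive1_comp (f := expinv p c)); first exact: is_derive_expinv.
by apply: is_derive_eq; rewrite addr0 [LHS]mulr1.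
Qed.

Lemma smooth_alg_differentiable n (f : 'rV[R]_n -> R) x :
  smooth_alg f -> differentiable f x.
Proof.
elim=> [a|i p c s a c0|g h _ dg _ dh|g h _ dg _ dh].
- exact: differentiable_cst.
- apply: (@differentiable_comp _ _ _ _ (fun x : 'rV[R]_n => x ord0 i)
    (fun y : R => expinv p c (s * y + a))); first exact: differentiable_coord.
  by apply/derivable1_diffP; have [] := is_derive_expinv_affine p s a (x ord0 i) c0.
- exact: differentiableD.
- exact: differentiableM.
Qed.

Lemma smooth_alg_partial n (f : 'rV[R]_n -> R) j :
  smooth_alg f -> smooth_alg (partial j f).
Proof.
elim=> [a|i p c s a c0|g h sg dg sh dh|g h sg dg sh dh].
- rewrite (_ : partial j _ = fun=> 0); first exact: smooth_alg_cst.
  by apply/funext => x; rewrite /partial derive_cst.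
- have [<-{j}|ij] := eqVneq i j.
    rewrite (_ : partial i _ =
      fun x => expinv (expinv_deriv p c) c (s * x ord0 i + a) * s).
      by apply: smooth_alg_mul; [exact: smooth_alg_expinv|exact: smooth_alg_cst].
    apply/funext => x; have [_ <-] := is_derive_expinv_affine p s a (x ord0 i) c0.
    rewrite /partial /derive; set F := (X in lim (X @ _) = _); set G := (X in _ = lim (X @ _)).
    suff -> : F = G by []; apply/funext => h; rewrite /F /G /=.
    by rewrite /shift /= !mxE !eqxx.
  rewrite (_ : partial j _ = fun=> 0); first exact: smooth_alg_cst.
  apply/funext => x.
  rewrite -(derive0 (fun y : R => expinv p c (s * y + a)) (x ord0 i)).
  rewrite /partial /derive; set F := (X in lim (X @ _) = _); set G := (X in _ = lim (X @ _)).
    suff -> : F = G by []; apply/funext => h; rewrite /F /G /=.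
  by rewrite /shift /= !mxE eqxx (negbTE ij) /= [h *: 0]mulr0 mulr0 add0r.
- rewrite (_ : partial j _ = fun x => partial j g x + partial j h x).
    exact: smooth_alg_add.
  by apply/funext => x; apply: deriveD; apply: diff_derivable;
    exact: smooth_alg_differentiable.
- rewrite (_ : partial j _ = fun x => g x * partial j h x + h x * partial j g x).
    by apply: smooth_alg_add; exact: smooth_alg_mul.
  by apply/funext => x; apply: deriveM; apply: diff_derivable;
    exact: smooth_alg_differentiable.
Qed.

Lemma smooth_alg_smooth n (f : 'rV[R]_n -> R) : smooth_alg f -> smooth f.
Proof.
move=> sf s x; apply: smooth_alg_differentiable.
by elim: s => //= i s IH; exact: smooth_alg_partial.
Qed.

Lemma continuous_expinv p c : 0 < c -> continuous (expinv p c).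
Proof.
move=> c0 x; apply: differentiable_continuous; apply/derivable1_diffP.
by have [] := is_derive_expinv p x c0.
Qed.

Lemma smooth_alg_measurable n (f : 'rV[R]_n -> R) :
  smooth_alg f -> measurable_fun setT f.
Proof.
elim=> [a|i p c s a c0|g h _ dg _ dh|g h _ dg _ dh].
- exact: measurable_cst.
- apply: (@measurableT_comp _ _ _ _ _ _ (expinv p c)).
    by apply: continuous_measurable_fun; exact: continuous_expinv.
  apply: measurable_funD => //; apply: measurable_funM => //.
  exact: measurable_rV_coord.
- exact: measurable_funD.
- exact: measurable_funM.
Qed.

Lemma smooth_alg_bounded n (f : 'rV[R]_n -> R) :
  smooth_alg f -> exists2 M : R, 0 <= M & forall x, `|f x| <= M.
Proof.
elim=> [a|i p c s a c0|g h _ [M M0 HM] _ [N N0 HN]|g h _ [M M0 HM] _ [N N0 HN]].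
- by exists `|a|.
- have [M HM] := expinv_bounded p c0.
  by exists M => //; exact: le_trans (HM 0).
- exists (M + N); first exact: addr_ge0.
  by move=> x; rewrite (le_trans (ler_normD _ _))// lerD.
- exists (M * N); first exact: mulr_ge0.
  by move=> x; rewrite normrM ler_pM.
Qed.

Lemma smooth_alg_prod n (I : Type) (s : seq I) (F : I -> 'rV[R]_n -> R) :
  (forall i, smooth_alg (F i)) -> smooth_alg (fun x => \prod_(i <- s) F i x).
Proof.
move=> sF; elim: s => [|i s IH].
  rewrite (_ : (fun x => _) = fun=> 1); first exact: smooth_alg_cst.
  by apply/funext => x; rewrite big_nil.
rewrite (_ : (fun x => _) = fun x => F i x * \prod_(i <- s) F i x).
  exact: smooth_alg_mul.
by apply/funext => x; rewrite big_cons.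
Qed.

Lemma is_derive_along n (f : 'rV[R]_n -> R) (x h : 'rV[R]_n) (t : R) :
  differentiable f (x + t *: h) ->
  is_derive t 1 (fun t => f (x + t *: h))
    (\sum_(i < n) h ord0 i * partial i f (x + t *: h)).
Proof.
move=> df.
have dg : is_diff t (fun t : R => x + t *: h) (fun s : R => s *: h).
  have -> : (fun s : R => s *: h) = (0 : R -> 'rV[R]_n) + ( *:%R ^~ h).
    by apply/funext => s; rewrite /= add0r.
  exact: is_diffD.
have dfg : differentiable (f \o (fun t : R => x + t *: h)) t.
  by apply: differentiable_comp => //; exact: ex_diff.
apply: DeriveDef; first exact/derivable1_diffP.
have Dg : differentiable (fun t : R => x + t *: h) t by exact: ex_diff.
rewrite [LHS](deriveE _ dfg) (diff_comp Dg df).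
have dgE : 'd (fun t0 : R => x + t0 *: h) t = *:%R^~ h :> (R -> 'rV[R]_n) by exact: diff_val.
rewrite /= dgE scale1r.
transitivity ('d f (x + t *: h) (\sum_i h ord0 i *: delta_mx ord0 i)).
  by rewrite -row_sum_delta.
rewrite linear_sum; apply: eq_bigr => i _.
by rewrite linearZ /= /partial deriveE.
Qed.

(** The rate [1/(k+1)] tends to 0, so these bumps converge pointwise to the indicator of the open
    box. The forms [1 * x + - a] and [-1 * x + b] match the shape in [smooth_alg_expinv]. *)
Definition box_bump n (a b : 'rV[R]_n) (k : nat) (x : 'rV[R]_n) : R :=
  \prod_(i < n) (expinv 1 k.+1%:R^-1 (1 * x ord0 i + - a ord0 i) *
                 expinv 1 k.+1%:R^-1 (-1 * x ord0 i + b ord0 i)).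

Definition open_box n (a b : 'rV[R]_n) : set 'rV[R]_n :=
  [set x | forall i, `]a ord0 i, b ord0 i[%classic (x ord0 i)].

Definition closed_box n (a b : 'rV[R]_n) : set 'rV[R]_n :=
  [set x | forall i, `[a ord0 i, b ord0 i]%classic (x ord0 i)].

Lemma smooth_alg_box_bump n (a b : 'rV[R]_n) k : smooth_alg (box_bump a b k).
Proof.
apply: smooth_alg_prod => i; apply: smooth_alg_mul; apply: smooth_alg_expinv;
  by rewrite invr_gt0.
Qed.

Lemma expinv1_bnd c x : 0 < c -> 0 <= expinv 1 c x <= 1.
Proof.
move=> c0; rewrite /expinv; case: ifPn => x0; last by rewrite lexx ler01.
rewrite hornerC mul1r expR_ge0/= expR_le1 oppr_le0 mulr_ge0// ?invr_ge0 ltW//.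
Qed.

Lemma box_bump_bnd n (a b : 'rV[R]_n) k x : 0 <= box_bump a b k x <= 1.
Proof.
have c0 : 0 < k.+1%:R^-1 :> R by rewrite invr_gt0.
have e0 y : 0 <= expinv 1 k.+1%:R^-1 y by have /andP[] := expinv1_bnd y c0.
have e1 y : expinv 1 k.+1%:R^-1 y <= 1 by have /andP[] := expinv1_bnd y c0.
apply/andP; split; first by apply: prodr_ge0 => i _; rewrite mulr_ge0.
by apply: prodr_ile1 => i _; rewrite mulr_ge0// mulr_ile1.
Qed.

Lemma box_bump_out n (a b : 'rV[R]_n) k x : ~ open_box a b x -> box_bump a b k x = 0.
Proof.
move=> /existsNP[i]; rewrite /= in_itv /= => /negP; rewrite negb_and -!leNgt => xi.
rewrite /box_bump (bigD1 i)//= mul1r mulN1r [- x _ _ + _]addrC /expinv !subr_gt0.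
rewrite !ltNge; case/orP: xi => -> /=; rewrite ?mul0r// mulr0 mul0r//.
Qed.

Lemma cvg_expinv1 (y : R) : 0 < y ->
  expinv 1 k.+1%:R^-1 y @[k --> \oo] --> (1 : R).
Proof.
move=> y0.
rewrite (_ : (fun k => _) = (fun k => expR (- (k.+1%:R^-1 * y^-1)))); last first.
  by apply/funext => k; rewrite /expinv y0 hornerC mul1r.
rewrite -[X in _ --> X]expR0; apply: continuous_cvg; first exact: continuous_expR.
rewrite -oppr0; apply: cvgN; rewrite -(mul0r y^-1); apply: cvgMl.
exact: cvg_harmonic.
Qed.

Lemma cvg_prodr (I : Type) (s : seq I) (F : I -> nat -> R) (l : I -> R) :
  (forall i, F i k @[k --> \oo] --> l i) ->
  \prod_(i <- s) F i k @[k --> \oo] --> \prod_(i <- s) l i.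
Proof.
move=> Fl; elim: s => [|i s IH].
  rewrite big_nil (_ : (fun k => _) = fun=> 1); first exact: cvg_cst.
  by apply/funext => k; rewrite big_nil.
rewrite big_cons (_ : (fun k => _) = fun k => F i k * \prod_(j <- s) F j k).
  exact: cvgM.
by apply/funext => k; rewrite big_cons.
Qed.

Lemma cvg_box_bump n (a b : 'rV[R]_n) x :
  box_bump a b k x @[k --> \oo] --> (\1_(open_box a b) x : R).
Proof.
have [xab|xab] := pselect (open_box a b x); last first.
  rewrite indicE memNset//=; apply: cvg_near_cst; apply: nearW => k.
  exact: box_bump_out.
rewrite indicE mem_set//= /box_bump.
rewrite [X in _ --> X](_ : _ = \prod_(i < n) (1 : R)); last by rewrite big1.
apply: (cvg_prodr (F := fun i k => expinv 1 k.+1%:R^-1 (1 * x ord0 i - a ord0 i) *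
   expinv 1 k.+1%:R^-1 (-1 * x ord0 i + b ord0 i)) (l := fun=> 1)) => i.
rewrite -[X in _ --> X]mulr1.
have := xab i; rewrite /= in_itv /= => /andP[ax xb].
by apply: cvgM; apply: cvg_expinv1; rewrite ?mul1r ?mulN1r ?subr_gt0// addrC subr_gt0.
Qed.

Lemma closed_closed_box n (a b : 'rV[R]_n) : closed (closed_box a b).
Proof.
rewrite (_ : closed_box a b = \bigcap_(i in [set: 'I_n])
    ((fun x : 'rV[R]_n => x ord0 i) @^-1` `[a ord0 i, b ord0 i])).
  apply: closed_bigI => i _; apply: closed_comp; last exact: itv_closed.
  by move=> x _; exact: coord_continuous.
by apply/seteqP; split => x h i; [move=> _; exact: h|exact: (h i)].
Qed.

Lemma open_sub_closed_box n (a b : 'rV[R]_n) : open_box a b `<=` closed_box a b.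
Proof. by move=> x xab i; apply: subset_itv_oo_cc; exact: xab. Qed.

Lemma box_bump_test_function n (a b : 'rV[R]_n) k (U : set 'rV[R]_n) :
  closed_box a b `<=` U -> test_function U (box_bump a b k).
Proof.
move=> abU; have sub : closure [set x | box_bump a b k x != 0] `<=` closed_box a b.
  rewrite [X in _ `<=` X]((closure_id _).1 (@closed_closed_box _ a b)).
  apply: closure_subset => x /= /eqP bx; apply: open_sub_closed_box.
  by apply: contrapT => /(box_bump_out k).
split.
- exact/smooth_alg_smooth/smooth_alg_box_bump.
- apply: (@subclosed_compact _ _ (closed_box a b)) => //; first exact: closed_closure.
  apply: (rV_compact (A := fun i => `[a ord0 i, b ord0 i]%classic)) => i.
  exact: segment_compact.
- exact: subset_trans abU.
Qed.

End smooth_cutoff.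

(** * The fundamental lemma of the calculus of variations *)

Section du_bois_reymond.
Context {R : realType}.

(** A generating pi-system whose members cut an open box into an open box again, since each active
    coordinate only raises a lower bound. The boolean leaves a coordinate free. *)
Definition rV_rays n : set (set 'rV[R]_n) :=
  [set A | exists (b : 'I_n -> bool) (c : 'I_n -> R),
     A = [set x : 'rV[R]_n | forall i, b i ==> (c i < x ord0 i)]].

Lemma setI_closed_rV_rays n : setI_closed (@rV_rays n).
Proof.
move=> _ _ [b [c ->]] [b' [c' ->]].
exists (fun i => b i || b' i), (fun i => if b i then
   (if b' i then Num.max (c i) (c' i) else c i) else c' i).
apply/seteqP; split => x /=.
  move=> [h h'] i; have := h i; have := h' i.
  by case: (b i); case: (b' i) => //= h1 h2; rewrite gt_max h1 h2.
move=> h; split => i; have := h i.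
  by case: (b i); case: (b' i) => //=; rewrite gt_max => /andP[].
by case: (b i); case: (b' i) => //=; rewrite gt_max => /andP[].
Qed.

Lemma measurable_rV_rays n : @measurable _ 'rV[R]_n = <<s @rV_rays n >>.
Proof.
apply/seteqP; split.
  pose T := g_sigma_algebraType (@rV_rays n).
  have mc i : measurable_fun [set: T] (fun x : T => (x : 'rV[R]_n) ord0 i).
    apply: (measurability _ (RGenOInfty.measurableE R)) => _ [_ [c ->] <-].
    rewrite setTI; apply: sub_sigma_algebra.
    exists (fun j => j == i), (fun=> c); apply/seteqP; split => x /=.
      by rewrite in_itv/= andbT => cx j; apply/implyP => /eqP ->.
    by move=> /(_ i); rewrite eqxx /= in_itv/= andbT.
  apply: smallest_sub; first exact: smallest_sigma_algebra.
  rewrite -bigcup_seq => A [i _] [B mB <-].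
  exact: mc.
apply: smallest_sub; first exact: sigma_algebra_measurable.
move=> _ [b [c ->]].
apply: (measurable_rV_forall (A := fun i => [set y : R | b i ==> (c i < y)])) => i.
case: (b i) => /=; last by rewrite (_ : mkset _ = setT)//; apply/seteqP.
rewrite (_ : mkset _ = `]c i, +oo[%classic)//.
by apply/seteqP; split => y /=; rewrite in_itv/= andbT.
Qed.

Lemma open_boxE n (a b : 'rV[R]_n) :
  open_box a b = [set x | forall i, a ord0 i < x ord0 i < b ord0 i].
Proof. by apply/seteqP; split => x h i; have := h i; rewrite /= in_itv. Qed.

Lemma closed_boxE n (a b : 'rV[R]_n) :
  closed_box a b = [set x | forall i, a ord0 i <= x ord0 i <= b ord0 i].
Proof. by apply/seteqP; split => x h i; have := h i; rewrite /= in_itv. Qed.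

Lemma measurable_open_box n (a b : 'rV[R]_n) : measurable (open_box a b).
Proof.
exact: (measurable_rV_forall (A := fun i => `]a ord0 i, b ord0 i[%classic)).
Qed.

Variables (n : nat) (U : set 'rV[R]_n) (D : 'rV[R]_n -> R).
Local Notation mu := (lebesgue_rV R n).
Hypothesis intD : mu.-integrable setT (EFin \o D).
Hypothesis D0 : forall a b k, closed_box a b `<=` U ->
  (\int[mu]_x (D x * box_bump a b k x)%:E = 0)%E.

Lemma integral_open_box0 a b : closed_box a b `<=` U ->
  (\int[mu]_(x in open_box a b) (D x)%:E = 0)%E.
Proof.
move=> abU.
have mD : measurable_fun setT D.
  by apply/measurable_EFinP; case/integrableP : intD.
have [] := @dominated_convergence _ _ _ mu setT measurableT
  (fun k x => (D x * box_bump a b k x)%:E)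
  (fun x => (D x * \1_(open_box a b) x)%:E) (fun x => `|(D x)%:E|%E).
- move=> k; apply/measurable_EFinP; apply: measurable_funM => //.
  by apply: smooth_alg_measurable; exact: smooth_alg_box_bump.
- apply/measurable_EFinP; apply: measurable_funM => //.
  apply: measurable_indic; exact: measurable_open_box.
- apply: aeW => x _; apply: cvg_EFin; first exact: nearW.
  by apply: cvgMr; exact: cvg_box_bump.
- by apply: integrable_abse.
- apply: aeW => x k _ /=; rewrite lee_fin normrM ler_piMr//.
  by have /andP[? ?] := box_bump_bnd a b k x; rewrite ger0_norm.
move=> _ _; rewrite (_ : [sequence _]_k = fun=> 0%E); last first.
  by apply/funext => k /=; exact: D0.
move=> h.
have -> : (\int[mu]_(x in open_box a b) (D x)%:E =
           \int[mu]_x (D x * \1_(open_box a b) x)%:E)%E.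
  rewrite integral_mkcond; apply: eq_integral => x _.
  by rewrite patchE indicE; case: ifP => _; rewrite ?mulr1 ?mulr0.
by rewrite -(cvg_lim _ h)// lim_cst.
Qed.

(** Dynkin induction on E: a ray reduces to a smaller box whose closed box is still in U;
    complements and disjoint unions follow by additivity. Vanishing over every measurable part of a
    box then forces [D = 0] almost everywhere in it. *)
Lemma integral_sub_open_box0 a b (E : set 'rV[R]_n) : closed_box a b `<=` U ->
  measurable E -> (\int[mu]_(x in E `&` open_box a b) (D x)%:E = 0)%E.
Proof.
move=> abU; rewrite measurable_rV_rays.
have intS (A : set 'rV[R]_n) : measurable A -> mu.-integrable A (EFin \o D).
  by move=> mA; exact: (integrableS measurableT).
have mQ := measurable_open_box a b.
move: E; apply: (dynkin_induction (measurable_rV_rays n)).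
- exact: setI_closed_rV_rays.
- by rewrite setTI integral_open_box0.
- move=> _ [e [c ->]].
  pose a' : 'rV[R]_n := \row_i (if e i then Num.max (a ord0 i) (c i) else a ord0 i).
  rewrite (_ : _ `&` _ = open_box a' b); last first.
    rewrite !open_boxE; apply/seteqP; split => x /=.
      move=> [h h'] i; have := h i; have := h' i; rewrite mxE.
      case: (e i) => //= /andP[ax ->] cx; rewrite andbT gt_max ax//.
    move=> h; split => i; have := h i; rewrite mxE; case: (e i) => //=.
      by rewrite gt_max => /andP[/andP[]].
    by rewrite gt_max => /andP[/andP[-> _] ->].
  apply: integral_open_box0 => x; rewrite closed_boxE => xa'b; apply: abU.
  rewrite closed_boxE => i; have := xa'b i; rewrite mxE => /andP[h ->]; rewrite andbT; apply: le_trans h.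
  by case: ifP => // _; rewrite le_max lexx.
- move=> S mS S0; rewrite -[RHS](integral_open_box0 abU).
  rewrite -[in RHS](setIT (open_box a b)) -(setUv S) setIUr integral_setU.
  + by rewrite ![open_box a b `&` _]setIC S0 add0e.
  + exact: measurableI.
  + by apply: measurableI => //; exact: measurableC.
  + apply: measurable_funTS; by case/integrableP : intD.
  + by apply/disj_set2P/seteqP; split=> x //= [[_ ?] [_]].
- move=> F mF tF F0; rewrite setI_bigcupl integral_bigcup.
  + by apply: eseries0 => k _ _; exact: F0.
  + exact: trivIset_setIr.
  + by move=> k; exact: measurableI.
  + by apply: intS; apply: bigcup_measurable => k _; exact: measurableI.
Qed.

Lemma open_box_ae0 a b : closed_box a b `<=` U ->
  {ae mu, forall x, open_box a b x -> D x = 0}.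
Proof.
move=> abU; have mQ := measurable_open_box a b.
have : ae_eq mu (open_box a b) (EFin \o D) (cst 0%E).
  apply: integral_ae_eq => //.
    exact: (integrableS measurableT).
  move=> E EQ mE; rewrite [RHS]integral0.
  by rewrite -(setIidl EQ) integral_sub_open_box0.
by apply: filterS => x /= h /h [].
Qed.

(** Only countably many null sets may be united, hence the boxes with rational corners, enumerated
    by [unpickle]; around each point of U one of them fits inside the given cube. *)
Lemma du_bois_reymond : (forall x, U x -> exists2 e : R, 0 < e & rV_cube x e `<=` U) ->
  {ae mu, forall x, U x -> D x = 0}.
Proof.
move=> openU.
pose B (q : 'rV[rat]_n * 'rV[rat]_n) x :=
  closed_box (map_mx ratr q.1) (map_mx ratr q.2) `<=` U ->
  open_box (map_mx ratr q.1) (map_mx ratr q.2) x -> D x = 0.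
have Bae k : {ae mu, forall x, forall q, unpickle k = Some q -> B q x}.
  case: (unpickle k) => [q|]; last exact: aeW.
  have [qU|qU] := pselect (closed_box (map_mx ratr q.1) (map_mx ratr q.2) `<=` U); last first.
    by apply: aeW => x _ [<-].
  by apply: filterS (open_box_ae0 qU) => x h _ [<-] _.
have : mu.-negligible (\bigcup_k ~` [set x | forall q, unpickle k = Some q -> B q x]).
  by apply: negligible_bigcup => k; exact: Bae.
apply: negligibleS => x /= /not_implyP[Ux Dx].
have [e e0 xeU] := openU _ Ux.
have [f Hf] : {f : 'I_n -> rat * rat & forall i,
    x ord0 i - e < ratr (f i).1 < x ord0 i /\ x ord0 i < ratr (f i).2 < x ord0 i + e}.
  apply: (@choice _ _ (fun i q => x ord0 i - e < ratr q.1 < x ord0 i /\ x ord0 i < ratr q.2 < x ord0 i + e)) => i.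
  have /rat_in_itvoo[p] : x ord0 i - e < x ord0 i by rewrite ltrBlDr ltrDl.
  have /rat_in_itvoo[q] : x ord0 i < x ord0 i + e by rewrite ltrDl.
  by rewrite !in_itv /= => ? ?; exists (p, q).
pose q := (\row_i (f i).1, \row_i (f i).2).
exists (pickle q) => //= /(_ q); rewrite pickleK => /(_ erefl) h; apply: Dx; apply: h.
  move=> y; rewrite closed_boxE => yq; apply: xeU => i; have := yq i; rewrite !mxE.
  have [/andP[h1 h2] /andP[h3 h4]] := Hf i => /andP[h5 h6].
  by rewrite ltr_distl (lt_le_trans h1 h5) (le_lt_trans h6 h4).
rewrite open_boxE => i; rewrite !mxE.
by have [/andP[_ ->] /andP[-> _]] := Hf i.
Qed.

End du_bois_reymond.

(** * Absolute continuity on lines *)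

Section real_integrals.
Context d (T : measurableType d) (R : realType) (mu : {measure set T -> \bar R}).
Implicit Types f g : T -> R.

Lemma integrable_mul_bounded f g M : mu.-integrable setT (EFin \o f) ->
  measurable_fun setT g -> (forall x, `|g x| <= M) ->
  mu.-integrable setT (EFin \o (fun x => f x * g x)).
Proof.
move=> intf mg gM; apply: (@integrableMl _ _ _ _ _ _ (EFin \o f)) => //.
exists M; split; first exact: num_real.
by move=> N MN x _; apply: le_trans (ltW MN).
Qed.

Lemma integrable_Rsum (I : Type) (s : seq I) (f : I -> T -> R) :
  (forall i, mu.-integrable setT (EFin \o f i)) ->
  mu.-integrable setT (EFin \o (fun x => \sum_(i <- s) f i x)).
Proof.
move=> intf; rewrite (_ : EFin \o _ = fun x => \sum_(j <- s) (f j x)%:E)%E.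
  by apply: integrable_sum => // i _; exact: intf.
by apply/funext => x /=; rewrite sumEFin.
Qed.

Lemma Rintegral_sum (I : Type) (s : seq I) (f : I -> T -> R) :
  (forall i, mu.-integrable setT (EFin \o f i)) ->
  \int[mu]_x (\sum_(i <- s) f i x) = \sum_(i <- s) \int[mu]_x f i x.
Proof.
move=> intf; elim: s => [|i s IH].
  by rewrite big_nil; under eq_Rintegral do rewrite big_nil; rewrite Rintegral_cst// mul0r.
rewrite big_cons -IH; under eq_Rintegral do rewrite big_cons.
rewrite RintegralD//.
exact: integrable_Rsum.
Qed.

Lemma integrable_fine (f : T -> \bar R) : mu.-integrable setT f ->
  mu.-integrable setT (EFin \o (fine \o f)).
Proof.
move=> intf; apply: (le_integrable measurableT _ _ intf).
  apply/measurable_EFinP; apply: measurableT_comp; last exact: measurable_int intf.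
  exact: fine_measurable.
by move=> x _ /=; case: (f x) => //=; rewrite ?leey// normr0 leey.
Qed.

End real_integrals.

Section real_fubini.
Context d1 d2 (T1 : measurableType d1) (T2 : measurableType d2) (R : realType).
Variables (m1 : {sigma_finite_measure set T1 -> \bar R})
  (m2 : {sigma_finite_measure set T2 -> \bar R}).

Lemma integrable_Rfubini_F (f : T1 * T2 -> R) :
  (m1 \x m2)%E.-integrable setT (EFin \o f) ->
  m1.-integrable setT (EFin \o (fun x => \int[m2]_y f (x, y))).
Proof. by move=> intf; exact: integrable_fine (integrable_fubini_F intf). Qed.

(** The real inner integrals agree with the extended ones wherever the section is integrable, that
    is, for almost every section. *)
Lemma RFubini (f : T1 * T2 -> R) :
  (m1 \x m2)%E.-integrable setT (EFin \o f) ->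
  \int[m1]_x \int[m2]_y f (x, y) = \int[m2]_y \int[m1]_x f (x, y).
Proof.
move=> intf.
have e1 : (\int[m1]_x (\int[m2]_y f (x, y))%R%:E = \int[m1]_x \int[m2]_y (f (x, y))%:E)%E.
  apply: ae_eq_integral => //.
  - exact: measurable_int (integrable_Rfubini_F intf).
  - exact: measurable_int (integrable_fubini_F intf).
  apply: filterS (ae_integrable1 intf) => x intx _.
  by rewrite /Rintegral fineK//; exact: integrable_fin_num.
have e2 : (\int[m2]_y (\int[m1]_x f (x, y))%R%:E = \int[m2]_y \int[m1]_x (f (x, y))%:E)%E.
  apply: ae_eq_integral => //.
  - apply/measurable_EFinP; apply: (@measurableT_comp _ _ _ _ _ _ (@fine R)).
      exact: fine_measurable.
    exact: (measurable_fubini_G intf).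
  - exact: (measurable_fubini_G intf).
  apply: filterS (ae_integrable2 intf) => y inty _.
  by rewrite /Rintegral fineK//; exact: integrable_fin_num.
by rewrite /Rintegral e1 e2; congr fine; exact: (Fubini intf).
Qed.

End real_fubini.

Section line.
Context {R : realType} (n : nat).
Local Notation mu := (lebesgue_rV R n).
Local Notation lam := (@lebesgue_measure R).

Lemma Rintegral_rV_translate (a : 'rV[R]_n) (f : 'rV[R]_n -> R) :
  measurable_fun setT f -> \int[mu]_x f (x + a) = \int[mu]_x f x.
Proof.
move=> mf; congr fine; apply: (integral_rV_translate a (f := EFin \o f)).
exact/measurable_EFinP.
Qed.

Lemma measurable_rV_line (h : 'rV[R]_n) :
  measurable_fun setT (fun z : 'rV[R]_n * R => z.1 + z.2 *: h).
Proof.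
apply: measurable_fun_rVP => i.
rewrite (_ : (fun z => _) = (fun z : 'rV[R]_n * R => z.1 ord0 i + z.2 * h ord0 i)).
  apply: measurable_funD; last by apply: measurable_funM => //; exact: measurable_snd.
  by apply: (measurableT_comp (measurable_rV_coord i)); exact: measurable_fst.
by apply/funext => z; rewrite !mxE.
Qed.

Lemma partial_shift (f : 'rV[R]_n -> R) c i x :
  partial i (fun y => f (y + c)) x = partial i f (x + c).
Proof.
rewrite /partial /derive; set F := (X in lim (X @ _) = _); set G := (X in _ = lim (X @ _)).
by suff -> : F = G by []; apply/funext => t; rewrite /F /G /= /shift /= addrA.
Qed.

Lemma box_bump_shift (a b c : 'rV[R]_n) k x :
  box_bump a b k (x + c) = box_bump (a - c) (b - c) k x.
Proof.
apply: eq_bigr => i _; congr (expinv _ _ _ * expinv _ _ _); rewrite !mxE; ring.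
Qed.

Lemma patch0M (A : set 'rV[R]_n) (f g : 'rV[R]_n -> R) x :
  ((fun x => f x * g x) \_ A) x = (f \_ A) x * g x.
Proof. by rewrite !patchE; case: ifP; rewrite ?mul0r. Qed.

Lemma integrable_patch (A : set 'rV[R]_n) (f : 'rV[R]_n -> R) : measurable A ->
  mu.-integrable A (EFin \o f) -> mu.-integrable setT (EFin \o (f \_ A)).
Proof. by move=> mA /(integrable_mkcond _ mA); rewrite restrict_EFin. Qed.

Lemma smooth_alg_sumZ (h : 'rV[R]_n) (F : 'I_n -> 'rV[R]_n -> R) :
  (forall i, smooth_alg (F i)) -> smooth_alg (fun x => \sum_(i < n) h ord0 i * F i x).
Proof.
move=> sF; elim: (index_enum _) => [|i s IH].
  rewrite (_ : (fun x => _) = fun=> 0); first exact: smooth_alg_cst.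
  by apply/funext => x; rewrite big_nil.
rewrite (_ : (fun x => _) = fun x => h ord0 i * F i x + \sum_(i <- s) h ord0 i * F i x).
  by apply: smooth_alg_add => //; apply: smooth_alg_mul => //; exact: smooth_alg_cst.
by apply/funext => x; rewrite big_cons.
Qed.

Variables (x0 : 'rV[R]_n) (r : R).
Hypothesis r_gt0 : 0 < r.
Variables (u : 'rV[R]_n -> R) (Du : 'rV[R]_n -> 'rV[R]_n).
Local Notation B := (eball x0 r).
Hypothesis sob : sobolev11 B u Du.

(** The directional derivative [h . Du], extended by zero so that translation and Fubini apply on
    the whole space. *)
Definition dirext (h : 'rV[R]_n) : 'rV[R]_n -> R :=
  (fun x => \sum_(i < n) h ord0 i * Du x ord0 i) \_ B.

Let mB : measurable B := measurable_eball x0 r.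

Let int_u : mu.-integrable setT (EFin \o (u \_ B)).
Proof. by apply: integrable_patch => //; case: sob. Qed.

Let int_Du i : mu.-integrable setT (EFin \o ((fun x => Du x ord0 i) \_ B)).
Proof. by apply: integrable_patch => //; case: sob => _ /(_ i). Qed.

Lemma dirextE h x : dirext h x = \sum_(i < n) h ord0 i * ((fun x => Du x ord0 i) \_ B) x.
Proof.
rewrite /dirext /patch; case: ifP => // _.
by rewrite big1// => i _; rewrite mulr0.
Qed.

Lemma integrableZ (f : 'rV[R]_n -> R) a : mu.-integrable setT (EFin \o f) ->
  mu.-integrable setT (EFin \o (fun x => a * f x)).
Proof. by move=> intf; exact: (integrableZl measurableT a intf). Qed.

Lemma integrable_dirext h : mu.-integrable setT (EFin \o dirext h).
Proof.
rewrite (_ : dirext h = fun x => \sum_(i < n) h ord0 i * ((fun x => Du x ord0 i) \_ B) x).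
  by apply: integrable_Rsum => i; exact: integrableZ.
by apply/funext => x; rewrite dirextE.
Qed.

Lemma weak_gradient_along (phi : 'rV[R]_n -> R) (h : 'rV[R]_n) :
  smooth_alg phi -> test_function B phi ->
  \int[mu]_x ((u \_ B) x * \sum_(i < n) h ord0 i * partial i phi x) =
  - \int[mu]_x (dirext h x * phi x).
Proof.
move=> sphi tphi.
have int_uphi (f : 'rV[R]_n -> R) psi : smooth_alg psi ->
    mu.-integrable setT (EFin \o f) -> mu.-integrable setT (EFin \o (fun x => f x * psi x)).
  move=> spsi intf; have [M _ HM] := smooth_alg_bounded spsi.
  exact: (integrable_mul_bounded intf (smooth_alg_measurable spsi) HM).
have -> : \int[mu]_x ((u \_ B) x * \sum_(i < n) h ord0 i * partial i phi x) =
    \sum_(i < n) h ord0 i * \int[mu]_x ((u \_ B) x * partial i phi x).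
  under eq_Rintegral do rewrite mulr_sumr.
  rewrite Rintegral_sum => [|i].
    apply: eq_bigr => i _; rewrite -RintegralZl//.
      by apply: eq_Rintegral => x _; rewrite mulrCA.
    by apply: int_uphi => //; exact: smooth_alg_partial.
  under eq_fun do rewrite mulrCA.
  by apply: integrableZ; apply: int_uphi => //; exact: smooth_alg_partial.
have -> : \int[mu]_x (dirext h x * phi x) =
    \sum_(i < n) h ord0 i * \int[mu]_x (((fun x => Du x ord0 i) \_ B) x * phi x).
  under eq_Rintegral do rewrite dirextE mulr_suml.
  rewrite Rintegral_sum => [|i].
    apply: eq_bigr => i _; rewrite -RintegralZl//; last exact: int_uphi.
    by apply: eq_Rintegral => x _; rewrite mulrA.
  under eq_fun do rewrite -mulrA.
  by apply: integrableZ; exact: int_uphi.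
rewrite -sumrN; apply: eq_bigr => i _; rewrite -mulrN; congr (_ * _).
under eq_Rintegral do rewrite -patch0M.
under [in RHS]eq_Rintegral do rewrite -patch0M.
rewrite -!Rintegral_mkcond.
by case: sob => _ _; apply.
Qed.

Definition line_grad (h : 'rV[R]_n) (T : R) (z : 'rV[R]_n * R) : R :=
  dirext h (z.1 + z.2 *: h) * \1_(`[0, T]%classic) z.2.

Let mline (f : 'rV[R]_n -> R) (h : 'rV[R]_n) (T : R) : measurable_fun setT f ->
  measurable_fun setT (fun z : 'rV[R]_n * R =>
    f (z.1 + z.2 *: h) * \1_(`[0, T]%classic) z.2).
Proof.
move=> mf; apply: measurable_funM.
  exact: (measurableT_comp mf (measurable_rV_line h)).
apply: (@measurableT_comp _ _ _ _ _ _ (\1_(`[0, T]%classic) : R -> R)).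
  exact: measurable_indic.
exact: measurable_snd.
Qed.

Let lam_indic (T M : R) : 0 <= T ->
  (\int[lam]_t (M%:E * (\1_(`[0%R, T]%classic) t)%:E) = (M * T)%:E)%E.
Proof.
move=> T0; rewrite integralZl//=; last first.
  apply: integrable_indic_itv.
rewrite integral_indic// setIT /= lebesgue_measure_itv /= lte_fin.
have [T1|] := ltP 0 T; first by rewrite -EFinB subr0 EFinM.
by move=> T1; rewrite (_ : T = 0) ?mulr0 ?mule0//; apply/eqP; rewrite eq_le T1.
Qed.

(** By Tonelli and translation invariance the L1 norm on the product is T times that of f, whatever
    h is. *)
Lemma integrable_line (f : 'rV[R]_n -> R) (h : 'rV[R]_n) (T : R) : 0 <= T ->
  mu.-integrable setT (EFin \o f) ->
  (mu \x lam)%E.-integrable setT (EFin \o (fun z : 'rV[R]_n * R =>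
    f (z.1 + z.2 *: h) * \1_(`[0, T]%classic) z.2)).
Proof.
move=> T0 intf.
have mf : measurable_fun setT f by apply/measurable_EFinP; exact: measurable_int intf.
apply/integrable21ltyP; first by apply/measurable_EFinP; exact: mline.
apply: (@le_lt_trans _ _
    (\int[lam]_t ((\int[mu]_x `|(f x)%:E|) * (\1_(`[0%R, T]%classic) t)%:E))%E); last first.
  have /integrableP[_ foo] := intf.
  have ffin : (\int[mu]_x `|(f x)%:E|)%E \is a fin_num.
    by rewrite ge0_fin_numE// integral_ge0.
  by rewrite -(fineK ffin) lam_indic// ltry.
rewrite le_eqVlt; apply/orP; left; apply/eqP; apply: eq_integral => t _ /=.
under eq_integral => x _ do rewrite normrM EFinM muleC (ger0_norm (_ : 0 <= \1_(`[0, T]%classic) t))//.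
rewrite ge0_integralZl ?lee_fin//.
  rewrite muleC; congr (_ * _)%E.
  apply: (ge0_integral_rV_translate (t *: h) (f := fun x => (`|f x|)%:E)) => //.
  by apply/measurable_EFinP; apply: measurableT_comp.
apply/measurable_EFinP; apply: measurableT_comp => //.
exact: (measurableT_comp mf (measurable_rV_translate _)).
Qed.

(** The shifts go backwards because translating the increment of u moves it onto the test function
    with the opposite sign. *)
Lemma line_ftc (phi : 'rV[R]_n -> R) (h x : 'rV[R]_n) (T : R) : 0 < T -> smooth_alg phi ->
  phi (x - T *: h) - phi x =
  \int[lam]_t ((- \sum_(i < n) h ord0 i * partial i phi (x - t *: h)) * \1_(`[0, T]%classic) t).
Proof.
move=> T0 sphi.
pose psi t := \sum_(i < n) (- h) ord0 i * partial i phi (x + t *: - h).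
have dF (t : R) : is_derive t 1 (fun t : R => phi (x + t *: - h)) (psi t).
  by apply: is_derive_along; exact: smooth_alg_differentiable.
have spsi : smooth_alg (fun y => \sum_(i < n) (- h) ord0 i * partial i phi y).
  by apply: smooth_alg_sumZ => i; exact: smooth_alg_partial.
have cpsi : continuous psi.
  move=> t; apply: differentiable_continuous; apply/derivable1_diffP.
  by have [] := is_derive_along (smooth_alg_differentiable (x + t *: - h) spsi).
have := @continuous_FTC2 R psi (fun t : R => phi (x + t *: - h)) 0 T T0.
move=> /(_ _ _ _)/(congr1 fine) /=.
rewrite scale0r addr0 scalerN => <-.
- rewrite [X in fine X = _]integral_mkcond /Rintegral; congr fine; apply: eq_integral => t _.
  rewrite patchE indicE /psi; case: ifP => _ /=; rewrite ?mulr1 ?mulr0//.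
  congr EFin; rewrite -sumrN; apply: eq_bigr => i _.
  by rewrite mxE mulNr scalerN.
- exact: continuous_subspaceT.
- have cF : continuous (fun t : R => phi (x + t *: - h)).
    move=> t; apply: differentiable_continuous; apply/derivable1_diffP.
    by have [] := dF t.
  split.
  + by move=> t _; have [] := dF t.
  + by apply: cvg_at_right_filter; exact: cF.
  + by apply: cvg_at_left_filter; exact: cF.
- by move=> t _; rewrite derive1E; have [] := dF t.
Qed.

Lemma integrable_bounded_line (f : 'rV[R]_n -> R) (g : 'rV[R]_n * R -> R) (M T : R) :
  0 <= T -> mu.-integrable setT (EFin \o f) -> measurable_fun setT g ->
  (forall z, `|g z| <= M) ->
  (mu \x lam)%E.-integrable setT (EFin \o (fun z : 'rV[R]_n * R =>
    f z.1 * (g z * \1_(`[0, T]%classic) z.2))).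
Proof.
move=> T0 intf mg gM.
have mf : measurable_fun setT f by apply/measurable_EFinP; exact: measurable_int intf.
have int0 := integrable_line 0 T0 intf.
apply: (le_integrable measurableT _ _ (integrable_mul_bounded int0 mg gM)).
  apply/measurable_EFinP; apply: measurable_funM.
    by apply: (measurableT_comp mf); exact: measurable_fst.
  apply: measurable_funM => //.
  apply: (@measurableT_comp _ _ _ _ _ _ (\1_(`[0, T]%classic) : R -> R)).
    exact: measurable_indic.
  exact: measurable_snd.
move=> z _ /=; rewrite scaler0 addr0 lee_fin le_eqVlt; apply/orP; left.
by rewrite mulrA mulrAC.
Qed.

(** The increment of u is moved onto the bump by translation, written there as an integral of
    derivatives along h, and moved back, for each t, by the weak gradient identity. The latter needs
    the bump shifted by [t h] to be supported in B, which holds by convexity: for y in the box both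
    y and [y + h] lie in B. *)
Lemma line_tested (a b h : 'rV[R]_n) (k : nat) (T : R) : 0 < T -> T <= 1 ->
  closed_box a b `<=` [set x | B x /\ B (x + h)] ->
  \int[mu]_x ((((u \_ B) (x + T *: h) - (u \_ B) x) -
     \int[lam]_t line_grad h T (x, t)) * box_bump a b k x) = 0.
Proof.
move=> T0 T1 abB; set phi := box_bump a b k.
have sphi : smooth_alg phi by exact: smooth_alg_box_bump.
have mphi := smooth_alg_measurable sphi.
have [M _ HM] := smooth_alg_bounded sphi.
have mU : measurable_fun setT (u \_ B) by apply/measurable_EFinP; exact: measurable_int int_u.
have intUT := integrable_rV_translate (T *: h) int_u.
have intK := integrable_line h (ltW T0) (integrable_dirext h).
have intF := integrable_Rfubini_F intK.
pose psi x := - \sum_(i < n) h ord0 i * partial i phi x.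
have spsi : smooth_alg (fun y => - \sum_(i < n) h ord0 i * partial i phi y).
  rewrite (_ : (fun y => _) = (fun y => (-1) * \sum_(i < n) h ord0 i * partial i phi y)).
    apply: smooth_alg_mul; first exact: smooth_alg_cst.
    by apply: smooth_alg_sumZ => i; exact: smooth_alg_partial.
  by apply/funext => y; rewrite mulN1r.
have [N _ HN] := smooth_alg_bounded spsi.
have mpsiL : measurable_fun setT (fun z : 'rV[R]_n * R => psi (z.1 + z.2 *: (- h))).
  exact: (measurableT_comp (smooth_alg_measurable spsi) (measurable_rV_line (- h))).
have e1 : \int[mu]_x ((u \_ B) (x + T *: h) * phi x) - \int[mu]_x ((u \_ B) x * phi x) =
    \int[mu]_x \int[lam]_t ((u \_ B) x * (psi (x + t *: - h) * \1_(`[0, T]%classic) t)).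
  have -> : \int[mu]_x ((u \_ B) (x + T *: h) * phi x) =
      \int[mu]_x ((u \_ B) x * phi (x - T *: h)).
    rewrite -(Rintegral_rV_translate (T *: h) (f := fun x => (u \_ B) x * phi (x - T *: h))).
      by apply: eq_Rintegral => x _; rewrite addrK.
    apply: measurable_funM => //.
    exact: (measurableT_comp mphi (measurable_rV_translate _)).
  rewrite -RintegralB//; last 2 first.
    apply: (integrable_mul_bounded int_u (M := M)) => //.
    exact: (measurableT_comp mphi (measurable_rV_translate _)).
    exact: (integrable_mul_bounded int_u (M := M)).
  apply: eq_Rintegral => x _.
  rewrite -mulrBr.
  rewrite (line_ftc _ _ T0 sphi).
  rewrite -RintegralZl; [|exact: measurableT|].
    by apply: eq_Rintegral => t _; rewrite scalerN.
  have mpsi : measurable_fun [set: measurableTypeR R] (fun t : R => psi (x + t *: - h)).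
    exact: (measurableT_comp mpsiL (pair1_measurable x)).
  apply: eq_integrable (integrable_mul_bounded (integrable_indic_itv 0 T true false) mpsi (fun t => HN _)) => //.
  by move=> t _ /=; rewrite mulrC scalerN.
have e2 : \int[mu]_x \int[lam]_t ((u \_ B) x * (psi (x + t *: - h) * \1_(`[0, T]%classic) t)) =
    \int[lam]_t \int[mu]_x (line_grad h T (x, t) * phi x).
  apply: etrans (RFubini (integrable_bounded_line (ltW T0) int_u mpsiL (fun z => HN _))) _.
  apply: eq_Rintegral => t _ /=; rewrite /line_grad /= indicE.
  have [tT|tT] := boolP (t \in `[0, T]%classic); last first.
    by under eq_Rintegral do rewrite !mulr0; under [in RHS]eq_Rintegral do rewrite mulr0 mul0r.
  under eq_Rintegral do rewrite mulr1.
  under [in RHS]eq_Rintegral do rewrite mulr1.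
  move: tT; rewrite inE /= in_itv /= => /andP[t0 tT].
  have tphi : test_function B (fun x => phi (x - t *: h)).
    rewrite (_ : (fun x => _) = box_bump (a - - (t *: h)) (b - - (t *: h)) k).
      apply: box_bump_test_function => y yab.
      rewrite (_ : y = (y - t *: h) + t *: ((y - t *: h + h) - (y - t *: h))); last first.
        by rewrite [_ + h]addrC addrK subrK.
      have [By Byh] : B (y - t *: h) /\ B (y - t *: h + h).
        apply: abB; move: yab; rewrite !closed_boxE => yab i; have := yab i.
        by rewrite !mxE opprK lerBrDr lerBlDr.
      by apply: eball_convex => //; rewrite t0 (le_trans tT).
    by apply/funext => x; rewrite /phi box_bump_shift.
  have stphi : smooth_alg (fun x => phi (x - t *: h)).
    rewrite (_ : (fun x => _) = box_bump (a - - (t *: h)) (b - - (t *: h)) k).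
      exact: smooth_alg_box_bump.
    by apply/funext => x; rewrite /phi box_bump_shift.
  transitivity (\int[mu]_x (dirext h x * phi (x - t *: h))).
    rewrite -[RHS]opprK -weak_gradient_along// -mulN1r -RintegralZl//; last first.
      apply: (integrable_mul_bounded int_u (M := N)) => //.
        apply: (smooth_alg_measurable (smooth_alg_sumZ _ _)) => i; exact: smooth_alg_partial.
      move=> x; rewrite -normrN; under eq_bigr do rewrite partial_shift.
      exact: HN.
    apply: eq_Rintegral => x _; rewrite mulrCA; congr (_ * _).
    rewrite mulN1r /psi.
    apply: congr1; apply: eq_bigr => i _; apply: congr1.
    rewrite scalerN; exact: esym (partial_shift _ _ _ _).
  rewrite -(Rintegral_rV_translate (t *: h) (f := fun x => dirext h x * phi (x - t *: h))).
    by apply: eq_Rintegral => x _; rewrite addrK.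
  apply: measurable_funM.
    by apply/measurable_EFinP; exact: measurable_int (integrable_dirext h).
  exact: smooth_alg_measurable.
have intKphi : (mu \x lam)%E.-integrable setT (EFin \o (fun z : 'rV[R]_n * R =>
    line_grad h T z * phi z.1)).
  apply: (integrable_mul_bounded intK (M := M)) => //.
  by apply: (measurableT_comp mphi); exact: measurable_fst.
have e3 : \int[lam]_t \int[mu]_x (line_grad h T (x, t) * phi x) =
    \int[mu]_x ((\int[lam]_t line_grad h T (x, t)) * phi x).
  apply: etrans (esym (RFubini intKphi)) _.
  congr fine; apply: ae_eq_integral => //.
  - exact: measurable_int (integrable_Rfubini_F intKphi).
  - exact: measurable_int (integrable_mul_bounded intF mphi HM).
  apply: filterS (ae_integrable1 intK) => x intx _ /=.
  by congr EFin; rewrite RintegralZr.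
rewrite (_ : \int[mu]_x _ = (\int[mu]_x ((u \_ B) (x + T *: h) * phi x) -
    \int[mu]_x ((u \_ B) x * phi x)) - \int[mu]_x ((\int[lam]_t line_grad h T (x, t)) * phi x)).
  by rewrite e1 e2 e3 subrr.
under eq_Rintegral do rewrite !mulrBl.
rewrite RintegralB//.
- by rewrite RintegralB//; exact: (integrable_mul_bounded _ mphi HM).
- under eq_fun do rewrite -mulrBl; apply: (integrable_mul_bounded _ mphi HM).
  exact: (integrableB measurableT intUT int_u).
- exact: (integrable_mul_bounded intF mphi HM).
Qed.

Lemma sqrD_le_perturb (p q e s : R) : `|p| < e -> e <= 1 -> `|q| < s ->
  (p + q) ^+ 2 <= q ^+ 2 + e * (2 * s + 1).
Proof.
move=> pe e1 qs; rewrite sqrrD addrC -mulr_natl.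
have pq : p * q <= `|p| * `|q| by rewrite -normrM ler_norm.
have pp : p ^+ 2 = `|p| ^+ 2 by rewrite real_normK// num_real.
have : `|p| * (2 * `|q| + `|p|) <= e * (2 * s + 1).
  rewrite ler_pM// ?addr_ge0 ?mulr_ge0// ?ltW//.
  by rewrite ltr_leD ?ltr_pM2l// (le_trans _ e1)// ltW.
move: (q ^+ 2) pp => Q ->; lra.
Qed.

Lemma eball_open (x : 'rV[R]_n) : B x -> exists2 e : R, 0 < e & rV_cube x e `<=` B.
Proof.
move=> Bx; have xr i : `|x ord0 i - x0 ord0 i| < r by exact: eball_sub_cube.
move/(eballP _ _ r_gt0) : Bx; set S := \sum_(i < n) _ => Sr.
(* Moving one coordinate by less than e changes its square by at most [e * (2 * r + 1)]. The factor
   [n.+1] instead of n makes the sum of the n changes strictly smaller than the gap, and is nonzero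
   for [n = 0]. *)
pose e := Num.min 1 ((r ^+ 2 - S) / (n.+1%:R * (2 * r + 1))).
have K0 : 0 < n.+1%:R * (2 * r + 1) by rewrite mulr_gt0// addr_gt0// mulr_gt0.
have e0 : 0 < e by rewrite lt_min ltr01 divr_gt0// subr_gt0.
have e1 : e <= 1 by rewrite ge_min lexx.
have e2 : e * (n.+1%:R * (2 * r + 1)) <= r ^+ 2 - S.
  by rewrite -ler_pdivlMr// ge_min lexx orbT.
exists e => // y yx; apply/(eballP _ _ r_gt0).
apply: (@le_lt_trans _ _ (S + \sum_(i < n) (e * (2 * r + 1)))).
  rewrite -big_split /=; apply: ler_sum => i _; rewrite !mxE.
  have := xr i; have := yx i.
  rewrite -[y ord0 i - x0 ord0 i](subrKA (x ord0 i)) => pe qr.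
  exact: sqrD_le_perturb.
rewrite sumr_const card_ord -[X in _ + X]mulr_natl -ltrBrDl; apply: lt_le_trans e2.
by rewrite mulrCA ltr_pM2l// ltr_pM2r ?ltr_nat// addr_gt0// mulr_gt0.
Qed.

(** [du_bois_reymond] applied to the defect on the open set where both x and [x + h] are in B. The
    exceptional null set depends on T. *)
Lemma line_identity (h : 'rV[R]_n) (T : R) : 0 < T -> T <= 1 ->
  {ae mu, forall x, B x -> B (x + h) ->
     u (x + T *: h) - u x = \int[lam]_t line_grad h T (x, t)}.
Proof.
move=> T0 T1; pose O := [set x | B x /\ B (x + h)].
pose D x := ((u \_ B) (x + T *: h) - (u \_ B) x) - \int[lam]_t line_grad h T (x, t).
have intDu : mu.-integrable setT (EFin \o (fun x => (u \_ B) (x + T *: h) - (u \_ B) x)).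
  exact: (integrableB measurableT (integrable_rV_translate (T *: h) int_u) int_u).
have intF := integrable_Rfubini_F (integrable_line h (ltW T0) (integrable_dirext h)).
have intD : mu.-integrable setT (EFin \o D) := integrableB measurableT intDu intF.
have : {ae mu, forall x, O x -> D x = 0}.
  apply: du_bois_reymond => //.
  - move=> a b k abO; have sphi := smooth_alg_box_bump a b k.
    have [M _ HM] := smooth_alg_bounded sphi.
    have intDphi := integrable_mul_bounded intD (smooth_alg_measurable sphi) HM.
    rewrite -[LHS]fineK; last exact: integrable_fin_num intDphi.
    by congr EFin; exact: line_tested.
  - move=> x [/eball_open[e1 e10 h1] /eball_open[e2 e20 h2]].
    exists (Num.min e1 e2); first by rewrite lt_min e10.
    move=> y yx; split.
      by apply: h1 => i; have := yx i; rewrite lt_min => /andP[].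
    by apply: h2 => i; have := yx i; rewrite !mxE opprD addrACA subrr addr0 lt_min => /andP[].
apply: filterS => x h1 Bx Bxh; have := h1 (conj Bx Bxh).
have BxT : B (x + T *: h).
  rewrite -[X in T *: X](addrK x) [h + x]addrC.
  by apply: eball_convex => //; rewrite ltW.
by rewrite /D !patchE !mem_set// => /eqP; rewrite subr_eq0 => /eqP.
Qed.

End line.

(** * Crossing two levels along a segment *)

Section path_crossing.
Context {R : realType}.
Local Notation lam := (@lebesgue_measure R).

Lemma within_closed_preimage (f : R -> R) (C : set R) :
  {within `[0, 1], continuous f} -> closed C -> closed (`[0, 1] `&` f @^-1` C).
Proof.
move=> /continuous_closedP cf cC.
have /closed_subspaceP[V cV VE] := cf _ cC.
by rewrite setIC -VE; apply: closedI => //; exact: itv_closed.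
Qed.

(** Take for a the last time with [f <= k], and for b the first time from a on with [f >= l]; both
    are attained because the sets of times are closed. *)
Lemma path_crossing (f : R -> R) (k l : R) : {within `[0, 1], continuous f} ->
  f 0 <= k -> k < l -> l <= f 1 ->
  exists a b, [/\ 0 <= a < b, b <= 1, f a <= k, l <= f b &
    forall t, a < t < b -> k < f t < l].
Proof.
move=> cf f0 kl f1.
pose S := `[0, 1] `&` f @^-1` [set y | y <= k].
have cS : closed S by apply: within_closed_preimage => //; exact: closed_le.
have S0 : S 0 by split => //=; rewrite in_itv /= lexx ler01.
have Sub : has_ubound S by exists 1 => t [/=]; rewrite in_itv /= => /andP[].
pose a := sup S.
have Sa : S a.
  by have := closure_sup (ex_intro _ _ S0) Sub; rewrite -(closure_id _).1.
have [] := Sa; rewrite /= in_itv /= => /andP[a0 a1] fa.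
have aub t : a < t -> t <= 1 -> k < f t.
  move=> at_ t1; rewrite ltNge; apply/negP => ft.
  have : t <= a by apply: ub_le_sup => //; split => //=; rewrite in_itv /= t1 (le_trans a0)// ltW.
  by rewrite leNgt at_.
pose U := (`[0, 1] `&` f @^-1` [set y | l <= y]) `&` [set t | a <= t].
have cU : closed U.
  apply: closedI; last exact: closed_ge.
  by apply: within_closed_preimage => //; exact: closed_ge.
have U1 : U 1 by split => //=; split => //=; rewrite in_itv /= lexx ler01.
have Ulb : has_lbound U by exists a => t [].
pose b := inf U.
have Ub : U b.
  rewrite [U in U b](closure_id _).1// => A /nbhs_ballP[e /= e0 eA].
  have [y Uy yb] := inf_adherent e0 (conj (ex_intro _ _ U1) Ulb).
  exists y; split => //; apply: eA; rewrite /ball /= distrC ger0_norm; last first.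
    by rewrite subr_ge0; exact: ge_inf.
  by rewrite ltrBlDl.
have [[]] := Ub; rewrite /= in_itv /= => /andP[b0 b1] fb ab.
have alb : a < b.
  rewrite lt_neqAle ab andbT; apply/eqP => abE.
  by move: fb; rewrite -abE leNgt (le_lt_trans fa).
exists a, b; split => //; first by rewrite a0.
move=> t /andP[at_ tb].
rewrite aub//=; last by rewrite (le_trans _ b1)// ltW.
rewrite ltNge; apply/negP => lt_.
have : b <= t.
  apply: ge_inf => //; split => /=; last exact: ltW.
  by split => //=; rewrite in_itv /= (le_trans a0 (ltW at_)) (le_trans (ltW tb)).
by rewrite leNgt tb.
Qed.

(** Here v stands for u on a segment and f for its absolutely continuous version. On the crossing
    interval the increment of f is the integral of G, and f stays in the layer; the almost
    everywhere equality of v and f is enough, as the layer indicator stands under an integral. *)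
Lemma path_level (G v : R -> R) (c k l : R) :
  lam.-integrable `[0, 1] (EFin \o G) ->
  measurable_fun [set: measurableTypeR R] v ->
  let f (t : R) := c + \int[lam]_(s in `[0, t]) G s in
  c <= k -> k < l -> l <= f 1 ->
  {ae lam, forall t, 0 < t <= 1 -> v t = f t} ->
  ((l - k)%R%:E <= \int[lam]_(t in `[0%R, 1%R]) (`|G t| * \1_(`]k, l[%classic) (v t))%R%:E)%E.
Proof.
move=> intG mv f ck kl lf1 vf.
have miv : measurable_fun [set: measurableTypeR R] (fun t => \1_(`]k, l[%classic) (v t) : R).
  by apply: (@measurableT_comp _ _ _ _ _ _ (\1_(`]k, l[%classic) : R -> R)) => //; exact: measurable_indic.
have mG : measurable_fun (`[0, 1]%classic : set (measurableTypeR R)) G.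
  by apply/measurable_EFinP; exact: measurable_int intG.
have f0 : f 0 = c by rewrite /f set_itv1 Rintegral_set1 addr0.
have cf : {within `[0, 1], continuous f}.
  move=> t; apply: cvgD; first exact: cvg_cst.
  exact: (parameterized_integral_continuous ler01 intG).
have := path_crossing cf _ kl lf1; rewrite f0 => /(_ ck) [a [b [/andP[a0 ab] b1 fa fb fab]]].
have sub : `]a, b] `<=` `[0, 1].
  by move=> t /=; rewrite !in_itv /= => /andP[at_ tb]; rewrite (le_trans a0 (ltW at_)) (le_trans tb b1).
have intGab : lam.-integrable `]a, b] (EFin \o G) by apply: integrableS intG.
apply: (@le_trans _ _ (\int[lam]_(t in `]a, b]) G t)%R%:E).
  rewrite lee_fin; apply: (@le_trans _ _ (f b - f a)); first by rewrite lerB.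
  rewrite /f opprD addrACA subrr add0r Rintegral_itvB ?bnd_simp ?(ltW ab)//.
  apply: integrableS intG => // t /=; rewrite !in_itv /= => /andP[-> tb].
  exact: le_trans b1.
apply: (@le_trans _ _ (\int[lam]_(t in `]a, b]) `|G t|%R%:E)%E).
  apply: (@le_trans _ _ `|(\int[lam]_(t in `]a, b]) G t)%R|%:E); first by rewrite lee_fin ler_norm.
  rewrite EFin_normr_Rintegral//; apply: le_abse_integral => //.
  exact: measurable_int intGab.
apply: (@le_trans _ _ (\int[lam]_(t in `]a, b]) (`|G t| * \1_(`]k, l[%classic) (v t))%R%:E)%E).
  rewrite le_eqVlt; apply/orP; left; apply/eqP; apply: ae_eq_integral => //.
  - by apply/measurable_EFinP; apply: measurableT_comp => //; exact: measurable_funS mG.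
  - apply/measurable_EFinP; apply: measurable_funM; last exact: measurable_funTS.
    by apply: measurableT_comp => //; exact: measurable_funS mG.
  (* The layer is entered strictly only between a and b, so the endpoint b is discarded as a null
     set. *)
  have nb : {ae lam, forall t, t != b}.
    exists [set b]; split => //; first exact: lebesgue_measure_set1.
    by move=> t /= /negP; rewrite negbK => /eqP.
  have FF := ae_filter_ringOfSetsType lam.
  apply: filterS2 vf nb => t vt tb /=; rewrite in_itv /= => /andP[at_ tb'].
  rewrite vt; last by rewrite (le_lt_trans a0 at_) (le_trans tb' b1).
  have /fab/andP[kf fl] : a < t < b by rewrite at_ lt_neqAle tb.
  by rewrite indicE mem_set ?mulr1//= in_itv /= kf.
apply: ge0_subset_integral => //.
- apply/measurable_EFinP; apply: measurable_funM; last exact: measurable_funTS.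
  exact: measurableT_comp.
Qed.

End path_crossing.

(** * From almost every length to almost every whole segment *)

Section product_null_sets.
Context d1 d2 (T1 : measurableType d1) (T2 : measurableType d2) (R : realType).
Variables (m1 : {sigma_finite_measure set T1 -> \bar R})
  (m2 : {sigma_finite_measure set T2 -> \bar R}).

(** Tonelli measurability for the positive and the negative part separately. It serves line
    integrals that have no sign and are not known to be integrable. *)
Lemma measurable_fubini_F_gen (f : T1 * T2 -> \bar R) : measurable_fun setT f ->
  measurable_fun setT (fun x => \int[m2]_y f (x, y))%E.
Proof.
move=> mf; under eq_fun do rewrite integralE.
apply: emeasurable_funB.
- rewrite (_ : (fun x => _) = fubini_F m2 (f^\+)%E).
    apply: measurable_fun_fubini_tonelli_F; first exact: measurable_funepos.
    by move=> x; rewrite funeposE le_max lexx orbT.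
  by apply/funext => x; apply: eq_integral => y _; rewrite !funeposE.
- rewrite (_ : (fun x => _) = fubini_F m2 (f^\-)%E).
    apply: measurable_fun_fubini_tonelli_F; first exact: measurable_funeneg.
    by move=> x; rewrite funenegE le_max lexx orbT.
  by apply/funext => x; apply: eq_integral => y _; rewrite !funenegE.
Qed.

(** The product measure of N can be computed from either family of sections. *)
Lemma ae_xsection0 (N : set (T1 * T2)) : measurable N ->
  (forall y, m1 (ysection N y) = 0%E) -> {ae m1, forall x, m2 (xsection N x) = 0%E}.
Proof.
move=> mN N0.
have : (\int[m1]_x m2 (xsection N x) = 0)%E.
  rewrite -[LHS]/((m1 \x m2)%E N) (product_measure_unique (m' := (m1 \x^ m2)%E))//.
    by apply: integral0_eq => y _ /=; exact: N0.
  by move=> A C mA mC; exact: product_measure2E.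
move=> h.
have mX := measurable_fun_xsection m2 mN.
have : ae_eq m1 setT (m2 \o xsection N) (cst 0%E).
  apply/(ae_eq_integral_abs m1 measurableT mX); rewrite -[RHS]h.
  by apply: eq_integral => x _; rewrite gee0_abs.
by apply: filterS => x /(_ I).
Qed.

End product_null_sets.

Section line_paths.
Context {R : realType} (n : nat).
Local Notation mu := (lebesgue_rV R n).
Local Notation lam := (@lebesgue_measure R).
Variables (x0 : 'rV[R]_n) (r : R).
Hypothesis r_gt0 : 0 < r.
Variables (u : 'rV[R]_n -> R) (Du : 'rV[R]_n -> 'rV[R]_n).
Local Notation B := (eball x0 r).
Hypothesis sob : sobolev11 B u Du.
Local Notation dirext := (dirext x0 r Du).
Local Notation line_grad := (line_grad x0 r Du).

Lemma measurable_sobolev_patch : measurable_fun setT (u \_ B).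
Proof.
apply/measurable_EFinP; apply: (@measurable_int _ _ _ mu).
by apply: integrable_patch; [exact: measurable_eball|case: sob].
Qed.

Lemma measurable_dirext h : measurable_fun setT (dirext h).
Proof. apply/measurable_EFinP; apply: measurable_int (integrable_dirext sob h). Qed.

(** Joint measurability in base point and length, which the exchange of null sets through
    [ae_xsection0] presupposes. *)
Lemma measurable_line_defect (h : 'rV[R]_n) :
  measurable_fun [set: 'rV[R]_n * R] (fun z => ((u \_ B) (z.1 + z.2 *: h) - (u \_ B) z.1)
    - \int[lam]_s line_grad h z.2 (z.1, s)).
Proof.
apply: measurable_funB.
  apply: measurable_funB.
    exact: (measurableT_comp measurable_sobolev_patch (measurable_rV_line h)).
  by apply: (measurableT_comp measurable_sobolev_patch); exact: measurable_fst.
pose f (z : ('rV[R]_n * R) * R) : \bar R := (line_grad h z.1.2 (z.1.1, z.2))%:E.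
apply: (@measurableT_comp _ _ _ _ _ _ (@fine R)); first exact: fine_measurable.
apply: (measurable_fubini_F_gen lam (f := f)).
apply/measurable_EFinP; apply: measurable_funM.
  apply: (measurableT_comp (measurable_dirext h)).
  apply: (measurableT_comp (measurable_rV_line h) (g := fun z : ('rV[R]_n * R) * R => (z.1.1, z.2))).
  apply: measurable_fun_pair; last exact: measurable_snd.
  apply: (measurableT_comp measurable_fst); exact: measurable_fst.
pose S : set (('rV[R]_n * R) * R) := [set z | `[0, z.1.2]%classic z.2].
rewrite (_ : (fun z => _) = (\1_S : _ -> R)).
  apply: measurable_indic.
  rewrite (_ : S = (fun z => z.2) @^-1` `[0, +oo[%classic `&`
     (fun z => z.1.2 - z.2) @^-1` `[0, +oo[%classic).
    have mfun : measurable_fun setT (fun z : ('rV[R]_n * R) * R => z.1.2 - z.2).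
      apply: measurable_funB; last exact: measurable_snd.
      by apply: (measurableT_comp measurable_snd); exact: measurable_fst.
    apply: measurableI.
      by rewrite -[X in measurable X]setTI; apply: measurable_snd.
    by rewrite -[X in measurable X]setTI; apply: mfun.
  apply/seteqP; split => z; rewrite /S /= !in_itv /= !andbT subr_ge0.
    by move/andP.
  by move=> [-> ->].
by apply/funext => z; rewrite !indicE /S; congr ((nat_of_bool _)%:R); rewrite !in_setE.
Qed.

(** [line_identity] holds at each length for almost every x; by [ae_xsection0], almost every x then
    has it at almost every length. Length 1 is added separately, since the end value [u (x + h)]
    must be exact. The null set does not depend on the levels. *)
Lemma ae_path_level (h : 'rV[R]_n) :
  {ae mu, forall x, B x -> B (x + h) -> forall k l, k < l -> u x <= k -> l <= u (x + h) ->
   ((l - k)%R%:E <= \int[lam]_(t in `[0%R, 1%R])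
     (`|dirext h (x + t *: h)| * \1_(`]k, l[%classic) ((u \_ B) (x + t *: h)))%R%:E)%E}.
Proof.
pose Phi (z : 'rV[R]_n * R) := ((u \_ B) (z.1 + z.2 *: h) - (u \_ B) z.1)
    - \int[lam]_s line_grad h z.2 (z.1, s).
pose N : set ('rV[R]_n * R) := [set z | [/\ B z.1, B (z.1 + h), 0 < z.2 <= 1 & Phi z != 0]].
have mB : measurable B := measurable_eball x0 r.
have mN : measurable N.
  rewrite (_ : N = (fst @^-1` B `&` (fun z => z.1 + h) @^-1` B) `&`
     (snd @^-1` `]0, 1]%classic `&` Phi @^-1` [set~ 0])); last first.
    apply/seteqP; split => z; rewrite /N /= in_itv /=.
      by move=> [? ? ? /eqP].
    by move=> [[? ?] [? /eqP]].
  apply: measurableI; apply: measurableI.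
  - by rewrite -[X in measurable X]setTI; apply: measurable_fst.
  - rewrite -[X in measurable X]setTI.
    by apply: (measurableT_comp (measurable_rV_translate h) measurable_fst).
  - by rewrite -[X in measurable X]setTI; apply: measurable_snd.
  - rewrite -[X in measurable X]setTI; apply: (measurable_line_defect h) => //.
    exact: measurableC.
have xB x t : B x -> B (x + h) -> 0 < t <= 1 -> B (x + t *: h).
  move=> Bx Bxh /andP[t0 t1].
  rewrite -[X in t *: X](addrK x) [h + x]addrC.
  by apply: eball_convex => //; rewrite ltW.
have N0 t : mu (ysection N t) = 0%E.
  have [/andP[t0 t1]|tn] := boolP (0 < t <= 1); last first.
    rewrite (_ : ysection N t = set0) ?measure0//.
    apply/seteqP; split => x //; rewrite /ysection /= inE => -[_ _ /=].
    by rewrite (negbTE tn).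
  apply: measure_negligible; first exact: measurable_ysection.
  have := line_identity r_gt0 sob h t0 t1.
  apply: negligibleS => x; rewrite /ysection /= inE => -[/= Bx Bxh t01 Phi0] H.
  move/negP: Phi0; apply.
  rewrite /Phi /= !patchE !mem_set//; last exact: xB.
  by rewrite H// subrr.
have ae1 := ae_xsection0 lam mN N0.
have ae2 := line_identity r_gt0 sob h ltr01 (lexx 1).
have ae3 := ae_integrable1 (integrable_line h ler01 (integrable_dirext sob h)).
have FF := ae_filter_ringOfSetsType mu.
apply: filterS (filterI ae1 (filterI ae2 ae3)) => x [xN [x1 intx]] Bx Bxh k l kl uk lu.
have fE t : \int[lam]_s line_grad h t (x, s) = \int[lam]_(s in `[0, t]) dirext h (x + s *: h).
  rewrite [RHS]Rintegral_mkcond; apply: eq_Rintegral => s _.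
  by rewrite /line_grad patchE indicE /=; case: ifP; rewrite ?mulr1 ?mulr0.
apply: (path_level (c := u x) (v := fun t => (u \_ B) (x + t *: h))) => //.
- apply/integrable_mkcond; first exact: measurable_itv.
  apply: eq_integrable intx => //.
  move=> t _ /=; rewrite patchE indicE /=.
  by case: ifP => _ /=; rewrite ?mulr1 ?mulr0.
- exact: (measurableT_comp (measurableT_comp measurable_sobolev_patch (measurable_rV_line h)) (pair1_measurable x)).
- by rewrite -fE -x1// scale1r addrC subrK.
- have mNx := measurable_xsection x mN.
  exists (xsection N x); split => //.
  move=> t /= /not_implyP[t01 ut]; rewrite /xsection /= inE; split => //=.
  apply/negP => /eqP Phi0; apply: ut; move: Phi0; rewrite /Phi /= fE.
  by rewrite [(u \_ B) x]patchE mem_set// => /eqP; rewrite subr_eq0 => /eqP <-; rewrite [RHS]addrC subrK.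
Qed.

End line_paths.

(** * The estimate for two level sets *)

Section level_kernel.
Context {R : realType}.
Local Notation lam := (@lebesgue_measure R).

(* The majorant of min(A, f/s)^(m+2) is chosen so that its integral over s in
   [0, 1] is explicit. *)
Lemma level_majorant (A f s : R) (m : nat) : 0 < A -> 0 < f -> 0 <= s ->
  let M := A ^+ m * (2 * A * f / (f + A * s)) ^+ 2 in
  (A * s <= f -> A ^+ m.+2 <= M) /\ (f < A * s -> (f / s) ^+ m.+2 <= M).
Proof.
move=> A0 f0 s0 M; have d0 : 0 < f + A * s by rewrite ltr_wpDr// mulr_ge0// ltW.
have A0' := ltW A0; have f0' := ltW f0.
have q0 : 0 <= 2 * A * f / (f + A * s) by rewrite divr_ge0 ?(ltW d0)// !mulr_ge0.
split => h.
  rewrite -addn2 exprD /M ler_wpM2l ?exprn_ge0//.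
  rewrite ler_pXn2r// ler_pdivlMr//; nra.
have s1 : 0 < s by rewrite -(pmulr_rgt0 _ A0) (lt_trans f0).
have fs0 : 0 <= f / s by rewrite divr_ge0.
rewrite -addn2 exprD /M ler_pM ?exprn_ge0//.
  rewrite lerXn2r// ler_pdivrMr// ltW//.
rewrite ler_pXn2r// ler_pdivlMr// mulrAC ler_pdivrMr//; nra.
Qed.

Lemma is_derive_inv_affine (A f t : R) : 0 < A -> 0 < f -> t <= 1 ->
  is_derive t 1 (fun t : R => (f + A * (1 - t))^-1) (- (f + A * (1 - t)) ^- 2 * - A).
Proof.
move=> A0 f0 t1.
have d0 : 0 < f + A * (1 - t) by rewrite ltr_wpDr// mulr_ge0 ?subr_ge0// ltW.
have dg : is_derive t 1 (fun t : R => f + A * (1 - t)) (- A).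
  by apply: is_derive_eq; rewrite !add0r !mul1r [LHS]mulrN1.
have := is_deriveV (f := fun t : R => f + A * (1 - t)) (lt0r_neq0 d0) dg.
by [].
Qed.

Lemma continuous_level_majorant (A f : R) (m : nat) : 0 < A -> 0 < f ->
  {within `[0, 1], continuous (fun t : R => A ^+ m * (2 * A * f / (f + A * (1 - t))) ^+ 2)}.
Proof.
move=> A0 f0.
apply: continuous_in_subspaceT => t; rewrite inE /= in_itv /= => /andP[t0 t1].
have cV : {for t, continuous (fun t : R => (f + A * (1 - t))^-1)}.
  apply: differentiable_continuous; apply/derivable1_diffP.
  by have [] := is_derive_inv_affine A0 f0 t1.
by apply: cvgM; [exact: cvg_cst|apply: cvgM; apply: cvgM => //; exact: cvg_cst].
Qed.

(** An antiderivative is [4 A^(m+1) f^2 / (f + A (1 - t))], of which only the value at [t = 1] is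
    kept. With [A = 4 r] and [m = n - 2] this is the source of [r^(n-1) |F|^(1/n)]. *)
Lemma integral_level_majorant (A f : R) (m : nat) : 0 < A -> 0 < f ->
  (\int[lam]_(t in `[0%R, 1%R]) (A ^+ m * (2 * A * f / (f + A * (1 - t))) ^+ 2)%R%:E
   <= (4 * A ^+ m.+1 * f)%R%:E)%E.
Proof.
move=> A0 f0.
pose F (t : R) := 4 * A ^+ m.+1 * f ^+ 2 * (f + A * (1 - t))^-1.
have d0 t : t <= 1 -> 0 < f + A * (1 - t).
  by move=> t1; rewrite ltr_wpDr// mulr_ge0 ?subr_ge0// ltW.
have dF (t : R) : t <= 1 ->
    is_derive t 1 F (A ^+ m * (2 * A * f / (f + A * (1 - t))) ^+ 2).
  move=> t1; have dV := is_derive_inv_affine A0 f0 t1.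
  apply: is_derive_eq; rewrite /=.
  suff : 4 * A ^+ m.+1 * f ^+ 2 * (- (f + A * (1 - t)) ^- 2 * - A) =
    A ^+ m * (2 * A * f / (f + A * (1 - t))) ^+ 2 by [].
  by rewrite exprS; field; exact: lt0r_neq0 (d0 _ t1).
have cF (t : R) : t <= 1 -> {for t, continuous F}.
  move=> t1; apply: differentiable_continuous; apply/derivable1_diffP.
  by have [] := dF t t1.
rewrite (@continuous_FTC2 R _ F 0 1 ltr01).
- rewrite -EFinB lee_fin /F !subrr mulr0 !addr0 subr0 mulr1.
  apply: (@le_trans _ _ (4 * A ^+ m.+1 * f ^+ 2 / f)).
    rewrite lerBlDr lerDl divr_ge0 ?addr_ge0 ?ltW//.
    by rewrite !mulr_gt0// exprn_gt0.
  by rewrite expr2 mulrA mulfK ?gt_eqF.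
- exact: continuous_level_majorant.
- split.
  + by move=> t; rewrite in_itv /= => /andP[t0 t1]; have [] := dF t (ltW t1).
  + by apply: cvg_at_right_filter; exact: cF.
  + by apply: cvg_at_left_filter; exact: cF.
- by move=> t; rewrite in_itv /= => /andP[t0 t1]; rewrite derive1E; have [] := dF t (ltW t1).
Qed.

End level_kernel.

Section level_estimate.
Context {R : realType} (n : nat).
Local Notation mu := (lebesgue_rV R n).
Local Notation lam := (@lebesgue_measure R).

Lemma measurable_rV_lin d (T : measurableType d) (a b : T -> 'rV[R]_n) (s : T -> R) :
  measurable_fun setT a -> measurable_fun setT b -> measurable_fun setT s ->
  measurable_fun setT (fun x => a x + s x *: b x).
Proof.
move=> ma mb ms; apply: measurable_fun_rVP => i.
rewrite (_ : (fun x => _) = (fun x => a x ord0 i + s x * b x ord0 i)).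
  apply: measurable_funD; first exact: (measurableT_comp (measurable_rV_coord i) ma).
  by apply: measurable_funM => //; exact: (measurableT_comp (measurable_rV_coord i) mb).
by apply/funext => x; rewrite !mxE.
Qed.

Lemma measurable_indic_comp d (T : measurableType d) d' (T' : measurableType d')
  (A : set T') (f : T -> T') : measurable A -> measurable_fun setT f ->
  measurable_fun setT (fun x => \1_A (f x) : R).
Proof.
move=> mA mf; apply: (@measurableT_comp _ _ _ _ _ _ (\1_A : T' -> R)) => //.
Qed.

Hypothesis n2 : (2 <= n)%N.

(** Two bounds compete: the whole cube, of side [4 r], and a rescaled copy of F, of measure
    [|F| / (1 - t)^n]. The first is used when [4 r (1 - t) <= f], the second otherwise. *)
Lemma level_section (F : set 'rV[R]_n) (f r : R) (z : 'rV[R]_n) (t : R) :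
  measurable F -> 0 < r -> 0 < f -> mu F = (f ^+ n)%:E -> 0 <= t <= 1 ->
  (mu (rV_cube 0%R (2 * r)%R `&` [set h | F (z + (1 - t) *: h)%R]) <=
   ((4 * r) ^+ (n - 2)%N * (2 * (4 * r) * f / (f + 4 * r * (1 - t))) ^+ 2)%R%:E)%E.
Proof.
move=> mF r0 f0 muF /andP[t0 t1].
have A0 : 0 < 4 * r by rewrite mulr_gt0.
have s0 : 0 <= 1 - t by rewrite subr_ge0.
have [M1 M2] := level_majorant (n - 2) A0 f0 s0.
have nE : (n - 2).+2 = n by rewrite -addn2 subnK.
have mF' : measurable [set h | F (z + (1 - t) *: h)].
  by rewrite -[X in measurable X]setTI; apply: (measurable_rV_affine z (1 - t)).
have mC := measurable_rV_cube (0 : 'rV[R]_n) (2 * r).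
have [h|h] := leP (4 * r * (1 - t)) f.
  apply: (@le_trans _ _ (mu (rV_cube 0 (2 * r)))).
    by apply: le_measure; rewrite ?inE//; exact: measurableI.
  rewrite lebesgue_rV_cube ?mulr_gt0// lee_fin mulrA -natrM.
  by have := M1 h; rewrite nE.
apply: (@le_trans _ _ (mu [set h | F (z + (1 - t) *: h)])).
  by apply: le_measure; rewrite ?inE//; exact: measurableI.
have s1 : 0 < 1 - t by rewrite -(pmulr_rgt0 _ A0) (lt_trans f0).
rewrite (lebesgue_rV_affine z s1 mF) muF -EFinM lee_fin.
by have := M2 h; rewrite nE expr_div_n mulrC.
Qed.

Variables (x0 : 'rV[R]_n) (r : R).
Hypothesis r_gt0 : 0 < r.
Variables (u : 'rV[R]_n -> R) (Du : 'rV[R]_n -> 'rV[R]_n).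
Local Notation B := (eball x0 r).
Hypothesis sob : sobolev11 B u Du.
Local Notation dirext := (dirext x0 r Du).

Definition level_grad (k l : R) : 'rV[R]_n -> R :=
  (fun y => enorm (Du y) * \1_(`]k, l[%classic) (u y)) \_ B.

Let mB : measurable B := measurable_eball x0 r.

Lemma measurable_level_grad k l : measurable_fun setT (level_grad k l).
Proof.
case: sob => /measurable_int/measurable_EFinP mu_ mDu _.
apply: (measurable_restrictT _ mB).1; apply: measurable_funM.
  by apply: measurable_enorm => i; apply/measurable_EFinP; exact: measurable_int (mDu i).
apply: (@measurableT_comp _ _ _ _ _ _ (\1_(`]k, l[%classic) : R -> R)) => //.
Qed.

Lemma enorm_ge0 (x : 'rV[R]_n) : 0 <= enorm x. Proof. exact: sqrtr_ge0. Qed.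

Lemma level_grad_ge0 k l x : 0 <= level_grad k l x.
Proof. by rewrite /level_grad patchE; case: ifP => // _; rewrite mulr_ge0// enorm_ge0. Qed.

Lemma dirext_le_level_grad k l (h y : 'rV[R]_n) : rV_cube 0 (2 * r) h ->
  `|dirext h y| * \1_(`]k, l[%classic) ((u \_ B) y) <= n%:R * (2 * r) * level_grad k l y.
Proof.
move=> hC; rewrite /dirext /level_grad !patchE; case: ifP => yB; last first.
  by rewrite normr0 mul0r mulr0.
rewrite mulrA ler_wpM2r//; apply: le_trans (ler_norm_sum _ _ _) _.
apply: (@le_trans _ _ (\sum_(i < n) (2 * r) * enorm (Du y))).
  apply: ler_sum => i _; rewrite normrM ler_pM// ?ler_coord_enorm//.
  by have := hC i; rewrite mxE subr0 => /ltW.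
by rewrite sumr_const card_ord -[leLHS]mulr_natl mulrA.
Qed.

Section fixed_level.
Variables (k l : R).
Hypothesis kl : k < l.
Let A := B `&` [set x | u x <= k].
Let F := B `&` [set x | l <= u x].
Let g := level_grad k l.
Let C : set 'rV[R]_n := rV_cube 0 (2 * r).
Let I : set R := `[0, 1]%classic.

Lemma measurable_sub_level k' : measurable (B `&` [set x | u x <= k']).
Proof.
by case: sob => /measurable_int/measurable_EFinP mu_ _ _; exact: measurable_fun_le.
Qed.

Lemma measurable_super_level l' : measurable (B `&` [set x | l' <= u x]).
Proof.
by case: sob => /measurable_int/measurable_EFinP mu_ _ _; exact: measurable_fun_le.
Qed.

Let mA : measurable A := measurable_sub_level k.
Let mF : measurable F := measurable_super_level l.
Let mC : measurable C := measurable_rV_cube 0 (2 * r).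
Let mI : measurable I := measurable_itv _.
Let mg : measurable_fun setT g := measurable_level_grad k l.
Let g0 x : 0 <= g x := level_grad_ge0 k l x.
Let K := n%:R * (2 * r).
Let K0 : 0 <= K. Proof. by rewrite !mulr_ge0// ltW. Qed.

Let ind0 T (D : set T) (x : T) : 0 <= (\1_D x : R). Proof. by []. Qed.

(** The integrand after the substitution [z = x + t h], under which [x + h] becomes
    [z + (1 - t) h]. *)
Let q (h : 'rV[R]_n) (t : R) (z : 'rV[R]_n) : R :=
  \1_C h * \1_I t * (g z * \1_F (z + (1 - t) *: h)).

Let q0 h t z : 0 <= q h t z.
Proof. by rewrite /q !mulr_ge0. Qed.

Let mq d (T : measurableType d) (h z : T -> 'rV[R]_n) (t : T -> R) :
  measurable_fun setT h -> measurable_fun setT z -> measurable_fun setT t ->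
  measurable_fun setT (fun x => q (h x) (t x) (z x)).
Proof.
move=> mh mz mt; apply: measurable_funM.
  by apply: measurable_funM; exact: measurable_indic_comp.
apply: measurable_funM; first exact: (measurableT_comp mg mz).
apply: measurable_indic_comp => //; apply: measurable_rV_lin => //.
exact: measurable_funB.
Qed.

Lemma level_fixed_direction (h : 'rV[R]_n) :
  (\int[mu]_x ((l - k) * (\1_A x * \1_F (x + h)))%R%:E <=
   K%:E * \int[lam]_t \int[mu]_z (q h t z)%:E)%E.
Proof.
have mid : measurable_fun setT (@id 'rV[R]_n) by [].
pose w (x : 'rV[R]_n) (t : R) := q h t (x + t *: h).
have wE x t : w x t = \1_C h * \1_I t * (g (x + t *: h) * \1_F (x + h)).
  rewrite /w /q; congr (_ * (_ * \1_F _)).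
  by rewrite -addrA -scalerDl (addrC t) subrK scale1r.
have mw : measurable_fun setT (fun z : 'rV[R]_n * R => w z.1 z.2).
  apply: (mq (h := fun=> h) (z := fun z : 'rV[R]_n * R => z.1 + z.2 *: h) (t := snd)).
  - exact: measurable_cst.
  - exact: measurable_rV_line.
  - exact: measurable_snd.
have -> : (\int[lam]_t \int[mu]_z (q h t z)%:E = \int[mu]_x \int[lam]_t (w x t)%:E)%E.
  have mwE : measurable_fun setT (fun z : 'rV[R]_n * R => (w z.1 z.2)%:E).
    exact/measurable_EFinP.
  have wE0 z : (0 <= (w z.1 z.2)%:E)%E by rewrite lee_fin q0.
  have /= -> := @fubini_tonelli _ _ _ _ R mu lam (fun z => (w z.1 z.2)%:E) mwE wE0.
  apply: eq_integral => t _.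
  rewrite -(ge0_integral_rV_translate (t *: h) (f := fun z => (q h t z)%:E))//.
    by apply/measurable_EFinP; apply: (mq (h := fun=> h) (z := id) (t := fun=> t)).
  by move=> z; rewrite lee_fin q0.
have mwx : measurable_fun setT (fun x => \int[lam]_t (w x t)%:E)%E.
  apply: (measurable_fubini_F_gen lam (f := fun z : 'rV[R]_n * R => (w z.1 z.2)%:E)).
  exact/measurable_EFinP.
have w0 x t : 0 <= w x t by exact: q0.
rewrite -ge0_integralZl//; last first.
  by move=> x _; apply: integral_ge0 => t _; rewrite lee_fin.
apply: ae_ge0_le_integral => //.
- by move=> x _; rewrite lee_fin !mulr_ge0// subr_ge0 ltW.
- apply/measurable_EFinP; apply: measurable_funM => //; apply: measurable_funM => //.
  by apply: measurable_indic_comp => //; exact: measurable_rV_translate.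
- by move=> x _; rewrite mule_ge0// integral_ge0// => t _; rewrite lee_fin.
- exact: measurable_funeM.
apply: filterS (ae_path_level r_gt0 sob h) => x H _.
have [[Ax Fx]|nAF] := pselect (A x /\ F (x + h)); last first.
  have -> : \1_A x * \1_F (x + h) = 0 :> R.
    rewrite !indicE; have [|xA] := boolP (x \in A); last by rewrite mul0r.
    rewrite inE => Ax; have [|] := boolP (x + h \in F); last by rewrite mulr0.
    by rewrite inE => Fx; case: nAF.
  by rewrite mulr0 mule_ge0// integral_ge0// => t _; rewrite lee_fin.
have [Bx ux] := Ax; have [Bxh uxh] := Fx.
(* Both x and [x + h] are in the ball, so restricting h to the cube loses nothing. *)
have hC : C h.
  move=> i; have := eball_diff r_gt0 Bxh Bx.
  by rewrite mxE subr0; apply: le_lt_trans; have := ler_coord_enorm (x + h - x) i; rewrite addrC addKr.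
rewrite [X in (X%:E <= _)%E](_ : _ = l - k); last first.
  by rewrite !indicE !mem_set// !mulr1.
apply: le_trans (H Bx Bxh k l kl ux uxh) _.
have -> : (\int[lam]_t (w x t)%:E = \int[lam]_(t in I) (g (x + t *: h))%:E)%E.
  rewrite [RHS]integral_mkcond; apply: eq_integral => t _.
  rewrite wE patchE !indicE (mem_set hC) (mem_set Fx) mul1r mulr1.
  by case: ifP => _; rewrite ?mul1r ?mul0r.
have mgx : measurable_fun [set: measurableTypeR R] (fun t => g (x + t *: h)).
  exact: (measurableT_comp (measurableT_comp mg (measurable_rV_line h)) (pair1_measurable x)).
rewrite -ge0_integralZl//; last 2 first.
  by apply/measurable_EFinP; exact: measurable_funTS.
  by move=> t _; rewrite lee_fin.
apply: ge0_le_integral => //.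
- apply/measurable_EFinP; apply: measurable_funTS; apply: measurable_funM.
    apply: measurableT_comp => //.
    exact: (measurableT_comp (measurableT_comp (measurable_dirext sob h) (measurable_rV_line h)) (pair1_measurable x)).
  apply: measurable_indic_comp => //.
  exact: (measurableT_comp (measurableT_comp (measurable_sobolev_patch sob) (measurable_rV_line h)) (pair1_measurable x)).
- by apply: measurable_funeM; apply/measurable_EFinP; exact: measurable_funTS.
- by move=> t _; rewrite -EFinM lee_fin; exact: dirext_le_level_grad.
Qed.

Lemma measurable_level_lhs : measurable_fun setT (fun z : 'rV[R]_n * 'rV[R]_n =>
  ((l - k) * (\1_A z.2 * \1_F (z.2 + z.1)))%R%:E).
Proof.
apply/measurable_EFinP; apply: measurable_funM => //; apply: measurable_funM.
  by apply: measurable_indic_comp => //; exact: measurable_snd.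
apply: measurable_indic_comp => //.
rewrite (_ : (fun z => _) = (fun z : 'rV[R]_n * 'rV[R]_n => z.2 + 1 *: z.1)).
  by apply: measurable_rV_lin; [exact: measurable_snd|exact: measurable_fst|exact: measurable_cst].
by apply/funext => z; rewrite scale1r.
Qed.

Lemma integral_level_lhs :
  (\int[mu]_h \int[mu]_x ((l - k) * (\1_A x * \1_F (x + h)))%R%:E =
   (l - k)%R%:E * (mu A * mu F))%E.
Proof.
pose w (z : 'rV[R]_n * 'rV[R]_n) := (((l - k) * (\1_A z.2 * \1_F (z.2 + z.1)))%R%:E)%E.
have lk0 : 0 <= l - k by rewrite subr_ge0 ltW.
have mw : measurable_fun setT w by exact: measurable_level_lhs.
have w0 z : (0 <= w z)%E by rewrite lee_fin !mulr_ge0.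
have /= -> := @fubini_tonelli _ _ _ _ R mu mu w mw w0.
transitivity (\int[mu]_x ((l - k)%R%:E * mu F * (\1_A x)%:E))%E.
  apply: eq_integral => x _; rewrite /w /=.
  have mFx : measurable_fun setT (fun h : 'rV[R]_n => (\1_F (h + x)%R)%:E : \bar R).
    apply/measurable_EFinP; apply: measurable_indic_comp => //.
    exact: measurable_rV_translate.
  under eq_integral => h _ do rewrite mulrA EFinM (addrC x h).
  rewrite ge0_integralZl//; last by rewrite lee_fin mulr_ge0.
  rewrite (ge0_integral_rV_translate x (f := fun h => (\1_F h)%:E))//; last first.
    by apply/measurable_EFinP; exact: measurable_indic.
  by rewrite integral_indic// setIT EFinM -muleA [((\1_A x)%:E * _)%E]muleC muleA.
rewrite ge0_integralZl ?mule_ge0//.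
- by rewrite integral_indic// setIT -muleA [(mu F * _)%E]muleC.
- by apply/measurable_EFinP; exact: measurable_indic.
Qed.

(** Integrating [level_fixed_direction] over h leaves a triple integral. With t and z fixed and h
    innermost, [level_section] bounds the measure of the admissible h by a function of t alone, so
    the integral of the layer gradient factors out. *)
Lemma level_estimate (f : R) : 0 < f -> mu F = (f ^+ n)%:E ->
  ((l - k)%R%:E * (mu A * mu F) <=
   (K * (4 * (4 * r) ^+ (n - 1)%N * f))%R%:E * \int[mu]_z (g z)%:E)%E.
Proof.
move=> f0 muF.
have rr0 : 0 < 4 * r by rewrite mulr_gt0.
have mqE d (T : measurableType d) (h z : T -> 'rV[R]_n) (t : T -> R) :
    measurable_fun setT h -> measurable_fun setT z -> measurable_fun setT t ->
    measurable_fun setT (fun x => (q (h x) (t x) (z x))%:E).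
  by move=> mh mz mt; apply/measurable_EFinP; apply: mq.
have Q0 h t : (0 <= \int[mu]_z (q h t z)%:E)%E by apply: integral_ge0 => z _; rewrite lee_fin.
have mQ : measurable_fun setT (fun p : 'rV[R]_n * R => \int[mu]_z (q p.1 p.2 z)%:E)%E.
  apply: (measurable_fubini_F_gen mu (f := fun p : ('rV[R]_n * R) * 'rV[R]_n => (q p.1.1 p.1.2 p.2)%:E)).
  apply: (mqE _ _ (fun p => p.1.1) (fun p => p.2) (fun p => p.1.2)).
  - exact: (measurableT_comp measurable_fst measurable_fst).
  - exact: measurable_snd.
  - exact: (measurableT_comp measurable_snd measurable_fst).
have mTQ : measurable_fun setT (fun h => \int[lam]_t \int[mu]_z (q h t z)%:E)%E.
  exact: (measurable_fubini_F_gen lam (f := fun p : 'rV[R]_n * R => (\int[mu]_z (q p.1 p.2 z)%:E)%E)).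
rewrite -integral_level_lhs.
apply: (@le_trans _ _ (\int[mu]_h (K%:E * \int[lam]_t \int[mu]_z (q h t z)%:E))%E).
  apply: ge0_le_integral => //.
  - by move=> h _; apply: integral_ge0 => x _; rewrite lee_fin !mulr_ge0// subr_ge0 ltW.
  - apply: (measurable_fubini_F_gen mu (f := fun z : 'rV[R]_n * 'rV[R]_n =>
      ((l - k) * (\1_A z.2 * \1_F (z.2 + z.1)))%R%:E)); exact: measurable_level_lhs.
  - exact: measurable_funeM.
  - by move=> h _; exact: level_fixed_direction.
rewrite ge0_integralZl//; last by move=> h _; exact: integral_ge0.
rewrite [X in (_ <= X * _)%E](EFinM K) -muleA; apply: lee_wpmul2l => //.
have mQ' : measurable_fun setT (fun p : 'rV[R]_n * R => \int[mu]_z (q p.1 p.2 z)%:E)%E by exact: mQ.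
have /= -> := @fubini_tonelli _ _ _ _ R mu lam (fun p => \int[mu]_z (q p.1 p.2 z)%:E)%E mQ' (fun p => Q0 p.1 p.2).
pose M (t : R) : R := (4 * r) ^+ (n - 2) * (2 * (4 * r) * f / (f + 4 * r * (1 - t))) ^+ 2.
set G := (\int[mu]_z (g z)%:E)%E.
have G0 : (0 <= G)%E by apply: integral_ge0 => z _; rewrite lee_fin.
have mM : measurable_fun I M.
  apply: subspace_continuous_measurable_fun => //.
  exact: continuous_level_majorant.
have M0 t : 0 <= t <= 1 -> 0 <= M t.
  move=> /andP[t0 t1]; rewrite /M mulr_ge0 ?exprn_ge0 ?divr_ge0 ?addr_ge0 ?mulr_ge0 ?subr_ge0// ltW//.
have mgE : measurable_fun setT (EFin \o g) by apply/measurable_EFinP.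
apply: (@le_trans _ _ (\int[lam]_(t in I) (G * (M t)%:E))%E).
  rewrite [leRHS]integral_mkcond; apply: ge0_le_integral => //.
  - by move=> t _; apply: integral_ge0 => h _; exact: Q0.
  - apply: (measurable_fubini_F_gen mu (f := fun p : R * 'rV[R]_n => (\int[mu]_z (q p.2 p.1 z)%:E)%E)).
    apply: (measurable_fubini_F_gen mu (f := fun p : (R * 'rV[R]_n) * 'rV[R]_n => (q p.1.2 p.1.1 p.2)%:E)).
    apply: (mqE _ _ (fun p => p.1.2) (fun p => p.2) (fun p => p.1.1)).
    + exact: (measurableT_comp measurable_snd measurable_fst).
    + exact: measurable_snd.
    + exact: (measurableT_comp measurable_fst measurable_fst).
  - apply: (measurable_restrictT _ mI).1; apply: measurable_funeM.
    exact/measurable_EFinP.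
  move=> t _; rewrite patchE; case: ifPn => tI; last first.
    rewrite integral0_eq// => h _; rewrite integral0_eq// => z _.
    by rewrite /q [\1_I t]indicE (negbTE tI) mulr0 mul0r.
  have t01 : 0 <= t <= 1 by move: tI; rewrite inE /I /= in_itv.
  have mqt : measurable_fun setT (fun p : 'rV[R]_n * 'rV[R]_n => (q p.1 t p.2)%:E).
    by apply: (mqE _ _ (fun p => p.1) (fun p => p.2) (fun p => t));
      [exact: measurable_fst|exact: measurable_snd|exact: measurable_cst].
  have /= -> := @fubini_tonelli _ _ _ _ R mu mu (fun p => (q p.1 t p.2)%:E) mqt (fun p => q0 p.1 t p.2).
  rewrite muleC -ge0_integralZl//; last by rewrite lee_fin M0.
  apply: ge0_le_integral => //.
  - by move=> z _; apply: integral_ge0 => h _; rewrite lee_fin.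
  - apply: (measurable_fubini_F_gen mu (f := fun p : 'rV[R]_n * 'rV[R]_n => (q p.2 t p.1)%:E)).
    by apply: (mqE _ _ (fun p => p.2) (fun p => p.1) (fun p => t));
      [exact: measurable_snd|exact: measurable_fst|exact: measurable_cst].
  - exact: measurable_funeM.
  move=> z _; pose S := [set h | F (z + (1 - t) *: h)].
  have mS : measurable S.
    by rewrite -[X in measurable X]setTI; apply: (measurable_rV_affine z (1 - t)).
  rewrite (_ : (\int[mu]_h (q h t z)%:E = (g z)%:E * mu (C `&` S))%E).
    by rewrite muleC; apply: lee_wpmul2r; rewrite ?lee_fin//; exact: level_section.
  have mCS : measurable (C `&` S) by exact: measurableI.
  rewrite -[X in (_ * mu X)%E]setIT -integral_indic// -ge0_integralZl//.
    apply: eq_integral => h _; rewrite -EFinM /q [\1_I t]indicE tI mulr1; congr EFin.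
    have -> : \1_(C `&` S) h = \1_C h * \1_F (z + (1 - t) *: h) :> R.
      rewrite !indicE in_setI -mulnb natrM; congr (_ * (nat_of_bool _)%:R).
    by rewrite mulrCA.
  - by apply/measurable_EFinP; exact: measurable_indic.
  - by rewrite lee_fin.
  by move=> z _; rewrite lee_fin.
rewrite ge0_integralZl//; last exact/measurable_EFinP.
rewrite muleC; apply: lee_wpmul2r => //.
have := integral_level_majorant (n - 2) rr0 f0.
by rewrite (_ : (n - 2).+1 = n - 1)%N// -subSn.
Qed.

End fixed_level.
End level_estimate.

(** * Dyadic summation *)

Section dyadic.
Context {R : realType}.
Implicit Types (a b s t p q : R).

Lemma powR_le_mulr a t q : 1 <= q -> 0 <= a -> a <= t -> a `^ q <= a * t `^ (q - 1).
Proof.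
move=> q1 a0 at_; have [->|an0] := eqVneq a 0.
  by rewrite powR0 ?mul0r// gt_eqF// (lt_le_trans ltr01).
have -> : a `^ q = a * a `^ (q - 1).
  by rewrite -{2}(powRr1 a0) -powRD ?an0 ?implybT// [1 + _]addrC subrK.
rewrite ler_wpM2l//.
by apply: ge0_ler_powR; rewrite ?nnegrE ?subr_ge0// (le_trans a0).
Qed.

Lemma powRD_superadd a b q : 1 <= q -> 0 <= a -> 0 <= b -> a `^ q + b `^ q <= (a + b) `^ q.
Proof.
move=> q1 a0 b0.
have [ab0|abn0] := eqVneq (a + b) 0.
  have -> : a = 0 by lra.
  have -> : b = 0 by lra.
  by rewrite addr0 powR0 ?addr0// gt_eqF// (lt_le_trans ltr01).
apply: (@le_trans _ _ (a * (a + b) `^ (q - 1) + b * (a + b) `^ (q - 1))).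
  by rewrite lerD// powR_le_mulr// ?lerDl ?lerDr.
rewrite -mulrDl -{1}(powRr1 (addr_ge0 a0 b0)) -powRD ?abn0 ?implybT//.
by rewrite [1 + _]addrC subrK.
Qed.

Lemma sum_powR_le (I : Type) (r : seq I) (b : I -> R) q : 1 <= q ->
  (forall i, 0 <= b i) ->
  \sum_(i <- r) b i `^ q <= (\sum_(i <- r) b i) `^ q.
Proof.
move=> q1 b0; elim: r => [|i r IH].
  by rewrite !big_nil powR0// gt_eqF// (lt_le_trans ltr01).
rewrite !big_cons; apply: le_trans (powRD_superadd q1 (b0 i) (sumr_ge0 _ _)) => //.
by rewrite lerD2l.
Qed.

(** Both factors are bounded by powers of [m = max (1, (b/J)^p, G^s)] whose exponents add up to at
    most 1. Including 1 in the maximum covers a sum of exponents below 1. *)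
Lemma young_max (b G J t p s : R) : 0 < b -> 0 <= G -> 0 < J -> 1 <= t -> 0 < p -> 1 <= s ->
  (t - 1) / p + s^-1 <= 1 ->
  b `^ (t - 1) * G <= J `^ (t - 1) * ((b / J) `^ p + G `^ s + 1).
Proof.
move=> b0 G0 J0 t1 p0 s1 h.
have bJ0 : 0 < b / J by rewrite divr_gt0.
have -> : b `^ (t - 1) = J `^ (t - 1) * (b / J) `^ (t - 1).
  by rewrite -powRM ?ltW// mulrC divfK ?gt_eqF.
rewrite -mulrA ler_wpM2l ?powR_ge0//.
pose m := Num.max 1 (Num.max ((b / J) `^ p) (G `^ s)).
have m1 : 1 <= m by rewrite le_max lexx.
have m0 : 0 < m by rewrite (lt_le_trans ltr01).
have s0 : 0 < s by rewrite (lt_le_trans ltr01).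
have bm : (b / J) `^ (t - 1) <= m `^ ((t - 1) / p).
  have -> : b / J = ((b / J) `^ p) `^ p^-1.
    by rewrite -powRrM mulfV ?gt_eqF// powRr1// ltW.
  rewrite -powRrM [p^-1 * _]mulrC.
  apply: ge0_ler_powR; rewrite ?nnegrE ?powR_ge0 ?(ltW m0)//.
    by rewrite divr_ge0// ?subr_ge0// ltW.
  by rewrite !le_max lexx !orbT.
have Gm : G <= m `^ s^-1.
  have -> : G = (G `^ s) `^ s^-1 by rewrite -powRrM mulfV ?gt_eqF// powRr1.
  apply: ge0_ler_powR; rewrite ?nnegrE ?powR_ge0 ?(ltW m0)//.
    by rewrite invr_ge0 ltW.
  by rewrite !le_max lexx !orbT.
apply: (@le_trans _ _ (m `^ ((t - 1) / p) * m `^ s^-1)).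
  by rewrite ler_pM// powR_ge0.
rewrite -powRD ?(gt_eqF m0) ?implybT//.
apply: (@le_trans _ _ (m `^ 1)); first exact: ler_powR.
rewrite (powRr1 (ltW m0)) /m !ge_max.
have := powR_ge0 (b / J) p; have := powR_ge0 G s => ? ?.
by apply/and3P; split; lra.
Qed.

(** Absorption leads to [1 + S <= (c + 1) (1 + S)^(1 - 1/(p nu))] with [c = (C (2^p + 2))^(1/nu)].
    Solving for [1 + S] gives the power [p nu] of [c + 1], enlarged here to p. *)
Definition dyadic_const (C nu p : R) : R :=
  ((C * (2 `^ p + 2)) `^ nu^-1 + 1) `^ p.

(* With J = (1 + S)^(1/p), where S is the sum to be bounded, summing the
   hypothesis bounds S by a power of 1 + S with exponent smaller than 1. *)
Lemma dyadic_absorption (K : nat) (a e : nat -> R) (C nu p : R) :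
  0 < C -> 0 < nu <= 1 -> 1 <= p * nu ->
  (forall j, 0 <= a j <= 1) -> \sum_(j < K) e j <= 2 ->
  (forall J j, 1 <= J -> (j < K)%N -> (2 ^+ j) `^ (p * nu) * a j.+1 `^ nu <=
     C * (J `^ (p * nu - 1) * (((2 ^+ j) / J) `^ p * a j + e j))) ->
  1 + \sum_(j < K) (2 ^+ j) `^ p * a j.+1 <= dyadic_const C nu p.
Proof.
move=> C0 /andP[nu0 nu1] pnu1 a01 e2 H.
set S := \sum_(j < K) _.
have p0 : 0 < p by rewrite -(pmulr_lgt0 _ nu0) (lt_le_trans ltr01).
have a0 j : 0 <= a j by case/andP: (a01 j).
have S0 : 0 <= S by apply: sumr_ge0 => j _; rewrite mulr_ge0 ?powR_ge0.
have S1 : 0 < 1 + S by rewrite ltr_pwDl.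
pose J := (1 + S) `^ p^-1.
have J1 : 1 <= J.
  by rewrite -(powRr0 (1 + S)) /J ler_powR ?lerDl ?invr_ge0 ?(ltW p0).
have J0 : 0 < J by rewrite (lt_le_trans ltr01).
have JpE : J `^ p = 1 + S by rewrite -powRrM mulVf ?gt_eqF// powRr1// ltW.
pose X := \sum_(j < K) (2 ^+ j) `^ (p * nu) * a j.+1 `^ nu.
have X0 : 0 <= X by apply: sumr_ge0 => j _; rewrite mulr_ge0 ?powR_ge0.
(* Superadditivity of the power [1/nu >= 1]. *)
have SX : S <= X `^ nu^-1.
  apply: le_trans (sum_powR_le _ _ _); last 2 first.
  - by rewrite invf_ge1.
  - by move=> j; rewrite mulr_ge0 ?powR_ge0.
  apply: ler_sum => j _; rewrite powRM ?powR_ge0// -!powRrM mulfK ?gt_eqF//.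
  by rewrite mulfV ?gt_eqF// powRr1.
(* Lowering the index of a by one costs [2^p], and the new first term is at most 1. After division
   by [J^p = 1 + S] the whole sum is at most [2^p]. *)
have shift : \sum_(j < K) (2 ^+ j) `^ p * a j <= 1 + 2 `^ p * S.
  rewrite /S; case: (K) => [|k]; first by rewrite !big_ord0 mulr0 addr0 ler01.
  rewrite big_ord_recl /= expr0 powR1 mul1r lerD//; first by case/andP: (a01 0%N).
  rewrite big_ord_recr /= mulrDr mulr_sumr.
  apply: (@le_trans _ _ (\sum_(i < k) 2 `^ p * ((2 ^+ i) `^ p * a i.+1))).
    by apply: ler_sum => i _; rewrite /bump /= add1n exprS powRM// mulrA.
  by rewrite lerDl !mulr_ge0 ?powR_ge0.
have XJ : X <= C * (2 `^ p + 2) * J `^ (p * nu - 1).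
  apply: (@le_trans _ _ (\sum_(j < K) C * (J `^ (p * nu - 1) * (((2 ^+ j) / J) `^ p * a j + e j)))).
    by apply: ler_sum => j _; exact: H.
  rewrite -mulr_sumr -mulrA (ler_wpM2l (ltW C0))// -mulr_sumr [leRHS]mulrC ler_wpM2l ?powR_ge0//.
  rewrite big_split /= lerD//.
  have -> : \sum_(j < K) ((2 ^+ j) / J) `^ p * a j = (1 + S)^-1 * \sum_(j < K) (2 ^+ j) `^ p * a j.
    rewrite mulr_sumr; apply: eq_bigr => j _.
    rewrite powRM ?invr_ge0 ?(ltW J0)// [RHS]mulrA [(1 + S)^-1 * _]mulrC; congr (_ * _ * _).
    by rewrite -powR_inv1 ?(ltW J0)// -powRrM mulN1r powRN JpE.
  rewrite mulrC ler_pdivrMr//; apply: le_trans shift _.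
  by rewrite mulrDr mulr1 lerD2r -{1}(powRr0 2%:R) ler_powR ?ler1n// ltW.
have SJ : S <= (C * (2 `^ p + 2)) `^ nu^-1 * (1 + S) `^ (1 - (p * nu)^-1).
  apply: (le_trans SX); apply: (@le_trans _ _ ((C * (2 `^ p + 2) * J `^ (p * nu - 1)) `^ nu^-1)).
    apply: ge0_ler_powR; rewrite ?nnegrE ?invr_ge0 ?(ltW nu0)//.
    by rewrite !mulr_ge0 ?powR_ge0 ?addr_ge0 ?powR_ge0// ltW.
  rewrite powRM ?powR_ge0 ?mulr_ge0 ?addr_ge0 ?powR_ge0 ?(ltW C0)//.
  rewrite ler_wpM2l ?powR_ge0// -!powRrM le_eqVlt; apply/orP; left; apply/eqP; congr (_ `^ _).
  by field; rewrite !gt_eqF.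
set C2 := (C * (2 `^ p + 2)) `^ nu^-1 in SJ *.
have C20 : 0 <= C2 by exact: powR_ge0.
have tp : (p * nu)^-1 <= 1 by rewrite invf_le1// mulr_gt0.
have S1' : 1 <= (1 + S) `^ (1 - (p * nu)^-1).
  by rewrite -{1}(powRr0 (1 + S)) ler_powR ?lerDl ?subr_ge0.
have : 1 + S <= (C2 + 1) * (1 + S) `^ (1 - (p * nu)^-1) by rewrite mulrDl mul1r [leLHS]addrC lerD.
rewrite powRD ?(gt_eqF S1) ?implybT// powRr1 ?(ltW S1)// mulrCA -{1}(mulr1 (1 + S)) ler_pM2l//.
rewrite powRN -ler_pdivrMr ?invr_gt0 ?powR_gt0// invrK mul1r => h.
rewrite /dyadic_const -/C2.
have -> : 1 + S = ((1 + S) `^ (p * nu)^-1) `^ (p * nu).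
  by rewrite -powRrM mulVf ?powRr1 ?(ltW S1)// gt_eqF// mulr_gt0.
apply: (@le_trans _ _ ((C2 + 1) `^ (p * nu))).
  by apply: ge0_ler_powR; rewrite ?nnegrE ?powR_ge0 ?addr_ge0// mulr_ge0 ?ltW.
by rewrite ler_powR ?lerDr// ler_piMr// ltW.
Qed.

End dyadic.

(** * Truncation at dyadic levels, with constant exponents *)

Section truncated_sobolev.
Context {R : realType} (n : nat).
Local Notation mu := (lebesgue_rV R n).
Hypothesis n2 : (2 <= n)%N.
Variables (x0 : 'rV[R]_n) (r : R) (r_gt0 : 0 < r).
Local Notation B := (eball x0 r).
Variables (u : 'rV[R]_n -> R) (Du : 'rV[R]_n -> 'rV[R]_n).
Hypothesis sob : sobolev11 B u Du.
Variables (m D P s gamma : R).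
Let nu : R := 1 - n%:R^-1.
Let t := P * nu.
Hypotheses (D0 : 0 < D) (s1 : 1 <= s) (gamma0 : 0 < gamma).
Hypotheses (Pnu : 1 <= P * (1 - n%:R^-1))
  (sP : (P * (1 - n%:R^-1) - 1) / P + s^-1 <= 1).
Hypothesis below : (gamma%:E * mu B <= mu (B `&` [set x | (u x <= m)%R]))%E.
Hypothesis grad :
  (\int[mu]_(x in B) (enorm (Du x) `^ s)%:E <= (D `^ s)%:E * mu B)%E.

Let n0 : (0 < n)%N. Proof. exact: ltn_trans n2. Qed.
Let nR0 : 0 < n%:R :> R. Proof. by rewrite ltr0n. Qed.
Let nu01 : 0 < nu <= 1.
Proof.
rewrite /nu subr_gt0 invf_lt1// ltr1n n2 /= lerBlDr lerDl invr_ge0 ltW//.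
Qed.
Let P0 : 0 < P.
Proof. by case/andP: nu01 => nu0 _; rewrite -(pmulr_lgt0 _ nu0) (lt_le_trans ltr01). Qed.
Let s0 : 0 < s. Proof. exact: lt_le_trans s1. Qed.

Let V : R := fine (mu B).
Let muB : mu B = V%:E.
Proof.
rewrite fineK// ge0_fin_numE//.
exact: le_lt_trans (lebesgue_eball_le x0 r_gt0) (ltry _).
Qed.
Let Vge : (2 * (r / n%:R)) ^+ n <= V.
Proof. by rewrite -lee_fin -muB; exact: lebesgue_eball_ge. Qed.
Let V0 : 0 < V.
Proof. by apply: lt_le_trans Vge; rewrite exprn_gt0// mulr_gt0// divr_gt0. Qed.
Let mB : measurable B. Proof. exact: measurable_eball. Qed.

(** The gaps are scale invariant: r cancels against the length of the directions in
    [level_estimate], D against the size of the gradient. *)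
Let k j : R := m + r * D * 2 ^+ j.
Let klt j : k j < k j.+1.
Proof. by rewrite ltrD2l ltr_pM2l ?mulr_gt0// exprS ltr_pMl ?exprn_gt0// ltr1n. Qed.
Let kle i j : (i <= j)%N -> k i <= k j.
Proof.
by move=> ij; rewrite lerD2l ler_pM2l ?mulr_gt0// ler_weXn2l// ler1n.
Qed.
Let S j := B `&` [set x | k j <= u x].
Let mS j : measurable (S j). Proof. exact: (measurable_super_level sob (k j)). Qed.
Let a j : R := fine (mu (S j)) / V.
Let muS j : mu (S j) = (V * a j)%:E.
Proof.
rewrite /a mulrC divfK ?gt_eqF// fineK// ge0_fin_numE//.
apply: (@le_lt_trans _ _ (mu B)); last by rewrite muB ltry.
by apply: le_measure; rewrite ?inE//; exact: subIsetl.
Qed.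
Let a01 j : 0 <= a j <= 1.
Proof.
apply/andP; split; first by rewrite divr_ge0 ?(ltW V0)// fine_ge0.
rewrite -(ler_pM2l V0) mulr1 -lee_fin -muS -muB.
by apply: le_measure; rewrite ?inE//; exact: subIsetl.
Qed.

Let E j := B `&` [set x | u x \in `]k j, k j.+1[].
Let mu_ : measurable_fun B u.
Proof. by case: sob => /measurable_int/measurable_EFinP. Qed.
Let mE j : measurable (E j).
Proof. exact: (mu_ mB (measurable_itv `]k j, k j.+1[)). Qed.
Let trivE : trivIset setT E.
Proof.
apply/trivIsetP => i j _ _; rewrite neq_ltn => /orP ij.
apply/seteqP; split => x //= -[[_ /= +] [_ /=]]; rewrite !in_itv /= => /andP[h1 h2] /andP[h3 h4].
by case: ij => /kle ij; lra.
Qed.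

Let mDu : measurable_fun B (fun x => enorm (Du x)).
Proof.
case: sob => _ iDu _.
by apply: measurable_enorm => i; apply/measurable_EFinP; exact: measurable_int (iDu i).
Qed.
(** The summand 1 pays for the 1 in [young_max]. The average of H over B is then at most 2, which is
    the bound on the sum of e in [dyadic_absorption]. *)
Let H x := (enorm (Du x) / D) `^ s + 1.
Let H0 x : 0 <= H x. Proof. by rewrite addr_ge0// powR_ge0. Qed.
Let mH : measurable_fun B (fun x => (H x)%:E).
Proof.
apply/measurable_EFinP; apply: measurable_funD => //.
apply: (measurableT_comp (measurable_powR s)).
by apply: measurable_funM.
Qed.
Let mHE j : measurable_fun (E j) (fun x => (H x)%:E).
Proof. by apply: measurable_funS mH => //; exact: subIsetl. Qed.
Let intH : (\int[mu]_(x in B) (H x)%:E <= (2 * V)%:E)%E.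
Proof.
rewrite (_ : (\int[mu]_(x in B) (H x)%:E =
  \int[mu]_(x in B) ((D `^ s)^-1%:E * (enorm (Du x) `^ s)%:E + 1%:E))%E); last first.
  apply: eq_integral => x _; rewrite /H EFinD -EFinM; congr (_%:E + _)%E.
  rewrite powRM ?invr_ge0 ?(ltW D0) ?enorm_ge0// mulrC; congr (_ * _).
  by rewrite -powR_inv1 ?(ltW D0)// -powRrM mulN1r powRN.
have Ds : 0 <= (D `^ s)^-1 by rewrite invr_ge0 powR_ge0.
have mDs : measurable_fun B (fun x => (enorm (Du x) `^ s)%:E).
  by apply/measurable_EFinP; exact: (measurableT_comp (measurable_powR s)).
rewrite ge0_integralD//; last 2 first.
- by move=> x _; rewrite -EFinM lee_fin mulr_ge0// powR_ge0.
- exact: measurable_funeM.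
rewrite ge0_integralZl//; last by move=> x _; rewrite lee_fin powR_ge0.
rewrite integral_cst// mul1e [in leRHS]mulr_natl mulr2n EFinD; apply: leeD; last by rewrite -muB.
apply: (@le_trans _ _ ((D `^ s)^-1%:E * ((D `^ s)%:E * mu B))%E).
  by apply: lee_wpmul2l.
by rewrite muleA -EFinM mulVf ?gt_eqF ?powR_gt0// mul1e muB.
Qed.
Let e j : R := fine (\int[mu]_(x in E j) (H x)%:E) / V.
Let intHE j : (\int[mu]_(x in E j) (H x)%:E)%E = (V * e j)%:E.
Proof.
rewrite /e mulrC divfK ?gt_eqF// fineK// ge0_fin_numE; last first.
  by apply: integral_ge0 => x _; rewrite lee_fin.
apply: (@le_lt_trans _ _ (\int[mu]_(x in B) (H x)%:E)%E).
  by apply: ge0_subset_integral => //; [move=> x _; rewrite lee_fin|exact: subIsetl].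
exact: le_lt_trans intH (ltry _).
Qed.
Let e0 j : 0 <= e j.
Proof.
by rewrite divr_ge0 ?(ltW V0)// fine_ge0//; apply: integral_ge0 => x _; rewrite lee_fin.
Qed.
Let sum_e K : \sum_(j < K) e j <= 2.
Proof.
rewrite -(ler_pM2l V0) mulr_sumr -lee_fin -sumEFin [(V * 2)%R]mulrC.
apply: le_trans intH.
rewrite (eq_bigr (fun j : 'I_K => \int[mu]_(x in E j) (H x)%:E)%E); last by move=> j _; rewrite intHE.
rewrite -(big_mkord xpredT (fun j => \int[mu]_(x in E j) (H x)%:E)%E).
have sub : \big[setU/set0]_(0 <= j < K) E j `<=` B.
  by rewrite big_mkord -bigcup_mkord => x [j _ []].
rewrite -ge0_integral_bigsetU//=.
- apply: ge0_subset_integral => //.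
  + by rewrite big_mkord; exact: bigsetU_measurable.
  + by move=> x _; rewrite lee_fin.
- exact: iota_uniq.
- exact: sub_trivIset trivE.
- exact: measurable_funS mH.
- by move=> x _; rewrite lee_fin.
Qed.

(** [young_max] with [G = enorm (Du x) / D] at each point of the layer; the term constant in x
    integrates to a multiple of [mu (E j)], which is at most [mu (S j) = V a_j]. *)
Let level_young j J : 1 <= J ->
  (((2 ^+ j) `^ (t - 1))%:E * \int[mu]_x (level_grad x0 r u Du (k j) (k j.+1) x)%:E <=
   (D * J `^ (t - 1) * V * (((2 ^+ j) / J) `^ P * a j + e j))%:E)%E.
Proof.
move=> J1; have J0 : 0 < J by rewrite (lt_le_trans ltr01).
have t1 : 1 <= t by [].
rewrite -ge0_integralZl//; last 2 first.
- by apply/measurable_EFinP; exact: (measurable_level_grad sob (k j) (k j.+1)).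
- by move=> x _; rewrite lee_fin level_grad_ge0.
set b := 2 ^+ j; have b0 : 0 < b by rewrite exprn_gt0.
have c0 : 0 <= D * J `^ (t - 1) by rewrite mulr_ge0 ?powR_ge0// ltW.
apply: (@le_trans _ _ (\int[mu]_(x in E j) ((D * J `^ (t - 1))%:E * (((b / J) `^ P)%:E + (H x)%:E)))%E).
  rewrite [leRHS]integral_mkcond; apply: ge0_le_integral => //.
  - by move=> x _; rewrite -EFinM lee_fin mulr_ge0 ?powR_ge0 ?level_grad_ge0.
  - by apply: measurable_funeM; apply/measurable_EFinP; exact: (measurable_level_grad sob (k j) (k j.+1)).
  - apply: (measurable_restrictT _ (mE j)).1; apply: measurable_funeM.
    apply: emeasurable_funD => //; exact: measurable_cst.
  move=> x _; rewrite /level_grad !patchE.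
  case: ifPn => xB; last by rewrite mule0; case: ifPn => // _; rewrite -EFinD -EFinM lee_fin mulr_ge0// addr_ge0 ?powR_ge0.
  case: ifPn => xE.
    have uxk : u x \in (`]k j, k j.+1[%classic : set R) by move: xE; rewrite !inE => -[].
    rewrite indicE uxk mulr1 -EFinD -!EFinM lee_fin /H addrA.
    have -> : enorm (Du x) = D * (enorm (Du x) / D) by rewrite mulrC divfK ?gt_eqF.
    rewrite mulrCA -[leRHS]mulrA (ler_pM2l D0) mulrAC divff ?gt_eqF// mul1r.
    by apply: young_max; rewrite // divr_ge0 ?enorm_ge0// ltW.
  rewrite indicE (_ : u x \in _ = false) ?mulr0 ?mule0//.
  by apply: contraNF xE; rewrite !inE => h; split => //; rewrite -inE.
rewrite ge0_integralZl//; last 2 first.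
- apply: emeasurable_funD => //; exact: measurable_cst.
- by move=> x _; rewrite -EFinD lee_fin addr_ge0 ?powR_ge0.
rewrite -[X in (_ <= X%:E)%E]mulrA [leRHS]EFinM lee_wpmul2l ?lee_fin//.
rewrite ge0_integralD//; last 2 first.
- by move=> x _; rewrite lee_fin powR_ge0.
- by move=> x _; rewrite lee_fin.
rewrite integral_cst// intHE mulrDr [leRHS]EFinD leeD2r// mulrCA [leRHS]EFinM lee_wpmul2l ?lee_fin ?powR_ge0// -muS.
apply: le_measure; rewrite ?inE// => x [xB /=]; rewrite in_itv /= => /andP[/ltW].
by split.
Qed.

(** The factor [8 n] collects [n (2 r)] from the direction and 4 from the kernel, with r cancelled
    by the level gap. [(2 n)^(n-1)] is the ratio of [(4 r)^(n-1)] to [(2 r / n)^(n-1)], a lower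
    bound of [|B|^(1 - 1/n)]. The share gamma bounds the sub-level set from below. *)
Let C0 : R := 8 * n%:R * (2 * n%:R) ^+ (n - 1) / gamma.
Let C00 : 0 < C0.
Proof. by rewrite divr_gt0// !mulr_gt0// exprn_gt0// mulr_gt0. Qed.

(** Dividing [level_estimate] by [f = |F|^(1/n)] leaves [|F|^(1 - 1/n)] on the left, and
    [level_young] bounds the gradient on the right. *)
Let dyadic_step J j : 1 <= J -> (2 ^+ j) `^ t * a j.+1 `^ nu <=
  C0 * (J `^ (t - 1) * (((2 ^+ j) / J) `^ P * a j + e j)).
Proof.
move=> J1; have J0 : 0 < J by rewrite (lt_le_trans ltr01).
set Q := J `^ (t - 1) * _.
have Q0 : 0 <= Q.
  by case/andP: (a01 j) => aj0 _; rewrite mulr_ge0 ?powR_ge0// addr_ge0// mulr_ge0 ?powR_ge0.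
(* [level_estimate] asks for a positive f, so a null super-level set is treated first. *)
have /andP[] := a01 j.+1; rewrite le_eqVlt => /orP[/eqP <- _|ap _].
  by case/andP: nu01 => nu0 _; rewrite powR0 ?gt_eqF// mulr0 mulr_ge0// ltW.
set b := 2 ^+ j; have b0 : 0 < b by rewrite exprn_gt0.
pose f := (V * a j.+1) `^ n%:R^-1.
have f0 : 0 < f by rewrite powR_gt0// mulr_gt0.
have fn : f ^+ n = V * a j.+1.
  by rewrite -powR_mulrn ?(ltW f0)// /f -powRrM mulVf ?gt_eqF// powRr1// mulr_ge0// ltW.
have := level_estimate n2 r_gt0 sob (klt j) f0.
rewrite -/(S j.+1) muS fn => /(_ erefl).
set A := mu _; set L := (\int[mu]_x _)%E => lev.
have L0 : (0 <= L)%E by apply: integral_ge0 => x _; rewrite lee_fin level_grad_ge0.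
have yo : ((b `^ (t - 1))%:E * L <= (D * V * Q)%:E)%E.
  by apply: le_trans (level_young j J1) _; rewrite lee_fin /Q le_eqVlt; apply/orP; left; apply/eqP; ring.
have kE : k j.+1 - k j = r * D * b by rewrite /k /b exprS; ring.
have gA : ((gamma * V)%:E <= A)%E.
  rewrite EFinM -muB; apply: le_trans below _; apply: le_measure; rewrite ?inE.
  - exact: (measurable_sub_level sob).
  - exact: (measurable_sub_level sob).
  - by move=> x [xB /= h]; split => //=; apply: (le_trans h); rewrite lerDl !mulr_ge0 ?exprn_ge0// ltW.
have key : b `^ (t - 1) * (r * D * b * (gamma * V * (V * a j.+1))) <=
    n%:R * (2 * r) * (4 * (4 * r) ^+ (n - 1) * f) * (D * V * Q).
  have c0 : 0 <= n%:R * (2 * r) * (4 * (4 * r) ^+ (n - 1) * f).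
    by rewrite !mulr_ge0 ?exprn_ge0 ?mulr_ge0// ltW.
  rewrite -lee_fin [leRHS]EFinM; apply: le_trans (lee_wpmul2l _ yo); last by rewrite lee_fin.
  rewrite muleCA EFinM lee_wpmul2l ?lee_fin ?powR_ge0//; apply: le_trans lev.
  rewrite kE EFinM lee_wpmul2l ?lee_fin ?mulr_ge0 ?(ltW b0) ?(ltW D0) ?(ltW r_gt0)//.
  by rewrite EFinM lee_wpmul2r// lee_fin mulr_ge0// ltW.
have nE : n = (n - 1).+1 by rewrite subn1 prednK.
have Ff : f ^+ (n - 1) = V `^ nu * a j.+1 `^ nu.
  rewrite -powR_mulrn ?(ltW f0)// /f -powRrM natrB 1?ltnW// mulrBr mulr1 mulVf ?gt_eqF//.
  by rewrite powRM// ltW.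
have W0 : 0 < (2 * (r / n%:R)) ^+ (n - 1) by rewrite exprn_gt0// mulr_gt0// divr_gt0.
have WV : (2 * (r / n%:R)) ^+ (n - 1) <= V `^ nu.
  have w0 : 0 <= 2 * (r / n%:R) by rewrite mulr_ge0// divr_ge0// ltW.
  have -> : (2 * (r / n%:R)) ^+ (n - 1) = ((2 * (r / n%:R)) ^+ n) `^ nu.
    rewrite -!powR_mulrn// -powRrM natrB 1?ltnW//; congr (_ `^ _).
    by rewrite /nu mulrBr mulr1 mulfV ?gt_eqF.
  case/andP: nu01 => /ltW nu0 _.
  by apply: ge0_ler_powR; rewrite ?nnegrE ?exprn_ge0// ltW.
have bt : b `^ t = b `^ (t - 1) * b.
  by rewrite -[X in _ * X](powRr1 (ltW b0)) -powRD ?(gt_eqF b0) ?implybT// subrK.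
have pos : 0 < r * D * V * f by rewrite !mulr_gt0.
have key2 : b `^ t * gamma * f ^+ (n - 1) <= 8 * n%:R * (4 * r) ^+ (n - 1) * Q.
  rewrite -(ler_pM2l pos); move: key.
  rewrite -fn {1}nE exprS bt; set F := f ^+ _; set G := (4 * r) ^+ _ => key.
  by apply: (le_trans _ (le_trans key _)); rewrite le_eqVlt; apply/orP; left; apply/eqP; ring.
have gW : 0 < gamma * (2 * (r / n%:R)) ^+ (n - 1) by rewrite mulr_gt0.
rewrite -(ler_pM2l gW).
have -> : gamma * (2 * (r / n%:R)) ^+ (n - 1) * (C0 * Q) = 8 * n%:R * (4 * r) ^+ (n - 1) * Q.
  have -> : 4 * r = 2 * (r / n%:R) * (2 * n%:R) by field; rewrite gt_eqF.
  rewrite [in RHS]exprMn /C0; set X := (2 * (r / n%:R)) ^+ _.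
  by set Y := (2 * n%:R) ^+ _; field; rewrite gt_eqF.
apply: le_trans key2; rewrite Ff.
have c0 : 0 <= gamma * (b `^ t * a j.+1 `^ nu) by rewrite !mulr_ge0 ?powR_ge0// ltW.
apply: (@le_trans _ _ (V `^ nu * (gamma * (b `^ t * a j.+1 `^ nu)))).
  by rewrite mulrAC mulrC ler_wpM2r.
by rewrite le_eqVlt; apply/orP; left; apply/eqP; ring.
Qed.

Let sum_a K : \sum_(j < K) (2 ^+ j) `^ P * a j <= 2 `^ P * dyadic_const C0 nu P.
Proof.
have P1 : 1 <= 2 `^ P :> R by rewrite -{1}(powRr0 2%:R) ler_powR ?ler1n// ltW.
have := dyadic_absorption C00 nu01 Pnu a01 (sum_e K) (fun J j J1 _ => dyadic_step j J1).
set X := \sum_(j < K) _ * a j.+1 => h.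
have X0 : 0 <= X by apply: sumr_ge0 => j _; rewrite mulr_ge0 ?powR_ge0//; case/andP: (a01 j.+1).
apply: le_trans (ler_wpM2l (powR_ge0 _ _) h).
rewrite /X; case: (K) => [|k']; first by rewrite !big_ord0 addr0 mulr1 powR_ge0.
rewrite big_ord_recl /= expr0 powR1 mul1r mulrDr mulr1 lerD//.
  by apply: (le_trans _ P1); case/andP: (a01 0%N).
rewrite big_ord_recr /= mulrDr mulr_sumr.
apply: (@le_trans _ _ (\sum_(i < k') 2 `^ P * ((2 ^+ i) `^ P * a i.+1))).
  by apply: ler_sum => i _; rewrite /bump /= add1n exprS powRM// mulrA.
by case/andP: (a01 k'.+1) => ak _; rewrite lerDl mulr_ge0 ?powR_ge0// mulr_ge0 ?powR_ge0.
Qed.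

(** A value [w >= 1] lies in some dyadic range from [2^j] to [2^(j+1)], and then x is in [S j];
    hence [w^P] is at most 1 plus the sum of [2^((j+1) P)] times the indicators of [S j]. One factor
    [2^P] of [4^P] comes from the upper end of the range, the other from [sum_a]. *)
Lemma truncated_sobolev :
  (\int[mu]_(x in B) ((Num.max (u x - m) 0 / (r * D)) `^ P)%:E <=
   (1 + 4 `^ P * dyadic_const C0 nu P)%:E * mu B)%E.
Proof.
have rD0 : 0 < r * D by rewrite mulr_gt0.
pose w x := Num.max (u x - m) 0 / (r * D).
have w0 x : 0 <= w x by rewrite divr_ge0 ?(ltW rD0)// le_max lexx orbT.
have mw : measurable_fun B w.
  apply: measurable_funM => //; apply: measurable_maxr => //.
  exact: measurable_funB.
pose g (j : nat) x : \bar R := ((2 ^+ j.+1) `^ P * \1_(S j) x)%:E.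
have g0 j x : (0 <= g j x)%E by rewrite lee_fin mulr_ge0 ?powR_ge0.
have mg j : measurable_fun B (g j).
  apply/measurable_EFinP; apply: measurable_funM; first exact: measurable_cst.
  exact: measurable_indic.
apply: (@le_trans _ _ (\int[mu]_(x in B) (1 + \sum_(j <oo) g j x))%E).
  apply: ge0_le_integral => //.
  - by move=> x _; rewrite lee_fin powR_ge0.
  - by apply/measurable_EFinP; exact: (measurableT_comp (measurable_powR P)).
  - apply: emeasurable_funD => //; exact: ge0_emeasurable_sum.
  move=> x xB.
  have pos : (0 <= \sum_(j <oo) g j x)%E by apply: nneseries_ge0.
  have [w1|w1] := ltP (w x) 1.
    apply: (@le_trans _ _ (1 `^ P)%:E); last by rewrite powR1 leeDl.
    rewrite lee_fin -/(w x).
    by apply: ge0_ler_powR; rewrite ?nnegrE ?w0 ?(ltW P0) ?(ltW w1).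
  have ex : exists j, w x < 2 ^+ j.
    have [N wN] : exists N : nat, w x < N%:R.
      by exists (Num.bound (w x)); exact: archi_boundP (w0 x).
    by exists N; apply: (lt_trans wN); rewrite -natrX ltr_nat ltn_expl.
  case: (ex_minnP ex) => -[|j] wj jmin; first by rewrite expr0 in wj; have := lt_le_trans wj w1; rewrite ltxx.
  have jw : 2 ^+ j <= w x by rewrite leNgt; apply/negP => /jmin; rewrite ltnn.
  apply: (@le_trans _ _ (g j x)).
    rewrite /g lee_fin indicE mem_set ?mulr1; last first.
      split => //=; move: jw; rewrite /w ler_pdivlMr// le_max => /orP[|].
        by rewrite lerBrDr addrC mulrC.
      by rewrite leNgt mulr_gt0// exprn_gt0.
    by rewrite -/(w x); apply: ge0_ler_powR; rewrite ?nnegrE ?(ltW P0) ?w0 ?exprn_ge0// ltW.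
  apply: (@le_trans _ _ (\sum_(j <oo) g j x)%E); last by rewrite leeDr.
  apply: le_trans (nneseries_lim_ge j.+1 _) => //.
  by rewrite big_nat_recr //= leeDr// sume_ge0.
rewrite ge0_integralD//; last 2 first.
- by move=> x _; apply: nneseries_ge0.
- exact: ge0_emeasurable_sum.
rewrite integral_cst// mul1e EFinD muleDl// ?mul1e; last by rewrite muB.
apply: leeD => //; rewrite integral_nneseries//.
apply: lime_le; first by apply: is_cvg_nneseries => j _ _; exact: integral_ge0.
apply: nearW => K /=; rewrite big_mkord.
apply: (@le_trans _ _ (\sum_(j < K) (2 `^ P * V * ((2 ^+ j) `^ P * a j))%:E)%E).
  apply: lee_sum => j _; rewrite /g.
  under eq_integral do rewrite EFinM.
  rewrite ge0_integralZl//; last first.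
  - by apply/measurable_EFinP; exact: measurable_indic.
  have SB : S j `&` B = S j by apply/setIidPl => x [].
  rewrite (_ : \int[mu]_(x in B) (\1_(S j) x)%:E = (V * a j)%:E)%E; last first.
    by rewrite integral_indic// SB; exact: muS.
  rewrite -EFinM lee_fin le_eqVlt; apply/orP; left; apply/eqP.
  by rewrite exprS powRM ?exprn_ge0//; ring.
rewrite sumEFin -mulr_sumr muB -EFinM lee_fin.
apply: (le_trans (ler_wpM2l _ (sum_a K))); first by rewrite mulr_ge0 ?powR_ge0// ltW.
rewrite (_ : 4 = 2 * 2 :> R) ?powRM//; last by ring.
by rewrite le_eqVlt; apply/orP; left; apply/eqP; ring.
Qed.

End truncated_sobolev.

(* The powers with exponent p x are never shown to be Borel functions, hence a
   comparison of integrals without measurability. *)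
Lemma ge0_le_integral_nonmeasurable d (T : measurableType d) (R : realType)
    (mu : {measure set T -> \bar R}) (D : set T) (f g : T -> \bar R) :
  (forall x, D x -> 0 <= f x)%E -> (forall x, D x -> f x <= g x)%E ->
  (\int[mu]_(x in D) f x <= \int[mu]_(x in D) g x)%E.
Proof.
move=> f0 fg.
have g0 x : D x -> (0 <= g x)%E by move=> Dx; exact: le_trans (f0 x Dx) (fg x Dx).
rewrite !ge0_integralE//; apply: le_ereal_sup => _ [h /= hf <-].
exists h => //= x; apply: (le_trans (hf x)).
by rewrite !patchE; case: ifPn => // /set_mem; exact: fg.
Qed.

(** Negation swaps the positive and the negative part. If one of their integrals is infinite, [fine]
    returns 0 on both sides. *)
Lemma RintegralN_real d (T : measurableType d) (R : realType)
    (mu : {measure set T -> \bar R}) (D : set T) (f : T -> R) :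
  \int[mu]_(x in D) (- f x) = - \int[mu]_(x in D) f x.
Proof.
rewrite /Rintegral (integralE _ _ (fun x => (- f x)%:E)) (integralE _ _ (fun x => (f x)%:E)).
rewrite (_ : (fun x => (- f x)%:E) = (\- (fun x => (f x)%:E))%E)//.
rewrite funeposN funenegN.
set a := (\int[mu]_(x in D) _)%E; set b := (\int[mu]_(x in D) _)%E.
have a0 : (0 <= a)%E by apply: integral_ge0.
have b0 : (0 <= b)%E by apply: integral_ge0.
by case: a b a0 b0 => [a||] [b||]//= _ _; rewrite ?opprB ?oppr0.
Qed.

(** Applied to [- u], the one-sided estimate above a level becomes the estimate below a level. *)
Lemma sobolev11N (R : realType) n (U : set 'rV[R]_n) u Du : measurable U ->
  sobolev11 U u Du -> sobolev11 U (fun x => - u x) (fun x => - Du x).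
Proof.
move=> mU [iu iDu wg]; split.
- exact: (integrableN iu).
- by move=> i; under eq_fun do rewrite mxE EFinN; exact: (integrableN (iDu i)).
- move=> phi tphi i; under eq_Rintegral do rewrite mulNr.
  rewrite RintegralN_real wg//; congr (- _).
  by under [RHS]eq_Rintegral do rewrite mxE mulNr; rewrite RintegralN_real.
Qed.

Lemma enormN (R : realType) n (x : 'rV[R]_n) : enorm (- x) = enorm x.
Proof. by rewrite /enorm; congr Num.sqrt; apply: eq_bigr => i _; rewrite mxE sqrrN. Qed.

(** * Two levels that halve the ball *)

Section approximate_median.
Context {R : realType} (n : nat).
Local Notation mu := (lebesgue_rV R n).
Variables (x0 : 'rV[R]_n) (r : R) (u : 'rV[R]_n -> R).
Local Notation B := (eball x0 r).
Hypotheses (n0 : (0 < n)%N) (r0 : 0 < r) (iu : mu.-integrable B (EFin \o u)).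

(* The gap r between the two levels spares an exact median. *)
Lemma approximate_median : exists m,
  ((2^-1)%:E * mu B <= mu (B `&` [set x | (u x <= m)%R]))%E /\
  ((2^-1)%:E * mu B <= mu (B `&` [set x | (m - r <= u x)%R]))%E.
Proof.
have mB : measurable B by exact: measurable_eball.
have mu_ : measurable_fun B u by exact/measurable_EFinP/measurable_int/iu.
pose V := fine (mu B).
have muB : mu B = V%:E.
  by rewrite fineK// ge0_fin_numE//; exact: le_lt_trans (lebesgue_eball_le x0 r0) (ltry _).
have V0 : 0 < V.
  rewrite -lte_fin -muB; apply: lt_le_trans (lebesgue_eball_ge x0 n0 r0).
  by rewrite lte_fin exprn_gt0// mulr_gt0// divr_gt0// ltr0n.
have mle (t : R) : measurable (B `&` [set x | u x <= t]) by exact: measurable_fun_le.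
have mge (t : R) : measurable (B `&` [set x | t <= u x]) by exact: measurable_fun_le.
have mabs (t : R) : measurable (B `&` [set x | t <= `|u x|]).
  by apply: measurable_fun_le => //; exact: (measurableT_comp (@normr_measurable _ _)).
have I0 : (\int[mu]_(x in B) `|(u x)%:E| < +oo)%E by case/integrableP: iu.
pose I := fine (\int[mu]_(x in B) `|(u x)%:E|)%E.
have IE : (\int[mu]_(x in B) `|(u x)%:E| = I%:E)%E.
  by rewrite fineK// ge0_fin_numE//; exact: integral_ge0.
have Ige0 : 0 <= I by rewrite fine_ge0//; exact: integral_ge0.
(* Markov's inequality: T times the measure of [|u| >= T] is at most [I < 2 (I + 1) = T V / 2]. *)
pose T := 4 * (I + 1) / V.
have T0 : 0 < T by rewrite divr_gt0// mulr_gt0// ltr_wpDl.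
have tail : (mu (B `&` [set x | (T <= `|u x|)%R]) < (2^-1 * V)%:E)%E.
  have h : (T%:E * mu (B `&` [set x | (T <= `|u x|)%R]) <= I%:E)%E.
    rewrite -IE -integral_cst//.
    apply: (@le_trans _ _ (\int[mu]_(x in B `&` [set x | (T <= `|u x|)%R]) `|(u x)%:E|)%E).
      by apply: ge0_le_integral_nonmeasurable => x [_ /=]; rewrite lee_fin// => _; exact: ltW.
    apply: ge0_subset_integral; [exact: mabs|exact: mB| |by []|exact: subIsetl].
    by apply: measurableT_comp => //; exact/measurable_EFinP.
  rewrite -(lte_pmul2l _ (_ : 0 < T%:E)%E)//.
  apply: le_lt_trans h _; rewrite -EFinM lte_fin /T.
  have -> : 4 * (I + 1) / V * (2^-1 * V) = 2 * (I + 1) by field; rewrite gt_eqF.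
  by lra.
have split_half (X Y : set 'rV[R]_n) : measurable X -> measurable Y ->
    B `<=` X `|` Y -> (mu Y < (2^-1 * V)%:E)%E -> ((2^-1 * V)%:E <= mu X)%E.
  move=> mX mY BXY Y2; rewrite leNgt; apply/negP => X2.
  have : (mu B < (2^-1 * V)%:E + (2^-1 * V)%:E)%E.
    apply: (@le_lt_trans _ _ (mu (X `|` Y))).
      by apply: le_measure; rewrite ?inE//; exact: measurableU.
    by apply: (le_lt_trans (measureU2 _ mX mY)); exact: lteD.
  by rewrite muB -EFinD lte_fin -mulrDl -[2^-1]mul1r -splitr mul1r ltxx.
have FT : ((2^-1 * V)%:E <= mu (B `&` [set x | (u x <= T)%R]))%E.
  apply: split_half tail => // x Bx /=.
  have [h|h] := leP (u x) T; [by left|right; split => //].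
  by rewrite (le_trans (ltW h))// ler_norm.
have ex : exists j : nat, ((2^-1 * V)%:E <= mu (B `&` [set x | (u x <= - T + j%:R * r)%R]))%E.
  exists (Num.bound (2 * T / r)); apply: (le_trans FT); apply: le_measure; rewrite ?inE//.
  move=> x [Bx /= h]; split => //=; apply: (le_trans h).
  have T2 : 0 <= 2 * T / r by rewrite ltW// divr_gt0// mulr_gt0.
  have := ltW (archi_boundP T2); rewrite ler_pdivrMr//; lra.
(* The least grid index is not 0, by the tail bound. By minimality u stays below the previous grid
   point on less than half of the ball, so the complement has at least half. *)
case: (ex_minnP ex) => -[|j] hj jmin.
  have : (mu (B `&` [set x | (u x <= - T + 0%:R * r)%R]) < (2^-1 * V)%:E)%E.
    apply: le_lt_trans tail; apply: le_measure; rewrite ?inE//.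
    move=> x [Bx /=]; rewrite mul0r addr0 => h; split => //=.
    by rewrite -normrN (le_trans _ (ler_norm _))// lerNr.
  by rewrite ltNge hj.
exists (- T + j.+1%:R * r); rewrite muB -EFinM; split=> //.
apply: (split_half _ (B `&` [set x | (u x <= - T + j%:R * r)%R])) => //.
  move=> x Bx /=; have [h|h] := leP (u x) (- T + j%:R * r); [by right|left; split => //].
  by rewrite -natr1 mulrDl mul1r addrA addrK ltW.
by rewrite ltNge; apply/negP => /jmin; rewrite ltnn.
Qed.

End approximate_median.

(** * Variable exponents *)

Section sum_power.
Context {R : realType}.
Implicit Types a b c p : R.

Lemma powR_sum3_le a b c p : 0 <= p -> 0 <= a -> 0 <= b -> 0 <= c ->
  (a + b + c) `^ p <= 3 `^ p * (a `^ p + b `^ p + c `^ p).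
Proof.
move=> p0 a0 b0 c0.
pose d := Num.max a (Num.max b c).
have [ad bd cd] : [/\ a <= d, b <= d & c <= d] by rewrite /d !le_max !lexx !orbT.
have d0 : 0 <= d by exact: le_trans ad.
apply: (@le_trans _ _ ((3 * d) `^ p)).
  by apply: ge0_ler_powR; rewrite ?nnegrE ?addr_ge0 ?mulr_ge0//; lra.
rewrite powRM// ler_wpM2l ?powR_ge0//.
have := powR_ge0 a p; have := powR_ge0 b p; have := powR_ge0 c p.
rewrite /d => ? ? ?; case: (leP b c) => _; case: (leP a _) => _; lra.
Qed.

(** Trades an exponent for a larger one at the cost of 1; this is how variable exponents are
    compared with constant ones. *)
Lemma powR_le1D a p q : 0 <= a -> 0 < p -> p <= q -> a `^ p <= 1 + a `^ q.
Proof.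
move=> a0 p0 pq; have [a1|a1] := leP a 1.
  apply: (@le_trans _ _ (1 `^ p)); last by rewrite powR1 lerDl powR_ge0.
  by apply: ge0_ler_powR; rewrite ?nnegrE// ltW.
by apply: (@le_trans _ _ (a `^ q)); [rewrite ler_powR// ltW|rewrite lerDr].
Qed.

Lemma dyadic_const_le (C nu p q : R) : 0 <= C -> 0 <= nu -> 0 <= p -> p <= q ->
  dyadic_const C nu p <= dyadic_const C nu q.
Proof.
move=> C0 nu0 p0 pq; rewrite /dyadic_const.
set a := (C * (2 `^ p + 2)) `^ nu^-1; set b := (C * (2 `^ q + 2)) `^ nu^-1.
have ab : a <= b.
  apply: ge0_ler_powR; rewrite ?nnegrE ?invr_ge0 ?mulr_ge0 ?addr_ge0 ?powR_ge0//.
  by rewrite ler_wpM2l// lerD2r ler_powR// ler1n.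
have a0 : 0 <= a by exact: powR_ge0.
have b0 : 0 <= b by exact: powR_ge0.
clearbody a b; apply: (@le_trans _ _ ((b + 1) `^ p)).
  by apply: ge0_ler_powR; rewrite ?nnegrE ?addr_ge0 ?lerD2r.
by rewrite ler_powR// lerDr.
Qed.

End sum_power.

(** * From constant to variable exponents *)

Section variable_exponent_estimate.
Context {R : realType} (n : nat).
Local Notation mu := (lebesgue_rV R n).
Hypothesis n2 : (2 <= n)%N.
Variables (x0 : 'rV[R]_n) (r : R) (r_gt0 : 0 < r).
Local Notation B := (eball x0 r).
Variables (p1 w q M : R).
Hypotheses (q1 : 1 <= q) (qp1 : q <= p1) (w0 : 0 <= w)
  (qw : q + w <= n%:R / (n%:R - 1)) (pM : p1 + w <= M) (M2 : 2 <= M).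

Let nu : R := 1 - n%:R^-1.
(** The constant of [truncated_sobolev] with P replaced by its upper bound M, so that only n, M and
    gamma enter. *)
Definition sobolev_const (gamma : R) : R :=
  1 + 4 `^ M * dyadic_const (8 * n%:R * (2 * n%:R) ^+ (n - 1) / gamma) (1 - n%:R^-1) M.

Let s := p1 / q.
Let P := Num.max (p1 + w) (n%:R / (n%:R - 1)).
Let nR2 : 2 <= n%:R :> R. Proof. by rewrite ler_nat. Qed.
Let s1 : 1 <= s. Proof. by rewrite ler_pdivlMr ?mul1r// (lt_le_trans ltr01). Qed.
Let s0 : 0 < s. Proof. exact: lt_le_trans s1. Qed.
Let nu0 : 0 < nu. Proof. by rewrite subr_gt0 invf_lt1 ?ltr1n// ltr0n (ltn_trans _ n2). Qed.
Let N2 : n%:R / (n%:R - 1) <= 2 :> R.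
Proof.
have := nR2; set N := n%:R; move: N => N N2.
by rewrite ler_pdivrMr; lra.
Qed.
Let PM : P <= M. Proof. by rewrite ge_max pM (le_trans N2). Qed.
Let Nnu : n%:R / (n%:R - 1) * nu = 1.
Proof.
rewrite /nu; have := nR2; move: (n%:R : R) => N N2'.
by field; rewrite !gt_eqF; lra.
Qed.
Let Pnu : 1 <= P * nu.
Proof. by rewrite -Nnu ler_pM2r// le_max lexx orbT. Qed.
Let P0 : 0 < P. Proof. by rewrite -(pmulr_lgt0 _ nu0) (lt_le_trans ltr01). Qed.
Let p2P : p1 + w <= P. Proof. by rewrite le_max lexx. Qed.

(** The claim is [q / p1 <= 1/n + 1/P]. If [P = n/(n-1)], the right side is 1. If [P = p1 + w],
    multiply by p1: since [(p1 + w)/n >= 1/(n-1)] and [w/(p1 + w) <= w (1 - 1/n)], the right side is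
    at least [n/(n-1) - w], which is the bound on q. *)
Let sP : (P * nu - 1) / P + s^-1 <= 1.
Proof.
have p10 : 0 < p1 by rewrite (lt_le_trans ltr01)// (le_trans q1).
rewrite mulrBl mulrAC mulfV ?gt_eqF// mul1r mul1r /s invf_div /nu.
suff : q / p1 <= n%:R^-1 + P^-1 by lra.
rewrite ler_pdivrMr//.
have [h|h] := leP (n%:R / (n%:R - 1)) (p1 + w).
  rewrite (_ : P = p1 + w); last exact/max_idPl.
  have p20 : 0 < p1 + w by rewrite ltr_wpDr.
  apply: (@le_trans _ _ (n%:R / (n%:R - 1) - w)); first by rewrite lerBrDr.
  have wP : w / (p1 + w) <= w * (1 - n%:R^-1).
    rewrite ler_wpM2l// -[leRHS]invrK lef_pV2 ?posrE ?invr_gt0//.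
    by rewrite (_ : (1 - n%:R^-1)^-1 = n%:R / (n%:R - 1))// -[RHS](mulfK (lt0r_neq0 nu0)) Nnu mul1r.
  have hN : (n%:R - 1)^-1 <= (p1 + w) / n%:R.
    rewrite ler_pdivlMr; last by rewrite (lt_le_trans _ nR2).
    by rewrite mulrC.
  have -> : (n%:R^-1 + (p1 + w)^-1) * p1 = (p1 + w) / n%:R + 1 - w / n%:R - w / (p1 + w).
    have := nR2; move: (n%:R : R) => N N2'.
    by field; rewrite !gt_eqF//; lra.
  have -> : n%:R / (n%:R - 1) = 1 + (n%:R - 1)^-1 :> R.
    have := nR2; move: (n%:R : R) => N N2'.
    by field; rewrite !gt_eqF//; lra.
  lra.
have -> : P = n%:R / (n%:R - 1) by apply/max_idPr/ltW.
rewrite (_ : n%:R^-1 + _ = 1 :> R) ?mul1r//.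
have := nR2; move: (n%:R : R) => N N2'.
by field; rewrite !gt_eqF//; lra.
Qed.

Variables (A : R) (A0 : 0 <= A).
Let D := (1 + A) `^ s^-1.
Let A1 : 0 < 1 + A. Proof. by rewrite ltr_pwDl. Qed.
Let D0 : 0 < D. Proof. exact: powR_gt0. Qed.
Let Ds : D `^ s = 1 + A.
Proof. by rewrite /D -powRrM mulVf ?gt_eqF// powRr1// ltW. Qed.

Let mB : measurable B. Proof. exact: measurable_eball. Qed.
Let V : R := fine (mu B).
Let muB : mu B = V%:E.
Proof.
rewrite fineK// ge0_fin_numE//.
exact: le_lt_trans (lebesgue_eball_le x0 r_gt0) (ltry _).
Qed.
Let V0 : 0 <= V. Proof. exact: fine_ge0. Qed.

Lemma truncated_variable u Du (p : 'rV[R]_n -> R) gamma m :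
  sobolev11 B u Du -> 0 < gamma ->
  (forall x, B x -> p1 <= p x) ->
  (\int[mu]_(x in B) (enorm (Du x) `^ (p x / q))%:E <= A%:E * mu B)%E ->
  (gamma%:E * mu B <= mu (B `&` [set x | (u x <= m)%R]))%E ->
  (\int[mu]_(x in B) ((Num.max (u x - m) 0 / (r * D)) `^ P)%:E <=
   (sobolev_const gamma)%:E * mu B)%E.
Proof.
move=> sob gamma0 hp intA below.
have mDu : measurable_fun B (fun x => enorm (Du x)).
  case: sob => _ iDu _.
  by apply: measurable_enorm => i; apply/measurable_EFinP; exact: measurable_int (iDu i).
have mDs : measurable_fun B (fun x => enorm (Du x) `^ s).
  exact: (measurableT_comp (measurable_powR s)).
have grad : (\int[mu]_(x in B) (enorm (Du x) `^ s)%:E <= (D `^ s)%:E * mu B)%E.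
  (* The truncation [max (|Du|^s - 1, 0)] is measurable and still lies below [|Du|^(p x / q)], so
     additivity is applied to measurable functions only. *)
  apply: (@le_trans _ _ (\int[mu]_(x in B) (1 + (Num.max (enorm (Du x) `^ s - 1) 0)%:E))%E).
    apply: ge0_le_integral_nonmeasurable => x _; first by rewrite lee_fin powR_ge0.
    by rewrite -EFinD lee_fin -lerBlDl le_max lexx.
  rewrite ge0_integralD//; last first.
  - apply/measurable_EFinP; apply: measurable_maxr => //; exact: measurable_funB.
  rewrite integral_cst// Ds EFinD muleDl//; last by rewrite muB.
  apply: leeD => //; apply: le_trans intA.
  apply: ge0_le_integral_nonmeasurable => x Bx; first by rewrite lee_fin le_max lexx orbT.
  rewrite lee_fin ge_max powR_ge0 andbT lerBlDl.
  apply: powR_le1D => //; first exact: enorm_ge0.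
  by rewrite ler_pM2r ?invr_gt0 ?(lt_le_trans ltr01 q1)//; exact: hp.
apply: (le_trans (truncated_sobolev n2 r_gt0 sob D0 s1 gamma0 Pnu sP below grad)).
apply: lee_wpmul2r; [exact: measure_ge0|rewrite lee_fin /sobolev_const].
set C := _ / gamma.
have C0 : 0 <= C.
  by rewrite divr_ge0 ?(ltW gamma0)// mulr_ge0 ?exprn_ge0// mulr_ge0.
clearbody C; rewrite lerD2l; apply: ler_pM.
- exact: powR_ge0.
- exact: powR_ge0.
- by apply: ler_powR PM; rewrite ler1n.
- exact: (dyadic_const_le C0 (ltW nu0) (ltW P0) PM).
Qed.

(** With [z = g / (r D)], [(g/r)^(p x)] is at most [1 + D^(p1 + w) (1 + z^P)]. As a power of
    [1 + A], the factor [D^(p1 + w)] has exponent [q + q w / p1 <= q + w], the exponent of the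
    theorem; [q + w <= 2] gives the factor 4. *)
Lemma variable_of_constant (g p : 'rV[R]_n -> R) (C : R) : 0 <= C ->
  measurable_fun B g -> (forall x, 0 <= g x) ->
  (forall x, B x -> p1 <= p x <= p1 + w) ->
  (\int[mu]_(x in B) ((g x / (r * D)) `^ P)%:E <= C%:E * mu B)%E ->
  (\int[mu]_(x in B) ((g x / r) `^ p x)%:E <=
   ((1 + 4 * (1 + C)) * (1 + A `^ (q + w)))%:E * mu B)%E.
Proof.
move=> C0 mg g0 hp intg.
have p10 : 0 < p1 by rewrite (lt_le_trans ltr01)// (le_trans q1).
have rD0 : 0 < r * D by rewrite mulr_gt0.
pose z x := g x / (r * D).
have z0 x : 0 <= z x by rewrite divr_ge0// ltW.
have mz : measurable_fun B (fun x => (z x `^ P)%:E).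
  by apply/measurable_EFinP; apply: (measurableT_comp (measurable_powR P)); exact: measurable_funM.
pose Q := D `^ (p1 + w).
have Q0 : 0 <= Q by exact: powR_ge0.
apply: (@le_trans _ _ (\int[mu]_(x in B) ((1 + Q)%:E + Q%:E * (z x `^ P)%:E))%E).
  apply: ge0_le_integral_nonmeasurable => x Bx; first by rewrite lee_fin powR_ge0.
  have /andP[h1 h2] := hp x Bx.
  have -> : g x / r = D * z x by rewrite /z; field; rewrite !gt_eqF.
  rewrite -EFinM -EFinD lee_fin.
  apply: (@le_trans _ _ (1 + (D * z x) `^ (p1 + w))).
    exact: powR_le1D (mulr_ge0 (ltW D0) (z0 x)) (lt_le_trans p10 h1) h2.
  rewrite -addrA lerD2l powRM ?(ltW D0)// -/Q -{2}[Q]mulr1 -mulrDr ler_wpM2l//.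
  exact: powR_le1D (z0 x) (ltr_wpDr w0 p10) p2P.
rewrite ge0_integralD//; last 3 first.
- by move=> x _; rewrite lee_fin addr_ge0.
- by move=> x _; rewrite -EFinM lee_fin mulr_ge0 ?powR_ge0.
- exact: measurable_funeM.
rewrite integral_cst// ge0_integralZl//; last by move=> x _; rewrite lee_fin powR_ge0.
apply: (@le_trans _ _ ((1 + Q)%:E * mu B + Q%:E * (C%:E * mu B))%E).
  by apply: leeD => //; apply: lee_wpmul2l.
rewrite muB -!EFinM -EFinD lee_fin mulrA -mulrDl ler_wpM2r//.
have QA : Q <= 4 * (1 + A `^ (q + w)).
  have -> : Q = (1 + A) `^ (s^-1 * (p1 + w)) by rewrite /Q /D -powRrM.
  have e0 : 0 < q + w by rewrite ltr_wpDr// (lt_le_trans ltr01).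
  apply: (@le_trans _ _ ((1 + A) `^ (q + w))).
    rewrite ler_powR ?lerDl// /s invf_div mulrDr divfK ?gt_eqF// lerD2l.
    by rewrite ler_piMl// ler_pdivrMr// mul1r.
  have e2 : q + w <= 2 by exact: le_trans qw N2.
  pose d := Num.max 1 A.
  have d1 : 1 <= d by rewrite le_max lexx.
  have d0 : 0 <= d by exact: le_trans d1.
  apply: (@le_trans _ _ ((2 * d) `^ (q + w))).
    apply: ge0_ler_powR; rewrite ?nnegrE ?(ltW e0) ?(ltW A1) ?mulr_ge0//.
    by have : A <= d by [rewrite le_max lexx orbT]; lra.
  rewrite powRM// ler_pM ?powR_ge0//.
    by rewrite (_ : 4 = 2 `^ 2%:R) ?ler_powR ?ler1n// powR_mulrn// -natrX.
  by rewrite /d; case: (leP 1 A) => _; rewrite ?powR1 ?lerDl ?lerDr ?powR_ge0 ?ler01.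
have X0 : 0 <= A `^ (q + w) by exact: powR_ge0.
have : Q * (1 + C) <= 4 * (1 + A `^ (q + w)) * (1 + C) by rewrite ler_wpM2r// addr_ge0.
lra.
Qed.

Lemma sobolev_const_ge0 gamma : 0 <= sobolev_const gamma.
Proof. by rewrite addr_ge0// mulr_ge0//; exact: powR_ge0. Qed.

Section two_sided.
Variables (u : 'rV[R]_n -> R) (Du : 'rV[R]_n -> 'rV[R]_n) (p : 'rV[R]_n -> R).
Variables (gamma m1 m2 : R).
Hypotheses (sob : sobolev11 B u Du) (gamma0 : 0 < gamma)
  (hp : forall x, B x -> p1 <= p x <= p1 + w)
  (intA : (\int[mu]_(x in B) (enorm (Du x) `^ (p x / q))%:E <= A%:E * mu B)%E)
  (below : (gamma%:E * mu B <= mu (B `&` [set x | (u x <= m2)%R]))%E)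
  (above : (gamma%:E * mu B <= mu (B `&` [set x | (m1 <= u x)%R]))%E).

Let zp x := Num.max (u x - m2) 0 / (r * D).
Let zm x := Num.max (m1 - u x) 0 / (r * D).
Let rD0 : 0 < r * D. Proof. exact: mulr_gt0. Qed.
Let zp0 x : 0 <= zp x. Proof. by rewrite divr_ge0 ?(ltW rD0)// le_max lexx orbT. Qed.
Let zm0 x : 0 <= zm x. Proof. by rewrite divr_ge0 ?(ltW rD0)// le_max lexx orbT. Qed.
Let mu_ : measurable_fun B u.
Proof. by case: sob => /measurable_int/measurable_EFinP. Qed.
Let mzp : measurable_fun B (fun x => (zp x `^ P)%:E).
Proof.
apply/measurable_EFinP; apply: (measurableT_comp (measurable_powR P)).
apply: measurable_funM => //; apply: measurable_maxr => //; exact: measurable_funB.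
Qed.
Let mzm : measurable_fun B (fun x => (zm x `^ P)%:E).
Proof.
apply/measurable_EFinP; apply: (measurableT_comp (measurable_powR P)).
apply: measurable_funM => //; apply: measurable_maxr => //; exact: measurable_funB.
Qed.

Let intzp : (\int[mu]_(x in B) (zp x `^ P)%:E <= (sobolev_const gamma)%:E * mu B)%E.
Proof.
by apply: truncated_variable sob gamma0 _ intA below => x /hp /andP[].
Qed.
Let intzm : (\int[mu]_(x in B) (zm x `^ P)%:E <= (sobolev_const gamma)%:E * mu B)%E.
Proof.
have -> : (\int[mu]_(x in B) (zm x `^ P)%:E =
    \int[mu]_(x in B) ((Num.max (- u x - - m1) 0 / (r * D)) `^ P)%:E)%E.
  by apply: eq_integral => x _; rewrite /zm opprK [- u x + m1]addrC.
apply: (truncated_variable (p := p) (sobolev11N mB sob) gamma0).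
- by move=> x /hp /andP[].
- by under eq_integral do rewrite enormN.
- apply: (le_trans above); rewrite le_eqVlt; apply/orP; left; apply/eqP; congr (mu (_ `&` _)).
  by apply/seteqP; split => x /=; rewrite lerN2.
Qed.

(** Meant for [v = u - lambda] and for [v = u]; the slack [K * (r * D)] absorbs the distance from
    the subtracted constant to the levels. *)
Lemma two_sided_bound (v : 'rV[R]_n -> R) (K : R) : 1 <= K ->
  measurable_fun B v ->
  (forall x, B x -> `|v x| <= Num.max (u x - m2) 0 + Num.max (m1 - u x) 0 + K * (r * D)) ->
  (\int[mu]_(x in B) (`|v x / r| `^ p x)%:E <=
   ((1 + 4 * (1 + 3 `^ M * (sobolev_const gamma + sobolev_const gamma + K `^ M))) *
    (1 + A `^ (q + w)))%:E * mu B)%E.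
Proof.
move=> K1 mv vle.
have K0 : 0 <= K by exact: le_trans K1.
move: (sobolev_const gamma) (sobolev_const_ge0 gamma) intzp intzm => S S0 hzp hzm.
have -> : (\int[mu]_(x in B) (`|v x / r| `^ p x)%:E =
    \int[mu]_(x in B) ((`|v x| / r) `^ p x)%:E)%E.
  by apply: eq_integral => x _; rewrite normrM normfV (gtr0_norm r_gt0).
apply: variable_of_constant => //.
- by rewrite mulr_ge0 ?addr_ge0 ?powR_ge0.
- exact: measurableT_comp.
apply: (@le_trans _ _ (\int[mu]_(x in B) ((3 `^ P)%:E * ((zp x `^ P)%:E + (zm x `^ P)%:E + (K `^ P)%:E)))%E).
  apply: ge0_le_integral_nonmeasurable => x Bx; first by rewrite lee_fin powR_ge0.
  rewrite -!EFinD -EFinM lee_fin; apply: le_trans (powR_sum3_le (ltW P0) (zp0 x) (zm0 x) K0).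
  apply: ge0_ler_powR; rewrite ?nnegrE ?(ltW P0)//.
  - by rewrite divr_ge0 ?(ltW rD0).
  - by rewrite !addr_ge0.
  by rewrite ler_pdivrMr// !mulrDl /zp /zm !divfK ?gt_eqF//; exact: vle.
have KP0 : 0 <= 3 `^ P by exact: powR_ge0.
rewrite ge0_integralZl//; last 2 first.
- by apply: emeasurable_funD => //; exact: emeasurable_funD.
- by move=> x _; rewrite -!EFinD lee_fin !addr_ge0 ?powR_ge0.
rewrite ge0_integralD//; last 3 first.
- by move=> x _; rewrite -!EFinD lee_fin !addr_ge0 ?powR_ge0.
- exact: emeasurable_funD.
- by move=> x _; rewrite lee_fin powR_ge0.
rewrite ge0_integralD//; last 2 first.
- by move=> x _; rewrite lee_fin powR_ge0.
- by move=> x _; rewrite lee_fin powR_ge0.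
rewrite integral_cst//.
apply: (@le_trans _ _ ((3 `^ P)%:E * ((S)%:E * mu B + (S)%:E * mu B + (K `^ P)%:E * mu B))%E).
  apply: lee_wpmul2l; first by rewrite lee_fin.
  by apply: leeD; [exact: leeD hzp hzm|exact: lexx].
rewrite muB -!EFinM lee_fin -!mulrDl mulrA (ler_wpM2r V0)//.
apply: ler_pM => //.
- by rewrite !addr_ge0 ?powR_ge0.
- by apply: ler_powR PM; rewrite ler1n.
- by rewrite lerD2l; exact: ler_powR PM.
Qed.

(** An L1 bound, from [z <= 1 + z^P] on both sides; it serves to locate the mean of u relative to
    the upper level. *)
Lemma oscillation_bound : m1 <= m2 ->
  (\int[mu]_(x in B) `|(u x - m2)%:E| <=
   ((m2 - m1 + (2 + sobolev_const gamma + sobolev_const gamma) * (r * D)) * V)%:E)%E.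
Proof.
move=> m12; move: (sobolev_const gamma) (sobolev_const_ge0 gamma) intzp intzm => S S0 hzp hzm.
pose b := m2 - m1 + 2 * (r * D).
apply: (@le_trans _ _ (\int[mu]_(x in B) (b%:E + (r * D)%:E * ((zp x `^ P)%:E + (zm x `^ P)%:E)))%E).
  apply: ge0_le_integral_nonmeasurable => x Bx; first exact: abse_ge0.
  rewrite abse_EFin -[leRHS]/((b + r * D * (zp x `^ P + zm x `^ P))%:E) lee_fin.
  have P1 : 1 <= P.
    by apply: le_trans p2P; rewrite (le_trans q1)// (le_trans qp1)// lerDl.
  have z1 z : 0 <= z -> z <= 1 + z `^ P.
    by move=> z0; rewrite -{1}(powRr1 z0); exact: powR_le1D.
  have hp1 : Num.max (u x - m2) 0 <= r * D * (1 + zp x `^ P).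
    by rewrite mulrC -ler_pdivrMr//; exact: z1 (zp0 x).
  have hm1 : Num.max (m1 - u x) 0 <= r * D * (1 + zm x `^ P).
    by rewrite mulrC -ler_pdivrMr//; exact: z1 (zm0 x).
  have h : `|u x - m2| <= m2 - m1 + Num.max (u x - m2) 0 + Num.max (m1 - u x) 0.
    have a1 : u x - m2 <= Num.max (u x - m2) 0 by rewrite le_max lexx.
    have a2 : 0 <= Num.max (u x - m2) 0 by rewrite le_max lexx orbT.
    have a3 : m1 - u x <= Num.max (m1 - u x) 0 by rewrite le_max lexx.
    have a4 : 0 <= Num.max (m1 - u x) 0 by rewrite le_max lexx orbT.
    by rewrite ler_norml; apply/andP; split; lra.
  by apply: (le_trans h); rewrite /b; lra.
have zz0 x : (0 <= (zp x `^ P)%:E + (zm x `^ P)%:E)%E.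
  by apply: adde_ge0; rewrite lee_fin powR_ge0.
have b0 : 0 <= b by rewrite addr_ge0 ?subr_ge0// mulr_ge0// ltW.
rewrite ge0_integralD//; last 2 first.
- by move=> x _; apply: mule_ge0; [rewrite lee_fin ltW|exact: zz0].
- by apply: measurable_funeM; exact: emeasurable_funD.
rewrite integral_cst// ge0_integralZl//; last 2 first.
- exact: emeasurable_funD.
- by rewrite lee_fin ltW.
rewrite ge0_integralD//; last 2 first.
- by move=> x _; rewrite lee_fin powR_ge0.
- by move=> x _; rewrite lee_fin powR_ge0.
apply: (@le_trans _ _ (b%:E * mu B + (r * D)%:E * (S%:E * mu B + S%:E * mu B))%E).
  apply: leeD; first exact: lexx.
  apply: lee_wpmul2l; first by rewrite lee_fin ltW.
  exact: leeD hzp hzm.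
rewrite muB -!EFinM lee_fin /b le_eqVlt; apply/orP; left; apply/eqP; ring.
Qed.

End two_sided.

End variable_exponent_estimate.

(** * Parameters on the ball and assembly *)

Lemma exponents_on_ball (R : realType) (n : nat) (n2 : (2 <= n)%N)
    (Omega : set 'rV[R]_n) p (alpha beta r0 : R) omega (r q : R) x0 :
  variable_exponent Omega p alpha beta r0 omega ->
  0 < r <= r0 ->
  1 <= q <= Num.min alpha (n%:R / (n%:R - 1) - omega r0) ->
  eball x0 r `<=` Omega ->
  exists p1, [/\ q <= p1, 0 <= omega r, q + omega r <= n%:R / (n%:R - 1),
    p1 + omega r <= Num.max (beta + 1) 2 &
    forall x, eball x0 r x -> p1 <= p x <= p1 + omega r].
Proof.
move=> ve /andP[r_gt0 rr0] /andP[q1]; rewrite le_min => /andP[qa qn] BO.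
have Bx0 : eball x0 r x0.
  by rewrite /eball /= subrr /enorm big1 ?sqrtr0// => i _; rewrite mxE expr0n.
have or := (ve_omega_nondecreasing ve (ltW r_gt0) rr0).
have lbp : lbound (p @` eball x0 r) alpha.
  by move=> _ [x Bx <-]; have /andP[] := ve_p_bounds ve (BO _ Bx).
have nep : (p @` eball x0 r) !=set0 by exists (p x0); exists x0.
have p1le x : eball x0 r x -> inf (p @` eball x0 r) <= p x.
  by move=> Bx; apply: ge_inf; [exists alpha|exists x].
exists (inf (p @` eball x0 r)); split.
- exact: le_trans qa (lb_le_inf nep lbp).
- exact/(ve_omega_ge0 ve)/ltW.
- by rewrite -lerBrDr (le_trans qn)// lerD2l lerN2.
- rewrite le_max; apply/orP; left; apply: lerD.
    by apply: (le_trans (p1le _ Bx0)); have /andP[] := ve_p_bounds ve (BO _ Bx0).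
  exact: le_trans or (ltW (ve_omega_r0_lt1 ve)).
move=> x Bx; rewrite p1le//= -lerBlDr.
apply: lb_le_inf => // _ [y By <-]; rewrite lerBlDr -lerBlDl.
apply: (le_trans (ler_norm _)); apply: (le_trans (ve_p_modulus ve (BO _ Bx) (BO _ By))).
(* Points of the ball are less than [2 r] apart, so the halved distance in the modulus is below r
   and the oscillation of p is at most [omega r]. *)
apply: (ve_omega_nondecreasing ve); first by rewrite divr_ge0// enorm_ge0.
by rewrite ler_pdivrMr// [r * 2]mulrC ltW// (eball_diff r_gt0 Bx By).
Qed.

(** Reduces to a finite average A of g: if the integral of g is infinite, the right side is [+oo],
    because c and e are positive. *)
Lemma eaverage_le (R : realType) n (B : set 'rV[R]_n) (f g : 'rV[R]_n -> \bar R)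
    (V c e : R) : lebesgue_rV R n B = V%:E -> 0 < V -> 0 < c -> 0 < e ->
  (forall x, B x -> 0 <= g x)%E ->
  (forall A, 0 <= A ->
     (\int[lebesgue_rV R n]_(x in B) g x <= A%:E * lebesgue_rV R n B)%E ->
     (\int[lebesgue_rV R n]_(x in B) f x <=
      (c * (1 + A `^ e))%:E * lebesgue_rV R n B)%E) ->
  (eaverage B f <= c%:E + c%:E * eaverage B g `^ e)%E.
Proof.
move=> muB V0 c0 e0 g0 H; rewrite /eaverage muB /=.
have Vn : V != 0 by rewrite gt_eqF.
have Vi : 0 < V^-1 by rewrite invr_gt0.
have : (0 <= \int[lebesgue_rV R n]_(x in B) g x)%E by exact: integral_ge0.
case E : (\int[lebesgue_rV R n]_(x in B) g x)%E => [I||]// I0.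
  have A0 : 0 <= V^-1 * I by rewrite mulr_ge0 ?(ltW Vi).
  have := H _ A0; rewrite muB E -EFinM lee_fin mulrAC mulVf// mul1r lexx => /(_ isT) h.
  apply: (@le_trans _ _ (V^-1%:E * ((c * (1 + (V^-1 * I) `^ e))%:E * V%:E))%E).
    by apply: lee_wpmul2l => //; rewrite lee_fin ltW.
  rewrite -[leRHS]/((c + c * (V^-1 * I) `^ e)%:E) lee_fin.
  by rewrite mulrCA mulVf// mulr1 mulrDr mulr1.
by rewrite gt0_muley ?lte_fin// poweRyr ?gt_eqF// gt0_muley ?lte_fin// addey// leey.
Qed.

Definition poincare_const (R : realType) (n : nat) (M gamma K : R) : R :=
  1 + 4 * (1 + 3 `^ M * (sobolev_const n M gamma + sobolev_const n M gamma + K `^ M)).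

Lemma poincare_const_gt0 (R : realType) (n : nat) (M gamma K : R) :
  0 < poincare_const n M gamma K.
Proof.
have S0 := sobolev_const_ge0 n M gamma.
rewrite ltr_pwDl// mulr_ge0// addr_ge0// mulr_ge0 ?powR_ge0//.
by apply: addr_ge0; [exact: addr_ge0|exact: powR_ge0].
Qed.

Lemma eball_fin_measure (R : realType) (n : nat) (x0 : 'rV[R]_n) (r : R) :
  (0 < n)%N -> 0 < r -> exists2 V, 0 < V & lebesgue_rV R n (eball x0 r) = V%:E.
Proof.
move=> n0 r0; have h : lebesgue_rV R n (eball x0 r) \is a fin_num.
  by rewrite ge0_fin_numE//; exact: le_lt_trans (lebesgue_eball_le x0 r0) (ltry _).
exists (fine (lebesgue_rV R n (eball x0 r))); last by rewrite fineK.
rewrite -lte_fin fineK//; apply: lt_le_trans (lebesgue_eball_ge x0 n0 r0).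
by rewrite lte_fin exprn_gt0// mulr_gt0// divr_gt0// ltr0n.
Qed.

Lemma average_dist (R : realType) (n : nat) (B : set 'rV[R]_n) (u : 'rV[R]_n -> R)
    (V m b : R) : measurable B -> lebesgue_rV R n B = V%:E -> 0 < V ->
  (lebesgue_rV R n).-integrable B (EFin \o u) ->
  (\int[lebesgue_rV R n]_(x in B) `|(u x - m)%:E| <= (b * V)%:E)%E ->
  `|average B u - m| <= b.
Proof.
move=> mB muB V0 iu h.
have Vn : V != 0 by rewrite gt_eqF.
have im : (lebesgue_rV R n).-integrable B (EFin \o (fun=> m)).
  apply/integrableP; split; first exact: measurable_cst.
  have -> : (\int[lebesgue_rV R n]_(x in B) `|(EFin \o (fun=> m)) x| =
      `|m|%:E * lebesgue_rV R n B)%E by exact: integral_cst.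
  by rewrite muB -EFinM ltry.
have -> : average B u - m = V^-1 * \int[lebesgue_rV R n]_(x in B) (u x - m).
  have cst : \int[lebesgue_rV R n]_(x in B) m = m * fine (lebesgue_rV R n B).
    exact: Rintegral_cst.
  rewrite RintegralB// cst muB /= mulrBr /average muB /=.
  by rewrite [m * V]mulrC mulrA mulVf// mul1r.
rewrite normrM gtr0_norm ?invr_gt0// ler_pdivrMl//.
have iD : (lebesgue_rV R n).-integrable B (EFin \o (fun x => u x - m)).
  by have := integrableB mB iu im; apply: eq_integrable => // x _; rewrite /= EFinB.
apply: (le_trans (le_normr_Rintegral mB iD)).
rewrite -lee_fin /Rintegral fineK ?[V * b]mulrC//.
by rewrite ge0_fin_numE ?integral_ge0//; exact: le_lt_trans h (ltry _).
Qed.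

Theorem theorem3p1 (R : realType) (n : nat) (beta : R) (n_ge2 : (2 <= n)%N) :
  (exists c : R, 0 < c /\
    forall (Omega : set 'rV[R]_n) (p : 'rV[R]_n -> R) (alpha r0 : R)
        (omega : R -> R),
      bounded_domain Omega ->
      variable_exponent Omega p alpha beta r0 omega ->
      omega r0 < 1 / (n%:R - 1) ->
    forall (r q : R) (x0 : 'rV[R]_n),
      0 < r <= r0 ->
      1 <= q <= Num.min alpha (n%:R / (n%:R - 1) - omega r0) ->
      eball x0 r `<=` Omega ->
    forall (u : 'rV[R]_n -> R) (Du : 'rV[R]_n -> 'rV[R]_n),
      sobolev1 (eball x0 r) p u Du ->
      let lambda := average (eball x0 r) u in
      (eaverage (eball x0 r) (fun x => (`|(u x - lambda) / r| `^ p x)%R%:E)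
       <= c%:E + c%:E *
          eaverage (eball x0 r) (fun x => (enorm (Du x) `^ (p x / q))%R%:E)
            `^ (q + omega r))%E) /\
  (forall gamma : R, 0 < gamma < 1 ->
   exists c : R, 0 < c /\
    forall (Omega : set 'rV[R]_n) (p : 'rV[R]_n -> R) (alpha r0 : R)
        (omega : R -> R),
      bounded_domain Omega ->
      variable_exponent Omega p alpha beta r0 omega ->
      omega r0 < 1 / (n%:R - 1) ->
    forall (r q : R) (x0 : 'rV[R]_n),
      0 < r <= r0 ->
      1 <= q <= Num.min alpha (n%:R / (n%:R - 1) - omega r0) ->
      eball x0 r `<=` Omega ->
    forall (u : 'rV[R]_n -> R) (Du : 'rV[R]_n -> 'rV[R]_n),
      sobolev1 (eball x0 r) p u Du ->
      (gamma%:E * lebesgue_rV R n (eball x0 r)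
       <= lebesgue_rV R n (eball x0 r `&` [set x | u x = 0%R]))%E ->
      (eaverage (eball x0 r) (fun x => (`|u x / r| `^ p x)%R%:E)
       <= c%:E + c%:E *
          eaverage (eball x0 r) (fun x => (enorm (Du x) `^ (p x / q))%R%:E)
            `^ (q + omega r))%E).
Proof.
have n0 : (0 < n)%N by exact: ltn_trans n_ge2.
pose M := Num.max (beta + 1) 2.
have M2 : 2 <= M by rewrite le_max lexx orbT.
split=> [|gamma /andP[gamma0 _]].
  (* With S the Sobolev constant, [|u - lambda|] is at most the two truncations plus
     [r + |lambda - m|], and [|lambda - m| <= r + (2 + 2 S) r D] by [oscillation_bound]. Since
     [D >= 1], the total is at most [(4 + 2 S) r D]. *)
  pose K := 4 + sobolev_const n M 2^-1 + sobolev_const n M 2^-1.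
  exists (poincare_const n M 2^-1 K); split; first exact: poincare_const_gt0.
  move=> Omega p alpha r0 omega _ ve _ r q x0 r_r0 q_b BO u Du [sob _]; cbv zeta; set lambda := average _ u.
  have [p1 [qp1 w0 qw pM hp]] := exponents_on_ball n_ge2 ve r_r0 q_b BO.
  have /andP[r_gt0 _] := r_r0; have /andP[q1 _] := q_b.
  have [V V0 muB] := eball_fin_measure x0 n0 r_gt0.
  have mB : measurable (eball x0 r) by exact: measurable_eball.
  apply: (eaverage_le muB V0); [exact: poincare_const_gt0| | |] => [||A A0 intA].
  - by rewrite ltr_pwDl// (lt_le_trans ltr01).
  - by move=> x _; rewrite lee_fin powR_ge0.
  have iu : (lebesgue_rV R n).-integrable (eball x0 r) (EFin \o u) by case: sob.
  have [m [below above]] := approximate_median n0 r_gt0 iu.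
  have h0 : 0 < 2^-1 :> R by rewrite invr_gt0.
  have S0 := sobolev_const_ge0 n M 2^-1.
  apply: (two_sided_bound n_ge2 r_gt0 q1 qp1 w0 qw pM M2 A0 sob h0 hp intA below above).
  - by rewrite /K; lra.
  - case: sob => /measurable_int/measurable_EFinP mu_ _ _.
    exact: measurable_funB.
  have m12 : m - r <= m by rewrite lerBlDr lerDl ltW.
  have osc := oscillation_bound n_ge2 r_gt0 q1 qp1 w0 qw pM M2 A0 sob h0 hp intA below above m12.
  set D := (1 + A) `^ _ in osc *.
  have D1 : 1 <= D.
    rewrite -(powRr0 (1 + A)) /D ler_powR ?lerDl// invr_ge0 divr_ge0// ?(le_trans _ q1)//.
    by rewrite (le_trans _ qp1)// (le_trans _ q1).
  move: osc; rewrite muB => osc.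
  have := average_dist mB muB V0 iu osc; rewrite -/lambda => lam x _.
  have rD : r <= r * D by rewrite ler_pMr.
  move: lam S0; rewrite /K; move: (sobolev_const n M 2^-1) => S.
  rewrite ler_norml => /andP[lam1 lam2] S0.
  have a1 : u x - m <= Num.max (u x - m) 0 by rewrite le_max lexx.
  have a2 : 0 <= Num.max (u x - m) 0 by rewrite le_max lexx orbT.
  have a3 : m - r - u x <= Num.max (m - r - u x) 0 by rewrite le_max lexx.
  have a4 : 0 <= Num.max (m - r - u x) 0 by rewrite le_max lexx orbT.
  by rewrite ler_norml; apply/andP; split; lra.
(* Both levels are 0, the zero set being contained in [u <= 0] and in [u >= 0]; 1 is the least K
   that [two_sided_bound] admits. *)
exists (poincare_const n M gamma 1); split; first exact: poincare_const_gt0.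
move=> Omega p alpha r0 omega _ ve _ r q x0 r_r0 q_b BO u Du [sob _] zero.
have [p1 [qp1 w0 qw pM hp]] := exponents_on_ball n_ge2 ve r_r0 q_b BO.
have /andP[r_gt0 _] := r_r0; have /andP[q1 _] := q_b.
have [V V0 muB] := eball_fin_measure x0 n0 r_gt0.
apply: (eaverage_le muB V0); [exact: poincare_const_gt0| | |] => [||A A0 intA].
- by rewrite ltr_pwDl// (lt_le_trans ltr01).
- by move=> x _; rewrite lee_fin powR_ge0.
have mu_ : measurable_fun (eball x0 r) u by case: sob => /measurable_int/measurable_EFinP.
have mzero : measurable (eball x0 r `&` [set x | u x = 0]).
  by have := mu_ (measurable_eball x0 r) _ (measurable_set1 (0 : R)).
have below : (gamma%:E * lebesgue_rV R n (eball x0 r) <=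
    lebesgue_rV R n (eball x0 r `&` [set x | (u x <= 0)%R]))%E.
  apply: (le_trans zero); apply: le_measure; rewrite ?inE//.
    exact: measurable_sub_level sob 0.
  by move=> x [Bx /= ->]; split => /=.
have above : (gamma%:E * lebesgue_rV R n (eball x0 r) <=
    lebesgue_rV R n (eball x0 r `&` [set x | (0 <= u x)%R]))%E.
  apply: (le_trans zero); apply: le_measure; rewrite ?inE//.
    exact: measurable_super_level sob 0.
  by move=> x [Bx /= ->]; split => /=.
apply: (two_sided_bound n_ge2 r_gt0 q1 qp1 w0 qw pM M2 A0 sob gamma0 hp intA below above) => // x _.
rewrite subr0 sub0r mul1r.
have D0 : 0 <= r * (1 + A) `^ (p1 / q)^-1 by rewrite mulr_ge0 ?powR_ge0// ltW.
have a1 : u x <= Num.max (u x) 0 by rewrite le_max lexx.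
have a2 : 0 <= Num.max (u x) 0 by rewrite le_max lexx orbT.
have a3 : - u x <= Num.max (- u x) 0 by rewrite le_max lexx.
have a4 : 0 <= Num.max (- u x) 0 by rewrite le_max lexx orbT.
by rewrite ler_norml; apply/andP; split; lra.
Qed.
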